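(* Let $T>0$, let $\Omega\subset\mathbb{R}^d$ ($d\ge 1$) be a bounded domain such that the embedding $H^1(\Omega)\subset L^2(\Omega)$ is compact, and let $J,K$ be positive integers. Let $f\colon\mathbb{R}\to\mathbb{R}$ be globally Lipschitz continuous with constant $L$ and $f(0)=f_0$; for $k=1,\ldots,K$ let $w_k\colon\mathbb{R}\to\mathbb{R}$ be globally Lipschitz continuous with constant $L_k$ and $w_k(0)=w_{k0}$. Let $D>0$, $\beta_1,\ldots,\beta_J>0$ and $y^*\in L^\infty(0,T;L^2(\Omega))$. Let $R^U>0$ and $R^0>0$. For $i=1,2$ let $\hat u^i=(g_j^i,h_k^i,\alpha_{jk}^i)_{j=1,\ldots,J}^{k=1,\ldots,K}\in U$ with $\|\hat u^i\|_U\le R^U$, let $(y_0^i,\kappa_{10}^i,\ldots,\kappa_{J0}^i)\in X^0$ with $\|(y_0^i,\kappa_{10}^i,\ldots,\kappa_{J0}^i)\|_{X^0}\le R^0$, and let $(y^i,\kappa_1^i,\ldots,\kappa_J^i)\in X^2$ be a weak solution of the thermostat control system corresponding to the control $\hat u^i$ and the initial condition $(y_0^i,\kappa_{10}^i,\ldots,\kappa_{J0}^i)$. Denote $y=y^1-y^2$, $\kappa_j=\kappa_j^1-\kappa_j^2$, $\hat u=\hat u^1-\hat u^2$, $y_0=y_0^1-y_0^2$ and $\kappa_{j0}=\kappa_{j0}^1-\kappa_{j0}^2$. Then $$\|(y,\kappa_1,\ldots,\kappa_J)\|_{X^2}\le C\left(\|\hat u\|_U^2+\|(y_0,\kappa_{10},\ldots,\kappa_{J0})\|_{X^0}^2\right)^{1/2},$$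 where the constant $C$ depends only on $T$, $|\Omega|$, $K$, $J$, $L$, $f_0$, $L_1,\ldots,L_K$, $w_{10},\ldots,w_{K0}$, $R^U$, $R^0$, $\|y^*\|_{L^2(0,T;L^2(\Omega))}$, $D$, $\beta_1,\ldots,\beta_J$.
   Context: Write $Q_T=\Omega\times(0,T)$; $|\Omega|$ is the Lebesgue measure of $\Omega$. The thermostat control system is, formally, $$y_t-D\Delta y=f(y)+\sum_{j=1}^J g_j(x)\kappa_j(t)\ \text{ on }Q_T,\qquad \frac{\partial y}{\partial n}=0\ \text{ on }\partial\Omega\times(0,T),\qquad y(\cdot,0)=y_0,$$ $$\beta_j\kappa_j'(t)+\kappa_j(t)=W_j(y(\cdot,t),y^*(\cdot,t))\ \text{ on }[0,T],\qquad \kappa_j(0)=\kappa_{j0},\qquad j=1,\ldots,J,$$ where $$W_j(y(\cdot,t),y^*(\cdot,t))=\sum_{k=1}^K\alpha_{jk}\,w_k\Big(\int_\Omega h_k(x)\,(y(x,t)-y^*(x,t))\,dx\Big).$$ Spaces. The control space is $U=(L^2(\Omega))^J\times(L^2(\Omega))^K\times\mathbb{R}^{KJ}$ with the standard product Hilbert norm; its elements (controls) are written $(g_j,h_k,\alpha_{jk})_{j=1,\ldots,J}^{k=1,\ldots,K}$. $X^0=L^2(\Omega)\times\mathbb{R}^J$ with the standard product Hilbert norm. $X^2$ is the space of tuples $(y,\kappa_1,\ldots,\kappa_J)$ with $y\in L^\infty(0,T;L^2(\Omega))$, $\nabla y\in (L^2(Q_T))^d$ (weak gradient in the space variables), $y'\in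 L^2(0,T;H^1(\Omega)^* )$, and $\kappa_j\in L^\infty(0,T)$, $\kappa_j'\in L^2(0,T)$ for $j=1,\ldots,J$ (time derivatives in the sense of (vector-valued) distributions), with the natural norm $$\|(y,\kappa_1,\ldots,\kappa_J)\|_{X^2}=\|y\|_{L^\infty(0,T;L^2(\Omega))}+\|\nabla y\|_{L^2(Q_T)}+\|y'\|_{L^2(0,T;H^1(\Omega)^* )}+\sum_{j=1}^J\big(\|\kappa_j\|_{L^\infty(0,T)}+\|\kappa_j'\|_{L^2(0,T)}\big).$$ If $(y,\kappa_1,\ldots,\kappa_J)\in X^2$ then $y$ has a representative in $C([0,T];L^2(\Omega))$ and $\kappa_j$ has one in $C([0,T])$, so initial values make sense. A weak solution of the system (corresponding to the control $(g_j,h_k,\alpha_{jk})$ and the initial condition $(y_0,\kappa_{10},\ldots,\kappa_{J0})$) is a tuple $(y,\kappa_1,\ldots,\kappa_J)\in X^2$ such that $y(0)=y_0$ in $L^2(\Omega)$, $\kappa_j(0)=\kappa_{j0}$ for all $j$, and: (i) $\int_0^T \big[\langle y',\phi\rangle + D(\nabla y,\nabla\phi)_{L^2(\Omega)} - (f(y)+\sum_{j=1}^J\kappa_j g_j,\phi)_{L^2(\Omega)}\big]\,dt=0$ for all $\phi\in L^2(0,T;H^1(\Omega))$, where $\langle\cdot,\cdot\rangle$ is the duality pairing between $H^1(\Omega)^*$ and $H^1(\Omega)$; (ii) $\int_0^T(\beta_j\kappa_j'+\kappa_j-W_j(y,y^* ))\,\xi\,dt=0$ for all $\xi\in L^2(0,T)$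 and all $j=1,\ldots,J$. *)

(* Defs.v *)
From HB Require Import structures.
From mathcomp Require Import all_boot all_order all_algebra.
From mathcomp Require Import all_classical all_reals all_analysis measurable_realfun.

Set Implicit Arguments.
Unset Strict Implicit.
Unset Printing Implicit Defensive.

Import Order.TTheory GRing.Theory Num.Theory.
Import numFieldNormedType.Exports.

Local Open Scope classical_set_scope.
Local Open Scope ring_scope.

(* R^d is ['rV[R]_d], with the topology of MathComp-Analysis (the sup norm
   there is only used for topological notions) and with the sigma-algebra
   generated by the coordinates, i.e. the Borel one
   (cf. [open_measurable_rV]). Its Lebesgue measure [lebesgue_rV] is the iterated
   product of the one of R, transported by [cons_rV] (cf. [lebesgue_rV_box]). *)

Fact rV_display : measure_display.
Proof. exact: default_measure_display. Qed.

Section measurable_rV.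
Context {R : realType} (n : nat).

Let coors : 'I_n -> 'rV[R]_n -> R := fun i v => v ord0 i.

Let rV_set0 : g_sigma_preimage coors set0.
Proof. exact: sigma_algebra0. Qed.

Let rV_setC A : g_sigma_preimage coors A -> g_sigma_preimage coors (~` A).
Proof. exact: sigma_algebraC. Qed.

Let rV_bigcup (F : _^nat) : (forall i, g_sigma_preimage coors (F i)) ->
  g_sigma_preimage coors (\bigcup_i (F i)).
Proof. exact: sigma_algebra_bigcup. Qed.

HB.instance Definition _ := @isMeasurable.Build rV_display
  'rV[R]_n (g_sigma_preimage coors) rV_set0 rV_setC rV_bigcup.

End measurable_rV.

Section measurable_rV_lemmas.
Context {R : realType}.

Lemma measurable_coord n (i : 'I_n) :
  measurable_fun [set: 'rV[R]_n] (fun v : 'rV[R]_n => v ord0 i).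
Proof.
move=> _ Y mY; rewrite setTI; apply: sub_sigma_algebra => /=.
rewrite -bigcup_seq/=; exists i => /=; first by rewrite mem_index_enum.
by exists Y => //; rewrite setTI.
Qed.

Lemma measurable_fun_rV d (T : measurableType d) n (f : T -> 'rV[R]_n) :
  (forall i, measurable_fun setT (fun t => f t ord0 i)) ->
  measurable_fun setT f.
Proof.
move=> mf; apply: (@measurability _ _ _ _ _ _
  (\big[setU/set0]_(i < n) preimage_set_system setT
     (fun v : 'rV[R]_n => v ord0 i) measurable)) => //.
move=> _ [A + <-]; rewrite -bigcup_seq => -[i _ [B mB <-]].
by have := mf i measurableT B mB; rewrite !setTI.
Qed.

Lemma open_measurable_rV n (A : set 'rV[R]_n) : open A -> measurable A.
Proof.
move=> oA.
pose B (p : 'rV[rat]_n * nat) : set 'rV[R]_n :=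
  \bigcap_(i in [set: 'I_n])
    [set v : 'rV[R]_n | `|ratr (p.1 ord0 i) - v ord0 i| < p.2.+1%:R^-1].
have mB p : measurable (B p).
  apply: fin_bigcap_measurable; first exact: finite_finset.
  move=> i _.
  rewrite (_ : [set _ | _] = (fun v : 'rV[R]_n => v ord0 i) @^-1`
     (ball (ratr (p.1 ord0 i) : R) p.2.+1%:R^-1)) //.
  rewrite -[X in measurable X]setTI; apply: measurable_coord => //.
  apply: open_measurable; exact: ball_open.
rewrite (_ : A = \bigcup_k
    (if unpickle k is Some p then
       if `[< B p `<=` A >] then B p else set0 else set0)); last first.
  apply/seteqP; split=> [v Av|v [k _]]; last first.
    by case: unpickle => // p; case: asboolP => // + Bv; exact.
  have /nbhs_ballP[e /= e0 eA] : nbhs v A by exact: open_nbhs_nbhs.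
  have e20 : 0 < e / 2 by rewrite divr_gt0.
  have [k ke] : exists k, k.+1%:R^-1 < e / 2 :> R.
    have [N _ /(_ N (leqnn _)) NP] := near_infty_natSinv_lt (PosNum e20).
    by exists N.
  have k0 : 0 < k.+1%:R^-1 :> R by rewrite invr_gt0 ltr0n.
  have qP i : exists q : rat, `|ratr q - v ord0 i| < k.+1%:R^-1.
    have /rat_in_itvoo[q] : v ord0 i - k.+1%:R^-1 < v ord0 i + k.+1%:R^-1.
      by rewrite ltrD2l (lt_trans _ k0)// oppr_lt0.
    by rewrite in_itv /= => qv; exists q; rewrite ltr_distl.
  have [q qv] := choice qP.
  exists (pickle (\row_i q i, k)) => //; rewrite pickleK.
  case: asboolP => [_ i _ /=|[]]; first by rewrite mxE.
  move=> w Bw; apply: eA; split=> // i j; rewrite ord1.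
  have := Bw j I; have := qv j; rewrite /= mxE => vq qw.
  rewrite /ball /= (le_lt_trans (ler_distD (ratr (q j)) _ _))//.
  rewrite [ltRHS](splitr e) ltrD// ?(lt_trans _ ke)//.
  by rewrite distrC.
apply: bigcupT_measurable => k; case: unpickle => // p.
by case: ifPn.
Qed.

End measurable_rV_lemmas.

Section lebesgue_rV.
Context {R : realType}.

Definition cons_rV n (p : measurableTypeR R * 'rV[R]_n) : 'rV[R]_n.+1 :=
  row_mx (p.1%:M : 'rV[R]_1) p.2.

Lemma measurable_cons_rV n : measurable_fun setT (@cons_rV n).
Proof.
apply: measurable_fun_rV => i; case: (splitP (i : 'I_(1 + n))) => j ij.
  rewrite (_ : (fun _ => _) = fst); first exact: measurable_fst.
  apply/funext => p; rewrite (_ : i = lshift n j); last exact/val_inj.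
  by apply: etrans (row_mxEl _ _ _ _) _; rewrite mxE [j]ord1 eqxx.
rewrite (_ : (fun _ => _) = (fun v : 'rV[R]_n => v ord0 j) \o snd).
  by apply: measurableT_comp; [exact: measurable_coord|exact: measurable_snd].
apply/funext => p; rewrite (_ : i = rshift 1 j); last exact/val_inj.
exact: row_mxEr.
Qed.

Section cons_measure.
Context n (mu : {sigma_finite_measure set 'rV[R]_n -> \bar R}).
Local Open Scope ereal_scope.

Let nu : {measure set (measurableTypeR R * 'rV[R]_n)%type -> \bar R} :=
  (@lebesgue_measure R \x mu).

Definition cons_measure : set 'rV[R]_n.+1 -> \bar R :=
  pushforward nu (@cons_rV n).

Let mcons A : measurable A -> measurable (@cons_rV n @^-1` A).
Proof. by move=> mA; rewrite -[X in measurable X]setTI; exact: measurable_cons_rV. Qed.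

Let cons_measure0 : cons_measure set0 = 0.
Proof. by rewrite /cons_measure /pushforward preimage_set0 measure0. Qed.

Let cons_measure_ge0 A : 0 <= cons_measure A.
Proof. by rewrite /cons_measure /pushforward; apply: measure_ge0. Qed.

Let cons_measure_sigma_additive : semi_sigma_additive cons_measure.
Proof.
move=> F mF tF mUF; rewrite /cons_measure /pushforward preimage_bigcup.
apply: measure_semi_sigma_additive.
- by move=> k; exact: mcons.
- apply/trivIsetP => /= i j _ _ ij; rewrite -preimage_setI.
  by move/trivIsetP : tF => /(_ _ _ _ _ ij) ->//; rewrite preimage_set0.
- by rewrite -preimage_bigcup; exact: mcons.
Qed.

HB.instance Definition _ := isMeasure.Build _ _ _ cons_measure
  cons_measure0 cons_measure_ge0 cons_measure_sigma_additive.

Let uncons (v : 'rV[R]_n.+1) : (measurableTypeR R * 'rV[R]_n)%type :=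
  (v ord0 ord0, rsubmx (v : 'rV[R]_(1 + n))).

Let unconsK : cancel (@cons_rV n) uncons.
Proof.
move=> [x v]; rewrite /uncons /cons_rV row_mxKr; congr pair => /=.
rewrite [X in fun_of_matrix _ _ X](_ : _ = lshift n (ord0 : 'I_1)).
  by apply: etrans (row_mxEl _ _ _ _) _; rewrite mxE.
exact/val_inj.
Qed.

Let measurable_uncons : measurable_fun setT uncons.
Proof.
apply/measurable_fun_pair; first exact: measurable_coord.
apply: measurable_fun_rV => i.
rewrite (_ : (fun _ => _) =
  (fun v : 'rV[R]_n.+1 => v ord0 (rshift 1 i : 'I_(1 + n)))).
  exact: measurable_coord.
by apply/funext => v; rewrite mxE.
Qed.

Let nu_sigma_finite : sigma_finite setT nu.
Proof.
have /sigma_finiteP[F [TF ndF Foo]] := sigma_finiteT (@lebesgue_measure R).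
have /sigma_finiteP[G [TG ndG Goo]] := sigma_finiteT mu.
exists (fun k => F k `*` G k).
  rewrite -setXTT TF TG predeqE => -[x y]; split.
    move=> [/= [i _ Fix] [j _ Gjy]]; exists (maxn i j) => //; split.
    - by move: x Fix; exact/subsetPset/ndF/leq_maxl.
    - by move: y Gjy; exact/subsetPset/ndG/leq_maxr.
  by move=> [i _ []/= ? ?]; split; exists i.
move=> k; have [? ?] := Foo k; have [? ?] := Goo k.
split; first exact: measurableX.
by rewrite /nu/= product_measure1E// lte_mul_pinfty// ge0_fin_numE.
Qed.

Let cons_measure_sigma_finite : sigma_finite setT cons_measure.
Proof.
have [F TF Foo] := nu_sigma_finite.
exists (fun k => uncons @^-1` F k).
  by rewrite -preimage_bigcup -TF preimage_setT.
move=> k; have [mF Fk] := Foo k; split.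
  by rewrite -[X in measurable X]setTI; exact: measurable_uncons.
rewrite /cons_measure /pushforward -comp_preimage.
by rewrite (_ : uncons \o _ = idfun)//; apply/funext => p /=; rewrite unconsK.
Qed.

HB.instance Definition _ := Measure_isSigmaFinite.Build _ _ _ cons_measure
  cons_measure_sigma_finite.

End cons_measure.

Fixpoint lebesgue_rV n : {sigma_finite_measure set 'rV[R]_n -> \bar R} :=
  match n with
  | 0 => @dirac _ 'rV[R]_0 0 R
  | m.+1 => cons_measure (lebesgue_rV m)
  end.

End lebesgue_rV.

Lemma lebesgue_rV_box {R : realType} n (A : 'I_n -> set R) :
  (forall i, measurable (A i)) ->
  lebesgue_rV n [set v : 'rV[R]_n | forall i, A i (v ord0 i)] =
  (\prod_(i < n) lebesgue_measure (A i))%E.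
Proof.
elim: n A => [|n IH] A mA /=.
  rewrite big_ord0 diracE (_ : _ \in _)//.
  by rewrite inE => -[].
rewrite /cons_measure /pushforward.
rewrite (_ : _ @^-1` _ = A ord0 `*`
    [set v : 'rV[R]_n | forall i, A (lift ord0 i) (v ord0 i)]); last first.
  apply/seteqP; split=> [[x v] /= Av|[x v] /= [Ax Av] i].
    split=> [|i].
      move: (Av ord0); rewrite [X in fun_of_matrix _ _ X](_ : _ = lshift n (ord0 : 'I_1)); last exact/val_inj.
      by rewrite /cons_rV (row_mxEl (x%:M : 'rV_1) v) mxE.
    move: (Av (lift ord0 i)); rewrite [X in fun_of_matrix _ _ X](_ : _ = rshift 1 i); last exact/val_inj.
    by rewrite /cons_rV (row_mxEr (x%:M : 'rV_1) v).
  have [j ->|] := unliftP ord0 i.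
    rewrite [X in fun_of_matrix _ _ X](_ : _ = rshift 1 j); last exact/val_inj.
    by rewrite /cons_rV (row_mxEr (x%:M : 'rV_1) v).
  move=> ->.
  rewrite [X in fun_of_matrix _ _ X](_ : _ = lshift n (ord0 : 'I_1)); last exact/val_inj.
  by rewrite /cons_rV (row_mxEl (x%:M : 'rV_1) v) mxE.
apply: etrans (product_measure1E _ _ _ _) _.
- exact: mA.
- rewrite (_ : [set _ | _] = \bigcap_(i in [set: 'I_n])
      (fun v : 'rV[R]_n => v ord0 i) @^-1` A (lift ord0 i)); last first.
    by apply/seteqP; split=> v /= Av i; [move=> _|]; exact: Av.
  apply: fin_bigcap_measurable; first exact: finite_finset.
  by move=> i _; rewrite -[X in measurable X]setTI; exact: measurable_coord.
- by rewrite big_ord_recl (IH (fun i => A (lift ord0 i))).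
Qed.

(* An element of L^p(D) is represented by any function whose restriction to [D]
   (extended by zero) is in the [Lfun] of the library; its values outside [D]
   play no role. *)

Section Lp.
Context {R : realType} d (T : measurableType d).
Variables (mu : {measure set T -> \bar R}) (p : \bar R) (D : set T).

Definition Lp_norm (u : T -> R) : \bar R := ('N[mu]_p[EFin \o u \_ D])%E.

Definition Lp (u : T -> R) : Prop := u \_ D \in Lfun mu p.

End Lp.

Section test_functions.
Context {R : realType} {V : normedModType R}.

Fixpoint Ck (k : nat) (u : V -> R) : Prop :=
  continuous u /\
  if k is j.+1 then forall v, (forall x, derivable u x v) /\ Ck j ('D_v u)
  else True.

(* u \in C_c^oo(A) *)
Definition test_function (A : set V) (u : V -> R) : Prop :=
  [/\ forall k, Ck k u,
      compact (closure [set x | u x != 0]) &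
      closure [set x | u x != 0] `<=` A].

End test_functions.

Section Sobolev.
Context {R : realType} {d : nat}.
Implicit Types (Omega : set 'rV[R]_d) (u : 'rV[R]_d -> R)
  (Du : 'I_d -> 'rV[R]_d -> R).

Definition weak_gradient Omega u Du : Prop :=
  forall i phi, test_function Omega phi ->
  \int[lebesgue_rV d]_(x in Omega) (u x * 'D_(delta_mx ord0 i) phi x) =
  - \int[lebesgue_rV d]_(x in Omega) (Du i x * phi x).

(* u \in H^1(Omega) and Du is its weak gradient. As the latter is unique up to a
   negligible set, we carry it along instead of choosing it. *)
Definition H1 Omega u Du : Prop :=
  [/\ Lp (lebesgue_rV d) 2%:E Omega u,
      forall i, Lp (lebesgue_rV d) 2%:E Omega (Du i) &
      weak_gradient Omega u Du].

Definition H1_norm Omega u Du : \bar R :=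
  ((Lp_norm (lebesgue_rV d) 2%:E Omega u ^+ 2 +
    \sum_(i < d) Lp_norm (lebesgue_rV d) 2%:E Omega (Du i) ^+ 2) `^ 2^-1)%E.

Definition H1_compact_in_L2 Omega : Prop :=
  forall (u : nat -> 'rV[R]_d -> R) (Du : nat -> 'I_d -> 'rV[R]_d -> R) (M : R),
    (forall n, H1 Omega (u n) (Du n)) ->
    (forall n, (H1_norm Omega (u n) (Du n) <= M%:E)%E) ->
  exists2 s : nat -> nat, {homo s : m n / (m < n)%N} &
  exists2 v, Lp (lebesgue_rV d) 2%:E Omega v &
    Lp_norm (lebesgue_rV d) 2%:E Omega (u (s n) \- v) @[n --> \oo] --> 0%E.

(* Bounded linear functionals on H^1(Omega); their values at functions that are
   not in H^1(Omega) play no role. *)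
Definition H1dual_norm Omega (F : ('rV[R]_d -> R) -> R) : \bar R :=
  ereal_sup [set `|F u|%:E | u in
    [set u | exists2 Du, H1 Omega u Du & (H1_norm Omega u Du <= 1)%E]].

Definition H1dual Omega (F : ('rV[R]_d -> R) -> R) : Prop :=
  (forall a u Du v Dv, H1 Omega u Du -> H1 Omega v Dv ->
     F (fun x => a * u x + v x) = a * F u + F v) /\
  (H1dual_norm Omega F < +oo)%E.

End Sobolev.

(* A function y(x,t) on Omega x (0,T) is written [y t x] and its measurability
   is the joint one; for L^p(0,T;L^2(Omega)) and L^2(0,T;H^1(Omega)) this is the
   usual identification with Bochner spaces. *)

Section evolution.
Context {R : realType} {d : nat}.
Variables (T : R) (Omega : set 'rV[R]_d).

Definition time : set (measurableTypeR R) := `]0, T[%classic.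

Definition QT : set (measurableTypeR R * 'rV[R]_d) := time `*` Omega.

Definition LpL2_norm (p : \bar R) (y : R -> 'rV[R]_d -> R) : \bar R :=
  ('N[lebesgue_measure]_p
    [(fun t => Lp_norm (lebesgue_rV d) 2%:E Omega (y t)) \_ time])%E.

Definition LpL2 (p : \bar R) (y : R -> 'rV[R]_d -> R) : Prop :=
  measurable_fun setT (uncurry y \_ QT) /\ (LpL2_norm p y < +oo)%E.

Definition L2QT (y : R -> 'rV[R]_d -> R) : Prop :=
  Lp (lebesgue_measure \x lebesgue_rV d)%E 2%:E QT (uncurry y).

Definition L2QT_norm (y : R -> 'rV[R]_d -> R) : \bar R :=
  Lp_norm (lebesgue_measure \x lebesgue_rV d)%E 2%:E QT (uncurry y).

Definition space_gradient (y : R -> 'rV[R]_d -> R)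
    (Dy : 'I_d -> R -> 'rV[R]_d -> R) : Prop :=
  (forall i, L2QT (Dy i)) /\
  {ae lebesgue_measure, forall t, time t ->
     weak_gradient Omega (y t) (fun i => Dy i t)}.

Definition L2QT_vnorm (Dy : 'I_d -> R -> 'rV[R]_d -> R) : \bar R :=
  ((\sum_(i < d) L2QT_norm (Dy i) ^+ 2) `^ 2^-1)%E.

Definition L2H1 (phi : R -> 'rV[R]_d -> R)
    (Dphi : 'I_d -> R -> 'rV[R]_d -> R) : Prop :=
  [/\ L2QT phi, space_gradient phi Dphi &
      {ae lebesgue_measure, forall t, time t ->
        H1 Omega (phi t) (fun i => Dphi i t)}].

Definition simple_H1dual (S : R -> ('rV[R]_d -> R) -> R) : Prop :=
  exists (n : nat) (A : 'I_n -> set (measurableTypeR R))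
      (F : 'I_n -> ('rV[R]_d -> R) -> R),
  [/\ forall i, measurable (A i), forall i, H1dual Omega (F i) &
      forall t u, S t u = \sum_(i < n) \1_(A i) t * F i u].

Definition L2H1dual_norm (F : R -> ('rV[R]_d -> R) -> R) : \bar R :=
  ('N[lebesgue_measure]_2%:E[(fun t => H1dual_norm Omega (F t)) \_ time])%E.

(* The Bochner space L^2(0,T;H^1(Omega)^* ): strongly measurable functions with
   square integrable norm. *)
Definition L2H1dual (F : R -> ('rV[R]_d -> R) -> R) : Prop :=
  [/\ {ae lebesgue_measure, forall t, time t -> H1dual Omega (F t)},
      (exists2 S : nat -> R -> ('rV[R]_d -> R) -> R,
        forall n, simple_H1dual (S n) &
        {ae lebesgue_measure, forall t, time t ->
          H1dual_norm Omega (S n t \- F t) @[n --> \oo] --> 0%E}) &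
      (L2H1dual_norm F < +oo)%E].

(* y' = F as distributions on (0,T) with values in H^1(Omega)^*, where L^2(Omega)
   is embedded in H^1(Omega)^* by the inner product of L^2(Omega); the identity
   int_0^T F eta dt = - int_0^T y eta' dt in H^1(Omega)^* is evaluated at u. *)
Definition time_derivative (y : R -> 'rV[R]_d -> R)
    (F : R -> ('rV[R]_d -> R) -> R) : Prop :=
  forall u Du (eta : R^o -> R), H1 Omega u Du -> test_function time eta ->
  \int[lebesgue_measure]_(t in time) (F t u * eta t) =
  - \int[lebesgue_measure]_(t in time)
      ((\int[lebesgue_rV d]_(x in Omega) (y t x * u x)) * 'D_1 eta t).

Definition scalar_derivative (k k' : R -> R) : Prop :=
  forall eta : R^o -> R, test_function time eta ->
  \int[lebesgue_measure]_(t in time) (k' t * eta t) =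
  - \int[lebesgue_measure]_(t in time) (k t * 'D_1 eta t).

(* The representative of y in C([0,T];L^2(Omega)) takes the value y0 at 0. *)
Definition initial_value (y : R -> 'rV[R]_d -> R) (y0 : 'rV[R]_d -> R) : Prop :=
  exists yc : R -> 'rV[R]_d -> R,
  [/\ forall t, `[0, T]%classic t -> Lp (lebesgue_rV d) 2%:E Omega (yc t),
      forall t, `[0, T]%classic t ->
        Lp_norm (lebesgue_rV d) 2%:E Omega (yc s \- yc t)
          @[s --> within `[0, T]%classic (nbhs t)] --> 0%E,
      {ae lebesgue_measure, forall t, time t ->
        {ae lebesgue_rV d, forall x, Omega x -> yc t x = y t x}} &
      {ae lebesgue_rV d, forall x, Omega x -> yc 0 x = y0 x}].

Definition scalar_initial_value (k : R -> R) (k0 : R) : Prop :=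
  exists kc : R -> R,
  [/\ {within `[0, T]%classic, continuous kc},
      {ae lebesgue_measure, forall t, time t -> kc t = k t} &
      kc 0 = k0].

End evolution.

Section thermostat.
Context {R : realType} {d J K : nat}.

Record control := Control {
  ctrl_g : 'I_J -> 'rV[R]_d -> R;
  ctrl_h : 'I_K -> 'rV[R]_d -> R;
  ctrl_alpha : 'M[R]_(J, K) }.

Definition control_sub (u v : control) : control :=
  Control (fun j => ctrl_g u j \- ctrl_g v j)
          (fun k => ctrl_h u k \- ctrl_h v k)
          (ctrl_alpha u - ctrl_alpha v).

Record initial := Initial {
  init_y : 'rV[R]_d -> R;
  init_kappa : 'I_J -> R }.

Definition initial_sub (a b : initial) : initial :=
  Initial (init_y a \- init_y b) (fun j => init_kappa a j - init_kappa b j).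

(* A tuple (y, kappa_1, ..., kappa_J) together with the derivatives of its
   components (which are unique up to negligible sets). *)
Record state := State {
  st_y : R -> 'rV[R]_d -> R;
  st_grad : 'I_d -> R -> 'rV[R]_d -> R;
  st_y' : R -> ('rV[R]_d -> R) -> R;
  st_kappa : 'I_J -> R -> R;
  st_kappa' : 'I_J -> R -> R }.

Definition state_sub (a b : state) : state :=
  State (fun t => st_y a t \- st_y b t)
        (fun i t => st_grad a i t \- st_grad b i t)
        (fun t => st_y' a t \- st_y' b t)
        (fun j => st_kappa a j \- st_kappa b j)
        (fun j => st_kappa' a j \- st_kappa' b j).

Section spaces.
Variables (T : R) (Omega : set 'rV[R]_d).

Definition in_U (u : control) : Prop :=
  (forall j, Lp (lebesgue_rV d) 2%:E Omega (ctrl_g u j)) /\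
  (forall k, Lp (lebesgue_rV d) 2%:E Omega (ctrl_h u k)).

Definition U_norm (u : control) : \bar R :=
  ((\sum_(j < J) Lp_norm (lebesgue_rV d) 2%:E Omega (ctrl_g u j) ^+ 2 +
    \sum_(k < K) Lp_norm (lebesgue_rV d) 2%:E Omega (ctrl_h u k) ^+ 2 +
    \sum_(j < J) \sum_(k < K) ((ctrl_alpha u j k) ^+ 2)%:E) `^ 2^-1)%E.

Definition in_X0 (a : initial) : Prop :=
  Lp (lebesgue_rV d) 2%:E Omega (init_y a).

Definition X0_norm (a : initial) : \bar R :=
  ((Lp_norm (lebesgue_rV d) 2%:E Omega (init_y a) ^+ 2 +
    \sum_(j < J) ((init_kappa a j) ^+ 2)%:E) `^ 2^-1)%E.

Definition in_X2 (s : state) : Prop :=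
  [/\ LpL2 T Omega +oo (st_y s),
      space_gradient T Omega (st_y s) (st_grad s),
      L2H1dual T Omega (st_y' s) /\ time_derivative T Omega (st_y s) (st_y' s) &
      forall j, [/\ Lp lebesgue_measure +oo (time T) (st_kappa s j),
        Lp lebesgue_measure 2%:E (time T) (st_kappa' s j) &
        scalar_derivative T (st_kappa s j) (st_kappa' s j)]].

Definition X2_norm (s : state) : \bar R :=
  (LpL2_norm T Omega +oo (st_y s) + L2QT_vnorm T Omega (st_grad s) +
   L2H1dual_norm T Omega (st_y' s) +
   \sum_(j < J) (Lp_norm lebesgue_measure +oo (time T) (st_kappa s j) +
                 Lp_norm lebesgue_measure 2%:E (time T) (st_kappa' s j)))%E.

End spaces.

Section solutions.
Variables (T : R) (Omega : set 'rV[R]_d).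
Variables (D : R) (beta : 'I_J -> R).
Variables (f : R -> R) (w : 'I_K -> R -> R) (ystar : R -> 'rV[R]_d -> R).

Definition thermostat_W (u : control) (j : 'I_J) (y : R -> 'rV[R]_d -> R) (t : R) : R :=
  \sum_(k < K) ctrl_alpha u j k *
    w k (\int[lebesgue_rV d]_(x in Omega) (ctrl_h u k x * (y t x - ystar t x))).

Definition heat_equation (u : control) (s : state) : Prop :=
  forall phi Dphi, L2H1 T Omega phi Dphi ->
  \int[lebesgue_measure]_(t in time T)
    (st_y' s t (phi t)
     + D * (\sum_(i < d)
         \int[lebesgue_rV d]_(x in Omega) (st_grad s i t x * Dphi i t x))
     - \int[lebesgue_rV d]_(x in Omega)
         ((f (st_y s t x) + \sum_(j < J) st_kappa s j t * ctrl_g u j x)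
          * phi t x)) = 0.

Definition thermostat_equation (u : control) (s : state) : Prop :=
  forall j xi, Lp lebesgue_measure 2%:E (time T) xi ->
  \int[lebesgue_measure]_(t in time T)
    ((beta j * st_kappa' s j t + st_kappa s j t - thermostat_W u j (st_y s) t) * xi t) = 0.

Definition weak_solution (u : control) (a : initial) (s : state) : Prop :=
  [/\ in_X2 T Omega s,
      initial_value T Omega (st_y s) (init_y a),
      forall j, scalar_initial_value T (st_kappa s j) (init_kappa a j),
      heat_equation u s &
      thermostat_equation u s].

End solutions.
End thermostat.
Arguments control : clear implicits.
Arguments initial : clear implicits.
Arguments state : clear implicits.

(* Main.v *)
(** Testing the difference y of two solutions with itself gives, for 0 < b <= T,
      |y(b)|^2 + 2D int_0^b |grad y|^2 <= |y(0)|^2 + int_0^b (|F|^2 + |y|^2),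
    where F is the difference of the right-hand sides. To avoid any chain rule for
    L^2(0,T;H^1) functions with derivative in the dual, the equation is integrated over
    (t - h, t), tested with 2 y(t) and averaged over t, and then h tends to 0. The
    thermostat equations hold almost everywhere, whence
      kappa_j(b)^2 <= 2 kappa_j(0)^2 + 2T int_0^b (kappa_j')^2.
    The terms F and kappa_j' are controlled by y, kappa and the data as soon as one of
    the two solutions is bounded, so that Gronwall's inequality is used twice: first to
    compare a solution with zero, which bounds it, and then to compare the two solutions.
    Finally, the heat equation at almost every time bounds y' in the dual of H^1. *)

Require Import Defs.
From HB Require Import structures.
From mathcomp Require Import all_boot all_order all_algebra.
From mathcomp Require Import all_classical all_reals all_analysis measurable_realfun.
From mathcomp Require Import ring lra.

Import Order.TTheory GRing.Theory Num.Theory.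
Import numFieldNormedType.Exports.

Local Open Scope classical_set_scope.
Local Open Scope ring_scope.

(** Exceptional null sets shape the proof. For a fixed u in H^1 the heat equation holds at almost
    every t, but the null set depends on u, so y(t) cannot be inserted for u. The integrated
    equation over ]s, t] holds for all s <= t and all u at once, and there y(t) may be inserted. The
    elementary inequality |a|^2 - |b|^2 <= 2 (a - b, a) then takes the place of the derivative of
    |y|^2. The passage h -> 0 asks little of the time averages: a lower bound in the limit for the
    gradient term, whose sign is favourable, and for the source only that averaging does not
    increase the L^2 norm. The opposite difficulty arises for y': its dual norm at time t is an
    uncountable supremum of quantities each known only almost everywhere. Strong measurability
    reduces it to countably many test functions. Products of unknowns and controls are split as a1
    b1 - a2 b2 = (a1 - a2) b1 + a2 (b1 - b2), with the control as the factor kept from the first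
    solution, so that a bound on the state is used for the second solution only. *)

Lemma sumr_cauchy_schwarz (R : realDomainType) n (a b : 'I_n -> R) :
  (\sum_i a i * b i) ^+ 2 <= (\sum_i a i ^+ 2) * \sum_i b i ^+ 2.
Proof.
(* Lagrange's identity: this sum of squares is twice the difference of the two sides. *)
have : 0 <= \sum_i \sum_j (a i * b j - a j * b i) ^+ 2.
  by apply: sumr_ge0 => i _; apply: sumr_ge0 => j _; exact: sqr_ge0.
rewrite (_ : \sum_i _ = 2 * ((\sum_i a i ^+ 2) * (\sum_i b i ^+ 2)) -
  2 * (\sum_i a i * b i) ^+ 2); first by lra.
have E1 : (\sum_i a i ^+ 2) * (\sum_i b i ^+ 2) = \sum_i \sum_j (a i * b j) ^+ 2.
  rewrite mulr_suml; apply: eq_bigr => i _; rewrite mulr_sumr.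
  by apply: eq_bigr => j _; rewrite exprMn.
have E2 : (\sum_i a i ^+ 2) * (\sum_i b i ^+ 2) = \sum_i \sum_j (a j * b i) ^+ 2.
  by rewrite E1 exchange_big.
have E3 : (\sum_i a i * b i) ^+ 2 = \sum_i \sum_j (a i * b j) * (a j * b i).
  rewrite expr2 mulr_suml; apply: eq_bigr => i _; rewrite mulr_sumr.
  by apply: eq_bigr => j _; ring.
transitivity (\sum_i \sum_j (a i * b j) ^+ 2 + \sum_i \sum_j (a j * b i) ^+ 2 -
  2 * \sum_i \sum_j (a i * b j) * (a j * b i)); last first.
  by rewrite -E3 -E1 -E2; ring.
rewrite !mulr_sumr -!big_split/= -sumrB; apply: eq_bigr => i _.
rewrite !mulr_sumr -!big_split/= -sumrB; apply: eq_bigr => j _; ring.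
Qed.

(** * The inner product of square integrable functions *)

Section square_integrable.
Set Implicit Arguments.
Import HBNNSimple.
Unset Strict Implicit.
Context {R : realType} {dX : measure_display} {X : measurableType dX}.
Variable mu : {measure set X -> \bar R}.

(** Domains enter by extending functions by zero, so that all inner products are integrals over the
    whole space. *)
Definition L2 (u : X -> R) : Prop :=
  measurable_fun setT u /\ mu.-integrable setT (EFin \o (fun x => u x ^+ 2)).

Definition ip (u v : X -> R) : R := \int[mu]_x (u x * v x).

(** The integral of a nonnegative function is a supremum over simple functions below it. A simple
    function below [f], cut to 0 on the null set [N], keeps its integral and lies below [g]
    everywhere. The argument concerns arbitrary nonnegative functions, so representatives may be
    exchanged freely below. *)
Lemma ge0_le_integral_ae (f g : X -> \bar R) :
  (forall x, 0 <= f x)%E -> (forall x, 0 <= g x)%E ->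
  {ae mu, forall x, f x <= g x}%E -> (\int[mu]_x f x <= \int[mu]_x g x)%E.
Proof.
move=> f0 g0 [N [mN N0 fgN]].
rewrite !ge0_integralTE//.
apply: ge_ereal_sup => _ [h /= hf <-].
have mNC : measurable (~` N) by exact: measurableC.
pose h1 : {nnsfun X >-> R} := proj_nnsfun h mNC.
have -> : sintegral mu h = sintegral mu h1.
  rewrite -!integralT_nnsfun; apply: ge0_ae_eq_integral => //.
  - exact/measurable_EFinP.
  - exact/measurable_EFinP.
  - by move=> x _; rewrite lee_fin.
  - by move=> x _; rewrite lee_fin.
  - exists N; split => // x /= /not_implyP[_] hx; apply: contrapT => Nx.
    by apply: hx; rewrite mindicE mem_set// mulr1.
apply: ereal_sup_ubound; exists h1 => // x /=.
rewrite mindicE; case: (boolP (x \in ~` N)) => [/set_mem Nx|_] /=.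
  rewrite mulr1 (le_trans (hf x))//; apply: contrapT => fgx.
  by apply: Nx; apply: fgN.
by rewrite mulr0.
Qed.

Lemma eq_integral_ae (f g : X -> \bar R) : {ae mu, forall x, f x = g x} ->
  (\int[mu]_x f x = \int[mu]_x g x)%E.
Proof.
move=> fg; rewrite [LHS]integralE [RHS]integralE.
by congr (_ - _)%E; apply/eqP; rewrite eq_le; apply/andP; split;
  apply: ge0_le_integral_ae => //; apply: filterS fg => x fgx;
  rewrite ?funeposE ?funenegE fgx.
Qed.

Lemma eq_Rintegral_ae (f g : X -> R) : {ae mu, forall x, f x = g x} ->
  \int[mu]_x f x = \int[mu]_x g x.
Proof.
by move=> fg; rewrite /Rintegral; congr fine; apply: eq_integral_ae;
  apply: filterS fg => x ->.
Qed.

Lemma eq_Rintegral_in_ae (D : set X) (f g : X -> R) :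
  {ae mu, forall x, D x -> f x = g x} ->
  \int[mu]_(x in D) f x = \int[mu]_(x in D) g x.
Proof.
move=> fg; rewrite Rintegral_mkcond [RHS]Rintegral_mkcond.
apply: eq_Rintegral_ae; apply: filterS fg => x fgx.
by rewrite !patchE; case: ifPn => // /set_mem /fgx.
Qed.

Lemma integrable_EFinZ D (a : R) (f : X -> R) : measurable D ->
  mu.-integrable D (EFin \o f) -> mu.-integrable D (EFin \o (fun x => a * f x)).
Proof. by move=> mD fi; exact: (integrableZl mD a fi). Qed.

Lemma integrable_EFinD D (f g : X -> R) : measurable D ->
  mu.-integrable D (EFin \o f) -> mu.-integrable D (EFin \o g) ->
  mu.-integrable D (EFin \o (fun x => f x + g x)).
Proof. by move=> mD fi gi; exact: (integrableD mD fi gi). Qed.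

Lemma integrable_EFinB D (f g : X -> R) : measurable D ->
  mu.-integrable D (EFin \o f) -> mu.-integrable D (EFin \o g) ->
  mu.-integrable D (EFin \o (fun x => f x - g x)).
Proof. by move=> mD fi gi; exact: (integrableB mD fi gi). Qed.

Lemma integrable_EFin_sum D I (s : seq I) (f : I -> X -> R) : measurable D ->
  (forall i, mu.-integrable D (EFin \o f i)) ->
  mu.-integrable D (EFin \o (fun x => \sum_(i <- s) f i x)).
Proof.
move=> mD fi; have := @integrable_sum _ _ _ mu _ mD _ s xpredT _ (fun i _ => fi i).
by congr integrable; apply/funext => x /=; rewrite sumEFin.
Qed.

Lemma Rintegral_sum D I (s : seq I) (f : I -> X -> R) : measurable D ->
  (forall i, mu.-integrable D (EFin \o f i)) ->
  \int[mu]_(x in D) (\sum_(i <- s) f i x) = \sum_(i <- s) \int[mu]_(x in D) f i x.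
Proof.
move=> mD fi; elim: s => [|i s IH].
  by rewrite big_nil; under eq_Rintegral do rewrite big_nil; rewrite /Rintegral integral0.
rewrite big_cons -IH -RintegralD//; last exact: integrable_EFin_sum.
by apply: eq_Rintegral => x _; rewrite big_cons.
Qed.

Lemma L2_mul_integrable u v : L2 u -> L2 v ->
  mu.-integrable setT (EFin \o (fun x => u x * v x)).
Proof.
move=> [mu1 iu] [mv iv].
apply: (le_integrable measurableT _ _ (integrableD measurableT iu iv)) => /=.
  by apply/measurable_EFinP; exact: measurable_funM.
move=> x _; rewrite lee_fin.
rewrite [leRHS]ger0_norm ?addr_ge0 ?sqr_ge0// normrM.
rewrite -(real_normK (num_real (u x))) -(real_normK (num_real (v x))).
have := sqr_ge0 (`|u x| - `|v x|); have := sqr_ge0 (`|u x| + `|v x|); nra.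
Qed.

Lemma L2_0 : L2 (fun=> 0).
Proof.
split => //; rewrite (_ : _ \o _ = cst 0%E); first exact: integrable0.
by apply/funext => x /=; rewrite expr0n.
Qed.

Lemma L2D u v : L2 u -> L2 v -> L2 (fun x => u x + v x).
Proof.
move=> [mu1 iu] [mv iv]; split; first exact: measurable_funD.
have i2 := integrable_EFinZ 2 measurableT (integrable_EFinD measurableT iu iv).
apply: (le_integrable measurableT _ _ i2) => /=.
  by apply/measurable_EFinP; apply: measurable_funX; exact: measurable_funD.
move=> x _; rewrite lee_fin [leLHS]ger0_norm ?sqr_ge0// [leRHS]ger0_norm; last first.
  by rewrite mulr_ge0// addr_ge0// sqr_ge0.
by have := sqr_ge0 (u x - v x); nra.
Qed.

Lemma L2Z a u : L2 u -> L2 (fun x => a * u x).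
Proof.
move=> [mu1 iu]; split; first exact: measurable_funM.
by under eq_fun do rewrite exprMn; exact: integrable_EFinZ.
Qed.

Lemma L2N u : L2 u -> L2 (fun x => - u x).
Proof.
by move=> /(L2Z (-1)); under [X in L2 X -> _]eq_fun do rewrite mulN1r.
Qed.

Lemma L2B u v : L2 u -> L2 v -> L2 (fun x => u x - v x).
Proof. by move=> uL vL; apply: L2D => //; exact: L2N. Qed.

Lemma L2_sum (I : Type) (s : seq I) (u : I -> X -> R) :
  (forall i, L2 (u i)) -> L2 (fun x => \sum_(i <- s) u i x).
Proof.
move=> uL; elim: s => [|i s IH].
  by under eq_fun do rewrite big_nil; exact: L2_0.
by under eq_fun do rewrite big_cons; exact: L2D.
Qed.

Lemma ipC u v : ip u v = ip v u.
Proof. by apply: eq_Rintegral => x _; rewrite mulrC. Qed.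

Lemma ipDl u v w : L2 u -> L2 v -> L2 w ->
  ip (fun x => u x + v x) w = ip u w + ip v w.
Proof.
move=> uL vL wL; rewrite -RintegralD//; [|exact: L2_mul_integrable..].
by apply: eq_Rintegral => x _; rewrite mulrDl.
Qed.

Lemma ipZl a u w : L2 u -> L2 w -> ip (fun x => a * u x) w = a * ip u w.
Proof.
move=> uL wL; rewrite -RintegralZl//; last exact: L2_mul_integrable.
by apply: eq_Rintegral => x _; rewrite mulrA.
Qed.

Lemma ipBl u v w : L2 u -> L2 v -> L2 w ->
  ip (fun x => u x - v x) w = ip u w - ip v w.
Proof.
move=> uL vL wL; rewrite -RintegralB//; [|exact: L2_mul_integrable..].
by apply: eq_Rintegral => x _; rewrite mulrBl.
Qed.

Lemma ipDr u v w : L2 u -> L2 v -> L2 w ->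
  ip w (fun x => u x + v x) = ip w u + ip w v.
Proof. by move=> uL vL wL; rewrite ipC ipDl// ![ip _ w]ipC. Qed.

Lemma ipBr u v w : L2 u -> L2 v -> L2 w ->
  ip w (fun x => u x - v x) = ip w u - ip w v.
Proof. by move=> uL vL wL; rewrite ipC ipBl// ![ip _ w]ipC. Qed.

Lemma ipZr a u w : L2 u -> L2 w -> ip w (fun x => a * u x) = a * ip w u.
Proof. by move=> uL wL; rewrite ipC ipZl// ipC. Qed.

Lemma ip_ge0 u : 0 <= ip u u.
Proof. by apply: Rintegral_ge0 => x _; rewrite -expr2 sqr_ge0. Qed.

Lemma eq_ip_ae u u' v v' : {ae mu, forall x, u x = u' x} ->
  {ae mu, forall x, v x = v' x} -> ip u v = ip u' v'.
Proof.
by move=> uu' vv'; apply: eq_Rintegral_ae; apply: filterS2 uu' vv' => x -> ->.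
Qed.

Lemma ip_sqrD u v : L2 u -> L2 v ->
  ip (fun x => u x + v x) (fun x => u x + v x) = ip u u + 2 * ip u v + ip v v.
Proof.
move=> uL vL; rewrite ipDl ?ipDr//; [|exact: L2D..].
by rewrite (ipC v u); ring.
Qed.

Lemma ip_sqrB u v : L2 u -> L2 v ->
  ip (fun x => u x - v x) (fun x => u x - v x) = ip u u - 2 * ip u v + ip v v.
Proof.
move=> uL vL; rewrite ipBl ?ipBr//; [|exact: L2B..].
by rewrite (ipC v u); ring.
Qed.

Lemma ip_young u v : L2 u -> L2 v -> 2 * ip u v <= ip u u + ip v v.
Proof.
move=> uL vL; have := ip_ge0 (fun x => u x - v x); rewrite ip_sqrB//; lra.
Qed.

Lemma ip_sqrD_le u v : L2 u -> L2 v ->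
  ip (fun x => u x + v x) (fun x => u x + v x) <= 2 * ip u u + 2 * ip v v.
Proof. by move=> uL vL; rewrite ip_sqrD//; have := ip_young uL vL; lra. Qed.

Lemma ip_sqrB_le u v : L2 u -> L2 v ->
  ip (fun x => u x - v x) (fun x => u x - v x) <= 2 * ip u u + 2 * ip v v.
Proof.
move=> uL vL; have := ip_ge0 (fun x => u x + v x).
by rewrite ip_sqrB// ip_sqrD//; lra.
Qed.

Lemma ip_cauchy_schwarz u v : L2 u -> L2 v -> ip u v ^+ 2 <= ip u u * ip v v.
Proof.
move=> uL vL; pose a := ip v v; pose b := ip u v.
have H c : 0 <= ip u u - 2 * c * b + c ^+ 2 * a.
  have := ip_ge0 (fun x => u x - c * v x); rewrite ip_sqrB//; last exact: L2Z.
  by rewrite ipZr// ipZl ?ipZr//; [rewrite -/a -/b; lra|exact: L2Z].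
have a0 : 0 <= a := ip_ge0 v.
(* If [v] has norm 0, the quadratic polynomial [H] in c is affine, and for b != 0 the choice c =
   (|u|^2 + 1) / b makes it negative. Otherwise its minimum, at c = b / a, gives the claim. *)
have [a00|an0] := eqVneq a 0.
  have := H ((ip u u + 1) * b); rewrite a00 mulr0 addr0 => H1.
  have u0 := ip_ge0 u; rewrite -/a a00 mulr0 -/b.
  have b2 := sqr_ge0 b; have : ip u u * b ^+ 2 >= 0 by rewrite mulr_ge0.
  have := H (b * (ip u u + 1) / 1); rewrite a00 divr1 => _.
  have [->|b0] := eqVneq b 0; first by rewrite expr0n.
  have := H ((ip u u + 1) / b); rewrite a00 mulr0 addr0.
  rewrite (_ : 2 * _ * b = 2 * (ip u u + 1)); [lra|by field].
have {}a0 : 0 < a by rewrite lt_neqAle eq_sym an0.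
have := H (b / a); rewrite (_ : _ - _ + _ = ip u u - b ^+ 2 / a); last by field.
by rewrite subr_ge0 ler_pdivrMr.
Qed.

Lemma norm_ip_le u v : L2 u -> L2 v ->
  `|ip u v| <= Num.sqrt (ip u u) * Num.sqrt (ip v v).
Proof.
move=> uL vL; rewrite -sqrtrM ?ip_ge0// -sqrtr_sqr ler_wsqrtr//.
exact: ip_cauchy_schwarz.
Qed.

(** Cauchy-Schwarz for finite sums is applied at each point x and then integrated. *)
Lemma ip_sum_sqr_le n (c : 'I_n -> R) (g : 'I_n -> X -> R) :
  (forall j, L2 (g j)) ->
  ip (fun x => \sum_j c j * g j x) (fun x => \sum_j c j * g j x) <=
  (\sum_j c j ^+ 2) * \sum_j ip (g j) (g j).
Proof.
move=> gL; have GL : L2 (fun x => \sum_j c j * g j x).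
  by apply: L2_sum => j; exact: L2Z.
have gi j : mu.-integrable setT (EFin \o (fun x => g j x * g j x)).
  exact: L2_mul_integrable.
have si := integrable_EFin_sum (index_enum 'I_n) measurableT gi.
rewrite -Rintegral_sum//.
rewrite -RintegralZl//; apply: le_Rintegral => //.
- exact: L2_mul_integrable.
- exact: integrable_EFinZ.
by move=> x _; rewrite -expr2 (le_trans (sumr_cauchy_schwarz _ _ _ _)).
Qed.

End square_integrable.

(** * Norms of exponent 2 on a subset as inner products *)

Section Lp_L2.
Set Implicit Arguments.
Context {R : realType} {dX : measure_display} {X : measurableType dX}.
Variable mu : {measure set X -> \bar R}.

Lemma Lp_L2 D u : Lp mu 2%:E D u <-> L2 mu (u \_ D).
Proof.
rewrite /Lp; split => [uL|[mu1 /integrableP[_ iu]]].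
  split; last exact: Lfun2_integrable_sqr.
  by move: uL; rewrite inE => /andP[]; rewrite inE.
rewrite inE; apply/andP; split; rewrite inE//= /finite_norm.
rewrite unlock /Lnorm poweR_lty//.
apply: le_lt_trans iu; apply: ge0_le_integral_ae => [x|x|]; rewrite ?poweR_ge0//.
by apply: aeW => x /=; rewrite lee_fin normrX powR_mulrn.
Qed.

Lemma poweR2V_EFin (a : R) : 0 <= a -> (a%:E `^ 2^-1)%E = (Num.sqrt a)%:E.
Proof. by move=> a0; rewrite poweR_EFin powR12_sqrt. Qed.

Lemma Lnorm2_ip u : L2 mu u -> 'N[mu]_2%:E[EFin \o u]%E = (Num.sqrt (ip mu u u))%:E.
Proof.
move=> uL; rewrite unlock /Lnorm -poweR2V_EFin ?ip_ge0//; congr poweR.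
rewrite /ip /Rintegral fineK; last first.
  by apply: integrable_fin_num => //; exact: L2_mul_integrable.
by apply: eq_integral => x _ /=; rewrite powR_mulrn// real_normK ?num_real.
Qed.

Lemma Lp_normE D u : L2 mu (u \_ D) ->
  Lp_norm mu 2%:E D u = (Num.sqrt (ip mu (u \_ D) (u \_ D)))%:E.
Proof. by move=> uL; rewrite /Lp_norm Lnorm2_ip. Qed.

Lemma Lp_norm_sqr D u : L2 mu (u \_ D) ->
  (Lp_norm mu 2%:E D u ^+ 2)%E = (ip mu (u \_ D) (u \_ D))%:E.
Proof. by move=> uL; rewrite Lp_normE// -EFin_expe sqr_sqrtr ?ip_ge0. Qed.

Lemma L2_restrict D u : measurable D -> L2 mu u -> L2 mu (u \_ D).
Proof.
move=> mD [mu1 iu]; split.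
  by apply/(measurable_restrictT _ mD); exact: measurable_funTS.
apply: le_integrable iu => //.
  apply/measurable_EFinP/measurable_funX/(measurable_restrictT _ mD).
  exact: measurable_funTS.
move=> x _ /=; rewrite lee_fin patchE; case: ifPn => // _.
by rewrite expr0n/= normr0.
Qed.

Lemma L2_indic D : measurable D -> (mu D < +oo)%E -> L2 mu (\1_D).
Proof.
move=> mD Doo; split; first exact: measurable_indic.
rewrite (_ : EFin \o _ = EFin \o \1_D); last first.
  by apply/funext => r /=; rewrite indicE; case: (_ \in _); rewrite ?expr0n ?expr1n.
apply/integrableP; split; first by apply/measurable_EFinP; exact: measurable_indic.
under eq_integral do rewrite /= ger0_norm//.
by rewrite integral_indic// setIT.
Qed.

Lemma ip_restrictl D u v : ip mu (u \_ D) v = \int[mu]_(x in D) (u x * v x).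
Proof.
rewrite Rintegral_mkcond; apply: eq_Rintegral => x _; rewrite !patchE.
by case: ifPn => // _; rewrite mul0r.
Qed.

Lemma ip_restrict D u v : ip mu (u \_ D) (v \_ D) = \int[mu]_(x in D) (u x * v x).
Proof.
rewrite Rintegral_mkcond; apply: eq_Rintegral => x _; rewrite !patchE.
by case: ifPn => // _; rewrite mul0r.
Qed.

Lemma restrictB D (u v : X -> R) : (u \- v) \_ D = (fun x => (u \_ D) x - (v \_ D) x).
Proof. by apply/funext => x; rewrite !patchE; case: ifPn => // _; rewrite subr0. Qed.

Lemma restrictZ D a (u : X -> R) : (fun x => a * u x) \_ D = (fun x => a * (u \_ D) x).
Proof. by apply/funext => x; rewrite !patchE; case: ifPn => // _; rewrite mulr0. Qed.

Lemma restrictD D (u v : X -> R) :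
  (fun x => u x + v x) \_ D = (fun x => (u \_ D) x + (v \_ D) x).
Proof. by apply/funext => x; rewrite !patchE; case: ifPn => // _; rewrite addr0. Qed.

Lemma integrable_patch D (f : X -> R) : measurable D ->
  mu.-integrable D (EFin \o f) <-> mu.-integrable setT (EFin \o f \_ D).
Proof.
move=> mD; rewrite (integrable_mkcond _ mD) (_ : (EFin \o f) \_ D = EFin \o f \_ D)//.
by apply/funext => x; rewrite /= !patchE; case: ifPn.
Qed.

Lemma Rintegral_eq0_ae f : (forall x, 0 <= f x) ->
  mu.-integrable setT (EFin \o f) -> \int[mu]_x f x = 0 -> {ae mu, forall x, f x = 0}.
Proof.
move=> f0 fi f00.
have := @ae_eq_integral_abs _ _ _ mu _ measurableT (EFin \o f) (measurable_int _ fi).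
rewrite (_ : (\int[mu]_x `|(EFin \o f) x| = 0)%E); last first.
  transitivity (\int[mu]_x (f x)%:E)%E.
    by apply: eq_integral => x _ /=; rewrite ger0_norm.
  by rewrite -[LHS]fineK ?[fine _]f00//; exact: integrable_fin_num.
by move=> [+ _] => /(_ erefl); apply: filterS => x /= /(_ I) [].
Qed.

Lemma ip_eq0_ae u : L2 mu u -> ip mu u u = 0 -> {ae mu, forall x, u x = 0}.
Proof.
move=> uL /Rintegral_eq0_ae h.
have : {ae mu, forall x, u x * u x = 0}.
  apply: h; last exact: L2_mul_integrable.
  by move=> x; rewrite -expr2 sqr_ge0.
by apply: filterS => x /eqP; rewrite mulf_eq0 orbb => /eqP.
Qed.

End Lp_L2.

(** * Fubini's theorem for square integrable functions on a product *)

Section product_L2.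
Set Implicit Arguments.
Unset Strict Implicit.
Context {R : realType} {d1 d2 : measure_display}.
Context {X1 : measurableType d1} {X2 : measurableType d2}.
Variables (m1 : {sigma_finite_measure set X1 -> \bar R})
  (m2 : {sigma_finite_measure set X2 -> \bar R}).
Implicit Types f g : X1 -> X2 -> R.

Lemma prod_integrable_ae g : (m1 \x m2)%E.-integrable setT (EFin \o uncurry g) ->
  {ae m1, forall t, m2.-integrable setT (EFin \o g t)}.
Proof. by move=> gi; apply: filterS (ae_integrable1 gi) => t. Qed.

Lemma prod_Rintegral g : (m1 \x m2)%E.-integrable setT (EFin \o uncurry g) ->
  m1.-integrable setT (EFin \o (fun t => \int[m2]_x g t x)) /\
  \int[m1]_t (\int[m2]_x g t x) = \int[(m1 \x m2)%E]_p uncurry g p.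
Proof.
move=> gi; pose F := fubini_F m2 (EFin \o uncurry g).
have iF : m1.-integrable setT F := integrable_fubini_F gi.
have FE : {ae m1, forall t, (\int[m2]_x g t x)%:E = F t}.
  apply: filterS (prod_integrable_ae gi) => t it.
  by rewrite /Rintegral fineK//; exact: integrable_fin_num.
have mF : measurable_fun setT (fun t => \int[m2]_x g t x).
  by apply: measurableT_comp => //; exact: measurable_int iF.
split.
  (* A real-valued integral reads an infinite inner integral as 0; hence the bound by [F] holds for
     every t, whereas equality holds for almost every t. *)
  apply: le_integrable iF => //; first exact/measurable_EFinP.
  move=> t _ /=; rewrite -/(F t) /Rintegral.
  have -> : (\int[m2]_x (g t x)%:E = F t)%E by [].
  by case: (F t) => //=; rewrite normr0 leey.
rewrite [RHS]/Rintegral -(integral12_prod_meas1 gi) -/F [LHS]/Rintegral; congr fine.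
exact: eq_integral_ae.
Qed.

Lemma prod_Rintegral2 g : (m1 \x m2)%E.-integrable setT (EFin \o uncurry g) ->
  \int[m2]_x (\int[m1]_t g t x) = \int[(m1 \x m2)%E]_p uncurry g p.
Proof.
move=> gi; pose G := fubini_G m1 (EFin \o uncurry g).
have GE : {ae m2, forall x, (\int[m1]_t g t x)%:E = G x}.
  apply: filterS (ae_integrable2 gi) => x ix.
  by rewrite /Rintegral fineK//; exact: integrable_fin_num.
rewrite [RHS]/Rintegral -(integral21_prod_meas1 gi) -/G [LHS]/Rintegral; congr fine.
exact: eq_integral_ae.
Qed.

Lemma prod_L2_ae2 g : L2 (m1 \x m2)%E (uncurry g) -> {ae m2, forall x, L2 m1 (g^~ x)}.
Proof.
move=> [mg gi]; apply: filterS (ae_integrable2 gi) => x it; split => //.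
exact: measurableT_comp mg (pair2_measurable x).
Qed.

Lemma prod_L2_ae g : L2 (m1 \x m2)%E (uncurry g) -> {ae m1, forall t, L2 m2 (g t)}.
Proof.
move=> [mg gi]; have := @prod_integrable_ae (fun t x => g t x ^+ 2).
rewrite (_ : uncurry _ = (fun p => uncurry g p ^+ 2)); last by apply/funext => -[].
move=> /(_ gi); apply: filterS => t it; split => //.
by have := measurableT_comp mg (pair1_measurable t).
Qed.

Lemma prod_ip f g : L2 (m1 \x m2)%E (uncurry f) -> L2 (m1 \x m2)%E (uncurry g) ->
  m1.-integrable setT (EFin \o (fun t => ip m2 (f t) (g t))) /\
  \int[m1]_t ip m2 (f t) (g t) = ip (m1 \x m2)%E (uncurry f) (uncurry g).
Proof.
move=> fL gL; have := @prod_Rintegral (fun t x => f t x * g t x).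
rewrite (_ : uncurry _ = (fun p => uncurry f p * uncurry g p)); last by apply/funext => -[].
by apply; exact: L2_mul_integrable.
Qed.

Lemma L2_tensor (a : X1 -> R) (u : X2 -> R) : L2 m1 a -> L2 m2 u ->
  L2 (m1 \x m2)%E (fun p => a p.1 * u p.2).
Proof.
move=> [ma ai] [mu ui]; split.
  by apply: measurable_funM; [exact: measurableT_comp measurable_fst|
    exact: measurableT_comp measurable_snd].
apply/integrableP; split.
  apply/measurable_EFinP/measurable_funX; apply: measurable_funM;
   [exact: measurableT_comp measurable_fst|exact: measurableT_comp measurable_snd].
rewrite fubini_tonelli1//=; last first.
  apply/measurable_EFinP; apply: measurableT_comp => //; apply: measurable_funX.
  by apply: measurable_funM; [exact: measurableT_comp measurable_fst|
    exact: measurableT_comp measurable_snd].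
rewrite /fubini_F/=.
have E t : (\int[m2]_x `|(a t * u x) ^+ 2|%:E =
    `|a t ^+ 2|%:E * \int[m2]_x `|u x ^+ 2|%:E)%E.
  rewrite -ge0_integralZl//.
  - by apply: eq_integral => x _; rewrite exprMn normrM EFinM.
  - apply/measurable_EFinP; apply: measurableT_comp => //.
    exact: measurable_funX.
under eq_integral do rewrite E.
rewrite ge0_integralZr//; last 2 first.
- apply/measurable_EFinP; apply: measurableT_comp => //; exact: measurable_funX.
- exact: integral_ge0.
move/integrableP : ai => [_ ai]; move/integrableP : ui => [_ ui].
by apply: lte_mul_pinfty => //; rewrite ?integral_ge0// ge0_fin_numE// integral_ge0.
Qed.

End product_L2.

(** * Smooth bump functions on the line *)

Section smooth_functions.
Set Implicit Arguments.
Context {R : realType}.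
Implicit Types (u v : R^o -> R) (p q : {poly R}).

Lemma CkD k u v : Ck k u -> Ck k v -> Ck k (fun x => u x + v x).
Proof.
elim: k u v => [|k IH] u v [cu hu] [cv hv]; split; try exact: continuousD.
  by move=> x; apply: cvgD; [exact: cu|exact: cv].
  by [].
  by move=> x; apply: cvgD; [exact: cu|exact: cv].
move=> w; have [du Du] := hu w; have [dv Dv] := hv w; split => [x|].
  exact: derivableD.
rewrite (_ : 'D_w _ = (fun x => 'D_w u x + 'D_w v x)); first exact: IH.
by apply/funext => x; rewrite deriveD.
Qed.

Lemma Ck_cst k (c : R) : Ck k (cst c : R^o -> R).
Proof.
elim: k c => [|n IHn] c; split => //; try exact: cst_continuous.
move=> z; split => //; rewrite (_ : 'D_z _ = cst 0)//.
by apply/funext => x; rewrite derive_cst.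
Qed.

Lemma CkS k u : Ck k.+1 u -> Ck k u.
Proof.
elim: k u => [|n IHn] u [cu hu]; split => // w.
by have [du Du] := hu w; split => //; exact: IHn.
Qed.

Lemma CkM k u v : Ck k u -> Ck k v -> Ck k (fun x => u x * v x).
Proof.
elim: k u v => [|k IH] u v.
  move=> [cu _] [cv _]; split => // x; apply: cvgM; [exact: cu|exact: cv].
move=> /[dup] cku [cu hu] /[dup] ckv [cv hv].
split; first by move=> x; apply: cvgM; [exact: cu|exact: cv].
move=> w; have [du Du] := hu w; have [dv Dv] := hv w; split => [x|].
  exact: derivableM.
rewrite (_ : 'D_w _ = (fun x => u x * 'D_w v x + v x * 'D_w u x)).
  by apply: CkD; apply: IH => //; exact: CkS.
by apply/funext => x; rewrite deriveM.
Qed.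

(** [Ck] asks for the derivatives in all directions w; on the line these are the multiples w u' of a
    single one. *)
Lemma Ck_derive1 k u (u' : R -> R) : (forall x : R, is_derive x 1 u (u' x)) ->
  Ck k (u' : R^o -> R) -> Ck k.+1 u.
Proof.
move=> du ku'.
have uw (w x : R) : is_derive x w (u : R^o -> R^o) (w * u' x).
  have := du x => -[du1 du2].
  have df : differentiable (u : R^o -> R^o) x by apply/derivable1_diffP.
  have dw : derivable (u : R^o -> R^o) x w by exact: diff_derivable.
  apply: DeriveDef => //.
  rewrite deriveE// (_ : w = w *: (1 : R^o)); last by rewrite /GRing.scale/= mulr1.
  by rewrite linearZ/= -deriveE// du2 /GRing.scale/= mulr1.
split.
  move=> x; apply: differentiable_continuous; apply/derivable1_diffP.
  by have [] := du x.
move=> w; split; first by move=> x; have [] := uw w x.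
rewrite (_ : 'D_w u = (fun x => cst w x * u' x)); last first.
  by apply/funext => x; have [_ ->] := uw w x.
by apply: CkM => //; exact: Ck_cst.
Qed.

(* x |-> p(1/x) exp(-1/x) for x > 0, extended by 0: this family is stable by derivation *)
Definition flat p (x : R) : R := if 0 < x then p.[x^-1] * expR (- x^-1) else 0.

(** With q = 1/x, the derivative of p(q) exp(-q) in x is q^2 (p(q) - p'(q)) exp(-q). *)
Definition flat_deriv p : {poly R} := 'X^2 * (p - p^`()).

(** With y = 1/h and n = 2 this makes [flat p h] of order h^2 at the right of 0, so that it has
    derivative 0 there. The exponent n is general because the induction on the polynomial raises it
    by one at each step. *)
Lemma horner_le_expR p n : exists2 M : R, 0 <= M &
  forall y, 0 < y -> `|p.[y]| * y ^+ n <= M * expR y.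
Proof.
have powE m y : 0 < y -> y ^+ m <= m`!%:R * expR y.
  case: m => [|m] y0; first by rewrite expr0 fact0 mul1r; have := expR_ge1Dx y; lra.
  have := expR_ge1Dxn m (ltW y0); rewrite -ler_pdivrMl ?ltr0n ?fact_gt0// mulrC; lra.
elim/poly_ind: p n => [|p c IH] n.
  by exists 0 => // y y0; rewrite horner0 normr0 !mul0r.
have [M M0 HM] := IH n.+1; exists (M + `|c| * n`!%:R).
  by rewrite addr_ge0// mulr_ge0.
move=> y y0; rewrite !hornerE mulrDl; apply: le_trans (_ : (`|p.[y]| * y + `|c|) * y ^+ n <= _).
  rewrite ler_wpM2r ?exprn_ge0 ?(ltW y0)// (le_trans (ler_normD _ _))//.
  by rewrite normrM (gtr0_norm y0).
rewrite mulrDl -mulrA -exprS lerD ?HM// -mulrA.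
by rewrite ler_wpM2l ?powE.
Qed.

Lemma is_derive_flat_pos p (x : R) : 0 < x ->
  is_derive x 1 (flat p : R^o -> R^o) (flat (flat_deriv p) x).
Proof.
move=> x0; have xn0 : x != 0 by rewrite gt_eqF.
pose h z : R := p.[z^-1] * expR (- z^-1).
have h1 : is_derive x 1 (fun z : R^o => z^-1 : R^o) (- x ^- 2).
  have := @is_deriveV _ (id : R -> R) x 1 1 xn0 (is_derive_id x 1).
  by rewrite /GRing.scale/= mulr1.
have h2 := @is_derive1_comp _ (horner p) (fun z => z^-1) x _ _ (is_derive_poly p x^-1) h1.
have h3 : is_derive x 1 (fun z : R^o => - z^-1 : R^o) (x ^- 2).
  by have := is_deriveN h1; rewrite opprK.
have h4 := @is_derive1_comp _ (@expR R) (fun z => - z^-1) x _ _ (is_derive_expR _) h3.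
have h5 := is_deriveM h2 h4.
apply: (@near_eq_is_derive _ _ _ (h : R^o -> R^o)).
  by near=> z; rewrite /flat /h ifT//; near: z; exact: lt_nbhsr.
apply: is_derive_eq h5 _.
transitivity (p.[x^-1] * (expR (- x^-1) * x ^- 2) + expR (- x^-1) * (p^`().[x^-1] * - x ^- 2)); first by [].
rewrite /flat x0 /flat_deriv hornerM hornerXn hornerD hornerN -!exprVn; ring.
Unshelve. all: by end_near. Qed.

Lemma is_derive_flat p (x : R) :
  is_derive x 1 (flat p : R^o -> R^o) (flat (flat_deriv p) x).
Proof.
have [x0|x0|->] := ltgtP x 0; last 2 first.
- exact: is_derive_flat_pos.
- have [M M0 HM] := horner_le_expR p 2.
  have bnd h : `|flat p h| <= M * h ^+ 2.
    rewrite /flat; case: ifPn => h0; last by rewrite normr0 mulr_ge0// sqr_ge0.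
    have := HM h^-1; rewrite invr_gt0 h0 => /(_ isT).
    rewrite exprVn ler_pdivrMr ?exprn_gt0// => H.
    rewrite expRN normrM (ger0_norm (_ : 0 <= (expR h^-1)^-1)) ?invr_ge0 ?expR_ge0//.
    rewrite ler_pdivrMr ?expR_gt0// (le_trans H)//; lra.
  have c : h^-1 *: ((flat p : R^o -> R^o) (h + 0) - flat p 0) @[h --> (0 : R^o)^'] --> (0 : R^o).
    apply/cvgrPdist_le => /= e e0.
    near=> h; rewrite addr0 {2}/flat ltxx subr0 sub0r normrN /GRing.scale/= normrM normfV.
    have h0 : h != 0 by near: h; exact: nbhs_dnbhs_neq.
    rewrite ler_pdivrMl ?normr_gt0// (le_trans (bnd h))// -(real_normK (num_real h)).
    rewrite expr2 mulrCA ler_wpM2l// (@le_trans _ _ ((M + 1) * `|h|))//.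
      by rewrite ler_wpM2r//; lra.
    rewrite mulrC -ler_pdivlMr; last by lra.
    near: h; apply: dnbhs0_le; rewrite divr_gt0//; lra.
  have Dc : derivable (flat p : R^o -> R^o) 0 1.
    apply/cvg_ex; exists 0; rewrite /=.
    by under eq_fun do rewrite /GRing.scale/= mulr1; exact: c.
  apply: DeriveDef => //; rewrite /flat ltxx -derive1E /derive1.
  exact: (cvg_lim _ c).
- apply: (@near_eq_is_derive _ _ _ (cst 0 : R^o -> R^o)).
    near=> z; rewrite /flat ifF//; apply/negbTE; rewrite -leNgt.
    by apply: ltW; near: z; exact: lt_nbhsl.
  by rewrite /flat ltNge (ltW x0)/=; exact: is_derive_cst.
Unshelve. all: by end_near. Qed.

(** The factor a of the chain rule is absorbed into the polynomial, so the derivative belongs to the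
    same family and the induction on k runs over all polynomials at once. *)
Lemma Ck_flat k p (a b : R) : Ck k ((fun x => flat p (a * x + b)) : R^o -> R).
Proof.
have D q (x : R) : is_derive x 1 ((fun x => flat q (a * x + b)) : R^o -> R^o)
    (flat (a%:P * flat_deriv q) (a * x + b)).
  have h : is_derive x 1 ((fun x => a * x + b) : R^o -> R^o) (a + 0).
    have := is_deriveD (is_deriveM (is_derive_cst a (x : R^o) 1)
      (is_derive_id (x : R^o) (1 : R^o))) (is_derive_cst b (x : R^o) 1).
    by move/is_derive_eq; apply; rewrite /GRing.scale/=; ring.
  have := @is_derive1_comp _ (flat q) _ x _ _ (is_derive_flat q _) h.
  by move/is_derive_eq; apply; rewrite /flat; case: ifPn => _; rewrite ?hornerM ?hornerC ?mul0r// addr0; ring.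
elim: k p => [|k IH] p; last by apply: Ck_derive1 (D p) _; exact: IH.
split => // x; apply: differentiable_continuous; apply/derivable1_diffP.
by have [] := D p x.
Qed.

Let leb := @lebesgue_measure R.

Lemma mollifier (a c : R) : a < c -> exists rho : R -> R,
  [/\ forall k, Ck k (rho : R^o -> R), forall x, 0 <= rho x,
      forall x, ~~ (a < x < c) -> rho x = 0,
      leb.-integrable setT (EFin \o rho) & \int[leb]_x rho x = 1].
Proof.
(* The product of exp(-1/(x - a)) and exp(-1/(c - x)) is positive exactly on ]a, c[. *)
move=> ac; pose b x := flat 1 (1 * x + - a) * flat 1 (-1 * x + c).
have Cb k : Ck k (b : R^o -> R) by apply: CkM; exact: Ck_flat.
have f0 x : 0 <= flat 1 x by rewrite /flat; case: ifPn => // _; rewrite hornerE mul1r expR_ge0.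
have b0 x : 0 <= b x by exact: mulr_ge0.
have bE x : (0 < b x) = (a < x < c).
  have fE y : (0 < flat 1 y) = (0 < y).
    by rewrite /flat; case: ifPn; rewrite ?ltxx// hornerE mul1r expR_gt0.
  have -> : (a < x < c) = (0 < flat 1 (1 * x + - a)) && (0 < flat 1 (-1 * x + c)).
    by rewrite !fE mul1r mulN1r subr_gt0 [- x + c]addrC subr_gt0.
  rewrite /b; have := f0 (1 * x + - a); have := f0 (-1 * x + c).
  rewrite !le_eqVlt => /orP[/eqP <-|p1] /orP[/eqP <-|p2]; rewrite ?mul0r ?mulr0 ?ltxx ?andbF//.
  by rewrite p1 p2 mulr_gt0.
have bout x : ~~ (a < x < c) -> b x = 0.
  by rewrite -bE => h; apply/eqP; rewrite eq_le b0 andbT leNgt.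
have cb : continuous (b : R^o -> R^o) by have [] := Cb 0%N.
have ib : leb.-integrable setT (EFin \o b).
  have : leb.-integrable `[a, c] (EFin \o b).
    apply: continuous_compact_integrable; first exact: segment_compact.
    by apply: continuous_subspaceT.
  rewrite integrable_mkcond//; congr integrable; apply/funext => x /=.
  rewrite patchE; case: ifPn => // xac; rewrite bout//; apply: contra xac => /andP[ax xc].
  by rewrite inE/= in_itv/= !ltW.
(* With a zero integral [b] would vanish almost everywhere, hence ]a, c[ would be a null set. *)
have m0 : 0 < \int[leb]_x b x.
  rewrite lt_neqAle Rintegral_ge0// andbT eq_sym; apply/eqP => /(@Rintegral_eq0_ae R _ (measurableTypeR R) leb b b0 ib).
  move=> H.
  have : leb `]a, c[%classic = 0.
    apply/negligibleP => //.
    apply: negligibleS (_ : leb.-negligible (~` [set x | b x = 0])) => //.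
    by move=> x /=; rewrite in_itv/= -bE => /[swap] ->; rewrite ltxx.
  rewrite /leb lebesgue_measure_itv/= lte_fin ac -EFinB => -[]; lra.
set m := \int[leb]_x b x in m0 *.
exists (fun x => m^-1 * b x); split.
- by move=> k; apply: (@CkM k (fun=> m^-1) b) => //; exact: Ck_cst.
- by move=> x; rewrite mulr_ge0// invr_ge0 ltW.
- by move=> x /bout ->; rewrite mulr0.
- exact: integrable_EFinZ.
- by rewrite RintegralZl// -/m mulVf// gt_eqF.
Qed.

Lemma mollifier_primitive (rho : R -> R) : continuous (rho : R^o -> R^o) ->
  leb.-integrable setT (EFin \o rho) -> forall x : R,
  is_derive x 1 ((fun x => \int[leb]_(t in `]-oo, x]) rho t) : R^o -> R^o) (rho x).
Proof.
move=> cr ir x.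
have x1 : x < x + 1 by rewrite ltrDl.
have ix : leb.-integrable [set` Interval -oo%O (BRight (x + 1))] (EFin \o rho).
  exact: integrableS ir.
have [d1 d2] := continuous_FTC1 x1 ix (ltNyr x) (cr x).
by apply: DeriveDef; [exact: d1|rewrite -derive1E].
Qed.

End smooth_functions.

(** * Weak derivatives on an interval as absolutely continuous functions *)

Section du_bois_reymond.
Set Implicit Arguments.
Context {R : realType}.
Notation leb := (@lebesgue_measure R).

Lemma measurable_time (T : R) : measurable (time T).
Proof. exact: measurable_itv. Qed.

(** The primitive of rho1 - rho2 rises from 0 to 1 on ]a, b[ and falls back on ]c, e[. It is a
    smooth substitute for the indicator of an interval, whose derivative averages near the left end
    and subtracts an average near the right end. *)
Lemma test_function_mollifier_step (T a b c e : R) (rho1 rho2 : R -> R) :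
  0 < a -> a < b -> b <= c -> c < e -> e < T ->
  (forall k, Ck k (rho1 : R^o -> R)) -> (forall k, Ck k (rho2 : R^o -> R)) ->
  (forall x, 0 <= rho1 x) -> (forall x, 0 <= rho2 x) ->
  (forall x, ~~ (a < x < b) -> rho1 x = 0) ->
  (forall x, ~~ (c < x < e) -> rho2 x = 0) ->
  leb.-integrable setT (EFin \o rho1) -> leb.-integrable setT (EFin \o rho2) ->
  \int[leb]_x rho1 x = 1 -> \int[leb]_x rho2 x = 1 ->
  exists eta : R -> R, [/\ test_function (time T) (eta : R^o -> R),
    forall x : R, is_derive x 1 (eta : R^o -> R^o) (rho1 x - rho2 x),
    forall x, 0 <= eta x <= 1,
    forall x, b <= x <= c -> eta x = 1 & forall x, ~~ (a <= x <= e) -> eta x = 0].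
Proof.
move=> a0 ab bc ce eT C1 C2 r1 r2 s1 s2 i1 i2 m1 m2.
pose S rho x := \int[leb]_(t in `]-oo, x]) rho t.
have c1 : continuous (rho1 : R^o -> R^o) by have [] := C1 0%N.
have c2 : continuous (rho2 : R^o -> R^o) by have [] := C2 0%N.
have S0 rho x y : (forall z, z <= y -> rho z = 0) -> x <= y -> S rho x = 0.
  move=> r0 xy; rewrite /S (@eq_Rintegral _ _ _ _ _ (fun=> 0)).
    by rewrite /Rintegral integral0.
  by move=> z; rewrite inE/= in_itv/= => zx; rewrite r0// (le_trans zx).
have S1 rho x y : leb.-integrable setT (EFin \o rho) -> \int[leb]_x rho x = 1 ->
    (forall z, y <= z -> rho z = 0) -> y <= x -> S rho x = 1.
  move=> ir m r0 xy; rewrite -m /S [LHS]Rintegral_mkcond; apply: eq_Rintegral => z _.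
  rewrite patchE; case: ifPn => //; rewrite notin_setE/= in_itv/= => /negP.
  by rewrite -ltNge => xz; rewrite r0// (le_trans xy)// ltW.
have Sb rho x : leb.-integrable setT (EFin \o rho) -> \int[leb]_x rho x = 1 ->
    (forall z, 0 <= rho z) -> 0 <= S rho x <= 1.
  move=> ir m r0; apply/andP; split; first exact: Rintegral_ge0.
  rewrite -m /S [leLHS]Rintegral_mkcond; apply: le_Rintegral => //.
    have mi : measurable (`]-oo, x]%classic : set (measurableTypeR R)) by exact: measurable_itv.
    by apply/(@integrable_patch R _ (measurableTypeR R) leb _ rho mi); exact: integrableS ir.
  by move=> z _; rewrite patchE; case: ifPn.
have S10 x : x <= a -> S rho1 x = 0.
  by apply: S0 => z za; apply: s1; rewrite ltNge za.
have S11 x : b <= x -> S rho1 x = 1.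
  by apply: S1 => // z bz; apply: s1; rewrite andbC ltNge bz.
have S20 x : x <= c -> S rho2 x = 0.
  by apply: S0 => z za; apply: s2; rewrite ltNge za.
have S21 x : e <= x -> S rho2 x = 1.
  by apply: S1 => // z bz; apply: s2; rewrite andbC ltNge bz.
pose eta x := S rho1 x - S rho2 x.
have D (x : R) : is_derive x 1 (eta : R^o -> R^o) (rho1 x - rho2 x).
  exact: is_deriveB (mollifier_primitive c1 i1 x) (mollifier_primitive c2 i2 x).
have sup x : ~~ (a <= x <= e) -> eta x = 0.
  rewrite negb_and -!ltNge => /orP[xa|ex]; rewrite /eta.
    by rewrite S10 ?S20 ?subr0// ltW//; lra.
  by rewrite S11 ?S21 ?subrr//; lra.
have cl : closure [set x : R^o | eta x != 0] `<=` `[a, e]%classic.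
  rewrite closureE; apply: smallest_sub; first exact: interval_closed.
  by move=> x /=; rewrite in_itv/=; apply: contraR => /sup ->.
exists eta; split => //.
- split.
  + move=> k.
    apply: CkS; apply: (@Ck_derive1 _ k eta _ D).
    have -> : (fun x => rho1 x - rho2 x) = (fun x => rho1 x + (cst (-1) x) * rho2 x).
      by apply/funext => x; rewrite mulN1r.
    apply: (@CkD _ k (rho1 : R^o -> R) (fun x => cst (-1) x * rho2 x)) => //.
    by apply: (@CkM _ k (cst (-1)) rho2) => //; exact: Ck_cst.
  + apply: subclosed_compact cl; first exact: closed_closure.
    exact: segment_compact.
  + move=> x /cl/=; rewrite /time/= !in_itv/= => /andP[ax xe].
    by rewrite (lt_le_trans a0)// (le_lt_trans xe).
- move=> x; have [xc|cx] := leP x c.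
    by rewrite /eta S20// subr0 Sb.
  by rewrite /eta S11; [have := Sb rho2 x i2 m2 r2; lra|lra].
- by move=> x /andP[bx xc]; rewrite /eta S11// S20// subr0.
Qed.

Lemma mollifier_mean (k : R -> R) (s e T a b : R) (rho : R -> R) : 0 <= a -> b <= T ->
  {within `[0, T], continuous k} ->
  (forall x, 0 <= rho x) -> (forall x, ~~ (a < x < b) -> rho x = 0) ->
  leb.-integrable setT (EFin \o rho) -> \int[leb]_x rho x = 1 -> continuous (rho : R^o -> R^o) ->
  (forall x, a < x < b -> `|k x - k s| <= e) ->
  `|\int[leb]_(t in time T) (k t * rho t) - k s| <= e.
Proof.
move=> a0 bT ck r0 rs ir m cr H.
have mt := measurable_time T.
have ir' : leb.-integrable (time T) (EFin \o rho) by exact: integrableS ir.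
have ikr : leb.-integrable (time T) (EFin \o (fun t => k t * rho t)).
  apply: integrableS (_ : leb.-integrable `[0, T] _) => //.
    exact: subset_itv_oo_cc.
  apply: continuous_compact_integrable; first exact: segment_compact.
  by move=> x; apply: cvgM; [exact: ck|exact: continuous_subspaceT].
have m' : \int[leb]_(t in time T) rho t = 1.
  rewrite -m [LHS]Rintegral_mkcond; apply: eq_Rintegral => x _.
  rewrite patchE; case: ifPn => //; rewrite notin_setE /time/= in_itv/= => /negP h.
  by rewrite rs//; apply: contra h => /andP[ax xb]; rewrite (le_lt_trans a0)//= (lt_le_trans xb).
have E : \int[leb]_(t in time T) (k t * rho t) - k s =
    \int[leb]_(t in time T) ((k t - k s) * rho t).
  rewrite -[k s in LHS]mulr1 -m' -RintegralZl// -RintegralB//; last exact: integrable_EFinZ.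
  by apply: eq_Rintegral => x _; rewrite mulrBl.
have ikr2 : leb.-integrable (time T) (EFin \o (fun t => (k t - k s) * rho t)).
  under eq_fun do rewrite mulrBl.
  by apply: integrable_EFinB => //; exact: integrable_EFinZ.
rewrite E (le_trans (le_normr_Rintegral _ _))//.
rewrite -[e]mulr1 -m' -RintegralZl//; apply: le_Rintegral => //.
- by have := integrable_norm ikr2.
- exact: integrable_EFinZ.
- move=> x _; rewrite normrM (ger0_norm (r0 x)).
  have [xab|/rs ->] := boolP (a < x < b); last by rewrite !mulr0.
  by rewrite ler_wpM2r// H.
Qed.
End du_bois_reymond.

Section du_bois_reymond.
Set Implicit Arguments.
Context {R : realType}.
Notation leb := (@lebesgue_measure R).

(** The weak derivative is tested with smooth approximations of the indicator of ]s, t[. The side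
    with k' converges by dominated convergence; the other side consists of two averages of the
    continuous representative, which concentrate at s and at t. *)
Lemma du_bois_reymond (T : R) (k k' kc : R -> R) :
  scalar_derivative T k k' -> {within `[0, T], continuous kc} ->
  {ae leb, forall t, time T t -> kc t = k t} ->
  leb.-integrable (time T) (EFin \o k') ->
  forall s t, 0 <= s -> s <= t -> t <= T ->
  kc t - kc s = \int[leb]_(r in `]s, t]) (k' \_ (time T)) r.
Proof.
move=> kk' ckc kck ik' s t s0 st tT.
have mt := measurable_time T.
have ik := (@integrable_patch R _ (measurableTypeR R) leb _ k' mt).1 ik'.
have [->|st'] := eqVneq s t.
  by rewrite subrr set_itv_ge ?bnd_simp// Rintegral_set0.
have {}st : s < t by rewrite lt_neqAle st'.
(* The ramps lie between s + e and s + 2 e and between t - 2 e and t - e. The factor 1/4 keeps them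
   from overlapping, and the gaps of length e keep the support inside ]0, T[ even if s = 0 or t =
   T. *)
pose e n : R := (t - s) / 4 * n.+1%:R^-1.
have e0 n : 0 < e n by rewrite mulr_gt0 ?divr_gt0 ?subr_gt0// invr_gt0 ltr0n.
have e4 n : 4 * e n <= t - s.
  have : n.+1%:R^-1 <= 1 :> R by rewrite invf_le1 ?ltr0n// ler1n.
  rewrite (_ : 4 * e n = (t - s) * n.+1%:R^-1); last by rewrite /e; field.
  by apply: ler_piMr; lra.
have cvge : e n @[n --> \oo] --> 0.
  rewrite -[X in _ --> X](mulr0 ((t - s) / 4)).
  by apply: cvgM; [exact: cvg_cst|exact: cvg_harmonic].
have H n : exists eta rho1 rho2 : R -> R, [/\
   test_function (time T) (eta : R^o -> R),
   [/\ forall x : R, is_derive x 1 (eta : R^o -> R^o) (rho1 x - rho2 x),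
    forall x, 0 <= eta x <= 1,
    forall x, s + 2 * e n <= x <= t - 2 * e n -> eta x = 1 &
    forall x, ~~ (s < x < t) -> eta x = 0],
   [/\ forall x, 0 <= rho1 x, forall x, ~~ (s < x < s + 2 * e n) -> rho1 x = 0,
     leb.-integrable setT (EFin \o rho1), \int[leb]_x rho1 x = 1 &
     continuous (rho1 : R^o -> R^o)] &
   [/\ forall x, 0 <= rho2 x, forall x, ~~ (t - 2 * e n < x < t) -> rho2 x = 0,
     leb.-integrable setT (EFin \o rho2), \int[leb]_x rho2 x = 1 &
     continuous (rho2 : R^o -> R^o)]].
  have := e0 n; have := e4 n => e4n e0n.
  have [|rho1 [C1 r1 s1 i1 m1]] := @mollifier R (s + e n) (s + 2 * e n); first lra.
  have [|rho2 [C2 r2 s2 i2 m2]] := @mollifier R (t - 2 * e n) (t - e n); first lra.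
  have [| | | | |eta [t1 t2 t3 t4 t5]] := @test_function_mollifier_step R T
    (s + e n) (s + 2 * e n) (t - 2 * e n) (t - e n) rho1 rho2 _ _ _ _ _ C1 C2 r1 r2 s1 s2 i1 i2 m1 m2; try lra.
  exists eta, rho1, rho2; split => //; split => //.
  - by move=> x xst; apply: t5; apply: contra xst => /andP[? ?]; apply/andP; split; lra.
  - by move=> x xst; apply: s1; apply: contra xst => /andP[? ?]; apply/andP; split; lra.
  - by have [] := C1 0%N.
  - by move=> x xst; apply: s2; apply: contra xst => /andP[? ?]; apply/andP; split; lra.
  - by have [] := C2 0%N.
pose eta n := sval (cid (H n)).
have etaP n := svalP (cid (H n)).
have eta01 n x : 0 <= eta n x <= 1.
  by have [r1 [r2 [_ [_ h _ _] _ _]]] := etaP n; exact: h.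
have ceta n : continuous (eta n : R^o -> R^o).
  have [r1 [r2 [_ [D _ _ _] _ _]]] := etaP n.
  move=> x; apply: differentiable_continuous; apply/derivable1_diffP.
  by have [] := D x.
pose g := k' \_ (time T).
have mg : measurable_fun setT g by apply/measurable_EFinP; exact: measurable_int ik.
have lim1 : \int[leb]_(x in time T) (k' x * eta n x) @[n --> \oo] -->
    \int[leb]_(r in `]s, t]) g r.
  have E1 n : \int[leb]_(x in time T) (k' x * eta n x) = \int[leb]_x (g x * eta n x).
    by rewrite -(@ip_restrictl R _ (measurableTypeR R) leb).
  under eq_fun do rewrite E1.
  (* The functions [eta n] vanish at s and at t, so that their limit is the indicator of the open
     interval. *)
  have -> : \int[leb]_(r in `]s, t]) g r = \int[leb]_r (g \_ `]s, t[%classic) r.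
    rewrite -Rintegral_mkcond /Rintegral integral_itv_bndoo//.
    by apply/measurable_EFinP; exact: measurable_funTS.
  have igst : leb.-integrable setT (EFin \o g \_ `]s, t[%classic).
    have mi : measurable (`]s, t[%classic : set (measurableTypeR R)) by exact: measurable_itv.
    by apply/(@integrable_patch R _ (measurableTypeR R) leb _ g mi); exact: integrableS ik.
  apply: fine_cvg; rewrite fineK; last exact: integrable_fin_num.
  have mi : measurable (`]s, t[%classic : set (measurableTypeR R)) by exact: measurable_itv.
  have cvx (x : R) : g x * eta n x @[n --> \oo] --> (g \_ `]s, t[%classic) x.
    rewrite patchE; case: ifPn => [|xst].
      rewrite inE/= in_itv/= => /andP[sx xt].
      apply: cvg_near_cst; near=> n.
      have [r1 [r2 [_ [_ _ h _] _ _]]] := etaP n.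
      suff -> : eta n x = 1 by rewrite mulr1.
      apply: h.
      have : e n <= Num.min ((x - s) / 2) ((t - x) / 2).
        near: n; apply: (cvgr_le 0) => //; by rewrite lt_min !divr_gt0 ?subr_gt0.
      rewrite le_min => /andP[]; move: (e n) => q ex ey.
      by clear -ex ey; apply/andP; split; lra.
    rewrite (_ : (fun n => _) = fun=> 0); first exact: cvg_cst.
    apply/funext => n; have [r1 [r2 [_ [_ _ _ h] _ _]]] := etaP n.
    suff -> : eta n x = 0 by rewrite mulr0.
    by apply: h; move: xst; rewrite notin_setE/= in_itv/= => /negP.
  have [] := @dominated_convergence _ (measurableTypeR R) R leb setT measurableT
    (fun n x => (g x * eta n x)%:E) (fun x => ((g \_ `]s, t[%classic) x)%:E)
    (fun x => `|g x|%:E).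
  - move=> n; apply/measurable_EFinP; apply: measurable_funM => //.
    exact: continuous_measurable_fun (ceta n).
  - exact: measurable_int igst.
  - by apply: aeW => x _; apply: cvg_EFin; [exact: nearW|exact: cvx].
  - exact: integrable_norm ik.
  - apply: aeW => x n _; rewrite /= lee_fin normrM ler_piMr//.
    by have /andP[? ?] := eta01 n x; rewrite ger0_norm.
  by move=> _ _.
have wc (z d : R) : 0 <= z <= T -> 0 < d ->
    exists2 r, 0 < r & forall x, 0 <= x <= T -> `|x - z| < r -> `|kc x - kc z| <= d.
  move=> zT d0; have /subspace_continuousP := ckc => /(_ z).
  rewrite /= in_itv/= => /(_ zT) /cvgrPdist_le/(_ _ d0).
  rewrite near_withinE => /nbhs_ballP[r /= r0 rH]; exists r => // x xT xz.
  by rewrite distrC; apply: rH; rewrite /= ?in_itv// /ball/= distrC.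
have lim2 : \int[leb]_(x in time T) (k x * 'D_1 (eta n : R^o -> R^o) x) @[n --> \oo] -->
    kc s - kc t.
  apply/cvgrPdist_le => d d0; have d20 : 0 < d / 2 by rewrite divr_gt0.
  have [|r1 r10 H1] := wc s _ _ d20; first by rewrite s0 (le_trans (ltW st)).
  have [|r2 r20 H2] := wc t _ _ d20; first by rewrite tT (le_trans s0 (ltW st)).
  near=> n.
  have : 2 * e n < Num.min r1 r2.
    have : e n < Num.min r1 r2 / 2.
      near: n; apply: (cvgr_lt 0) => //; rewrite divr_gt0// lt_min r10//.
    by rewrite ltr_pdivlMr// mulrC.
  rewrite lt_min => /andP[er1 er2].
  have [rho1 [rho2 [_ [D _ _ _] [p1 q1 i1 m1 c1] [p2 q2 i2 m2 c2]]]] := etaP n.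
  have e4n := e4 n; have e0n := e0 n.
  have ikr rho : continuous (rho : R^o -> R^o) -> leb.-integrable (time T) (EFin \o (fun t => kc t * rho t)).
    move=> cr; apply: integrableS (_ : leb.-integrable `[0, T] _) => //.
      exact: subset_itv_oo_cc.
    apply: continuous_compact_integrable; first exact: segment_compact.
    by move=> x; apply: cvgM; [exact: ckc|exact: continuous_subspaceT].
  have -> : \int[leb]_(x in time T) (k x * 'D_1 (eta n : R^o -> R^o) x) =
    \int[leb]_(x in time T) (kc x * rho1 x) - \int[leb]_(x in time T) (kc x * rho2 x).
    rewrite -RintegralB//; [|exact: ikr|exact: ikr].
    apply: eq_Rintegral_in_ae; apply: filterS kck => x kx xT.
    by have [_ ->] := D x; rewrite -kx// mulrBr.
  have B1 : `|\int[leb]_(x in time T) (kc x * rho1 x) - kc s| <= d / 2.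
    apply: (@mollifier_mean _ kc s (d / 2) T s (s + 2 * e n) _ s0) => //.
      by clear -e4n e0n tT st; lra.
    move=> x /andP[sx xs]; clear -sx xs s0 tT e0n e4n er1 H1.
    by apply: H1; [apply/andP; split; lra|rewrite gtr0_norm; lra].
  have B2 : `|\int[leb]_(x in time T) (kc x * rho2 x) - kc t| <= d / 2.
    apply: (@mollifier_mean _ kc t (d / 2) T (t - 2 * e n) t _ _ tT) => //.
      by clear -e4n e0n s0 st; lra.
    move=> x /andP[sx xs]; clear -sx xs s0 tT e0n e4n er2 H2.
    by apply: H2; [apply/andP; split; lra|rewrite ltr0_norm; lra].
  move: B1 B2; clear; rewrite !ler_norml => /andP[? ?] /andP[? ?]; apply/andP; split; lra.
have lim3 : \int[leb]_(x in time T) (k' x * eta n x) @[n --> \oo] --> kc t - kc s.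
  rewrite -opprB; have -> : (fun n => \int[leb]_(x in time T) (k' x * eta n x)) =
     (fun n => - \int[leb]_(x in time T) (k x * 'D_1 (eta n : R^o -> R^o) x)).
    apply/funext => n; have [r1 [r2 [tf _ _ _]]] := etaP n.
    by rewrite (kk' _ tf).
  exact: cvgN.
exact: cvg_unique lim3 lim1.
Unshelve. all: by end_near. Qed.
End du_bois_reymond.

(** * Backward difference quotients under the integral *)

Section difference_quotient.
Set Implicit Arguments.
Unset Strict Implicit.
Context {R : realType}.
Notation leb := (@lebesgue_measure R).

Lemma cvg_diff_quotient (P : R -> R) (t l : R) (h : nat -> R) :
  is_derive t 1 (P : R^o -> R^o) l ->
  (forall n, 0 < h n) -> h n @[n --> \oo] --> 0 ->
  (h n)^-1 * (P t - P (t - h n)) @[n --> \oo] --> l.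
Proof.
move=> [dP Pl] h0 hc.
have cF : r^-1 * (P (r + t) - P t) @[r --> (0 : R)^'] --> l.
  rewrite -Pl -derive1E /derive1; move: dP; rewrite /derivable.
  rewrite (_ : (fun h0 : R^o => h0^-1 *: ((P \o shift t) (h0 *: 1) - P t)) = (fun r => r^-1 * (P (r + t) - P t))).
    by [].
  by apply/funext => r /=; rewrite /GRing.scale/= mulr1.
have /cvgr_dnbhsP/(_ (fun n => - h n)) := cF.
have hc' : - h n @[n --> \oo] --> (0 : R) by rewrite -oppr0; exact: cvgN.
have hn0 n : - h n != 0 by rewrite oppr_eq0 gt_eqF.
move=> /(_ (conj hn0 hc')) H.
apply: cvg_trans H; apply: near_eq_cvg; apply: nearW => n.
by rewrite invrN mulNr -mulrN opprB [- h n + t]addrC.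
Qed.

(** In terms of a primitive P of phi, the integral is (P T - P (T - h)) - (P 0 - P (0 - h)); divided
    by h, the two brackets tend to phi T and phi 0. *)
Lemma cvg_integral_shift_quotient (phi : R -> R) (T : R) (h : nat -> R) : 0 < T ->
  continuous (phi : R^o -> R^o) ->
  (forall n, 0 < h n <= 1) -> h n @[n --> \oo] --> 0 ->
  (h n)^-1 * \int[leb]_(t in `[0, T]) (phi t - phi (t - h n)) @[n --> \oo] --> phi T - phi 0.
Proof.
move=> T0 cphi h01 hc.
have h0 n : 0 < h n by have /andP[] := h01 n.
(* Shifts by h <= 1 of the points used lie to the right of -2, where this primitive is
   differentiable. *)
pose P x := \int[leb]_(t in `[-2, x]) phi t.
have ciw (f : R -> R) (a b : R) : continuous (f : R^o -> R^o) -> leb.-integrable `[a, b] (EFin \o f).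
  move=> cf; apply: continuous_compact_integrable; first exact: segment_compact.
  by apply: continuous_subspaceT.
have dP (x : R) : -2 < x -> is_derive x 1 (P : R^o -> R^o) (phi x).
  move=> x2; have x1 : x < x + 1 by rewrite ltrDl.
  have [d1 d2] := continuous_FTC1_closed x1 (ciw phi (-2) (x + 1) cphi) x2 (cphi x).
  by apply: DeriveDef; [exact: d1|rewrite -derive1E].
have cP (x : R) : -2 < x -> {for x, continuous (P : R^o -> R^o)}.
  move=> x2; apply: differentiable_continuous; apply/derivable1_diffP.
  by have [] := dP x x2.
have FTC (Q f : R -> R) : continuous (f : R^o -> R^o) ->
    (forall x : R, -1 < x -> is_derive x 1 (Q : R^o -> R^o) (f x)) ->
    \int[leb]_(t in `[0, T]) f t = Q T - Q 0.
  move=> cf dQ.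
  have cQ (x : R) : -1 < x -> {for x, continuous (Q : R^o -> R^o)}.
    move=> x2; apply: differentiable_continuous; apply/derivable1_diffP.
    by have [] := dQ x x2.
  rewrite /Rintegral (@continuous_FTC2 _ f Q)//.
  - by apply: continuous_subspaceT.
  - split.
    + move=> x; rewrite in_itv/= => /andP[x0 _]; have [] := dQ x => //; lra.
    + by apply: cvg_at_right_filter; apply: cQ; lra.
    + by apply: cvg_at_left_filter; apply: cQ; lra.
  - move=> x; rewrite in_itv/= => /andP[x0 _]; rewrite derive1E.
    by have [] := dQ x => //; lra.
have E n : \int[leb]_(t in `[0, T]) (phi t - phi (t - h n)) =
    (P T - P (T - h n)) - (P 0 - P (0 - h n)).
  have csh : continuous ((fun t => phi (t - h n)) : R^o -> R^o).
    move=> x; apply: continuous_comp; last exact: cphi.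
    by apply: cvgB; [exact: cvg_id|exact: cvg_cst].
  rewrite RintegralB//; [|exact: ciw|exact: ciw].
  have -> : \int[leb]_(t in `[0, T]) phi t = P T - P 0.
    by apply: FTC => // x x1; apply: dP; lra.
  have -> : \int[leb]_(t in `[0, T]) phi (t - h n) = P (T - h n) - P (0 - h n).
    apply: (FTC (fun t => P (t - h n))) => //.
    move=> x x1; have /andP[hn0 hn1] := h01 n.
    have d1 : is_derive x 1 ((fun t => t - h n) : R^o -> R^o) (1 - 0).
      exact: (is_deriveB (is_derive_id (x : R^o) (1 : R^o)) (is_derive_cst (h n) (x : R^o) 1)).
    have d2 : is_derive (x - h n) 1 (P : R^o -> R^o) (phi (x - h n)) by apply: dP; lra.
    have := @is_derive1_comp _ P (fun t => t - h n) x _ _ d2 d1.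
    by move/is_derive_eq; apply; rewrite subr0 mulr1.
  by ring.
under eq_fun do rewrite E mulrBr.
apply: cvgB.
  by apply: cvg_diff_quotient => //; apply: dP; lra.
by apply: cvg_diff_quotient => //; apply: dP; lra.
Qed.

End difference_quotient.

(** * Averages over past time intervals *)

Section averages.
Set Implicit Arguments.
Context {R : realType} {d : measure_display} {X : measurableType d}.
Variable mu : {sigma_finite_measure set X -> \bar R}.
Notation leb := (@lebesgue_measure R).
Implicit Types g : measurableTypeR R -> X -> R.

Lemma measurable_fun_Rintegral d1 d2 (X1 : measurableType d1) (X2 : measurableType d2)
    (m2 : {sigma_finite_measure set X2 -> \bar R}) (K : X1 * X2 -> R) :
  measurable_fun setT K -> measurable_fun setT (fun x => \int[m2]_y K (x, y)).
Proof.
move=> mK; apply: measurableT_comp => //.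
have -> : (fun x => \int[m2]_y (K (x, y))%:E)%E =
    (fun x => fubini_F m2 (EFin \o K)^\+ x - fubini_F m2 (EFin \o K)^\- x)%E.
  apply/funext => x; rewrite [LHS]integralE; congr (_ - _)%E.
    by apply: eq_integral => y _; rewrite /= !funeposE.
  by apply: eq_integral => y _; rewrite /= !funenegE.
have mEK : measurable_fun setT (EFin \o K) by exact/measurable_EFinP.
apply: emeasurable_funB; apply: measurable_fun_fubini_tonelli_F => //.
  exact: measurable_funepos.
exact: measurable_funeneg.
Qed.

(** The backward Steklov average. The window ends at t because the equation integrated over ]t - h,
    t] is tested with the value at its right end. *)
Definition avg (h : R) g (t : measurableTypeR R) (x : X) : R :=
  h^-1 * \int[leb]_(r in `]t - h, t]) g r x.

(** The moving window becomes part of the integrand, which makes Tonelli's theorem applicable in the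
    three variables t, x, r. *)
Let K (h : R) g (p : (measurableTypeR R * X) * measurableTypeR R) : R :=
  if (p.1.1 - h < p.2) && (p.2 <= p.1.1) then g p.2 p.1.2 else 0.

Let mK h g : measurable_fun setT (uncurry g) -> measurable_fun setT (K h g).
Proof.
move=> mg; apply: measurable_fun_ifT => //; last first.
  apply: (@measurableT_comp _ _ _ _ _ _ (uncurry g) _ (fun p => (p.2, p.1.2))) => //.
  by apply/measurable_fun_pair => //; apply: measurableT_comp.
have m1 : measurable_fun setT (fun p : (measurableTypeR R * X) * measurableTypeR R => p.1.1).
  exact: measurableT_comp.
apply: measurable_and.
  apply: measurable_fun_ltr => //.
  exact: measurable_funB.
exact: measurable_fun_ler.
Qed.

Let avgE h g t x : avg h g t x = h^-1 * \int[leb]_r K h g ((t, x), r).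
Proof.
rewrite /avg [in LHS]Rintegral_mkcond; congr (_ * _); apply: eq_Rintegral => r _.
by rewrite patchE /K /= mem_setE in_itv/=.
Qed.

Lemma measurable_avg h g : measurable_fun setT (uncurry g) ->
  measurable_fun setT (uncurry (avg h g)).
Proof.
move=> mg; rewrite (_ : uncurry _ = (fun p => h^-1 * \int[leb]_r K h g (p, r))).
  by apply: measurable_funM => //; apply: measurable_fun_Rintegral; exact: mK.
by apply/funext => -[t x] /=; rewrite avgE.
Qed.

Lemma avg_sqr_le h g t x : 0 < h -> measurable_fun setT (uncurry g) ->
  ((avg h g t x ^+ 2)%:E <= h^-1%:E * \int[leb]_r (K h g ((t, x), r) ^+ 2)%:E)%E.
Proof.
move=> h0 mg; set I := (\int[leb]_r _)%E.
have mKr : measurable_fun setT (fun r => K h g ((t, x), r)).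
  exact: measurableT_comp (mK h mg) (pair1_measurable (t, x)).
have I0 : (0 <= I)%E by apply: integral_ge0 => r _; rewrite lee_fin sqr_ge0.
(* An infinite right-hand side leaves nothing to prove; a finite one makes the slice square
   integrable, and Cauchy-Schwarz against the indicator of the window applies. *)
have [Ioo|] := ltP I +oo%E; last first.
  by rewrite leye_eq => /eqP ->; rewrite gt0_muley ?lte_fin ?invr_gt0// leey.
have KL : L2 leb (fun r => K h g ((t, x), r)).
  split => //; apply/integrableP; split.
    by apply/measurable_EFinP; exact: measurable_funX.
  apply: le_lt_trans Ioo; rewrite le_eqVlt; apply/orP; left; apply/eqP.
  by apply: eq_integral => r _ /=; rewrite ger0_norm ?sqr_ge0.
have mi : measurable (`]t - h, t]%classic : set (measurableTypeR R)) by exact: measurable_itv.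
have leI : leb (`]t - h, t]%classic) = h%:E.
  by rewrite lebesgue_measure_itv/= lte_fin ltrBlDr ltrDl h0 -EFinB; congr EFin; ring.
have one_int : leb.-integrable setT (EFin \o (\1_(`]t - h, t]%classic) : measurableTypeR R -> R)).
  exact: integrable_indic_itv.
have OL : L2 leb (\1_(`]t - h, t]%classic) : measurableTypeR R -> R).
  split => //; rewrite (_ : (fun x => _) = \1_(`]t - h, t]%classic))//.
  by apply/funext => r; rewrite indicE; case: (_ \in _); rewrite ?expr0n ?expr1n.
have oneE : ip leb (\1_(`]t - h, t]%classic) : measurableTypeR R -> R) (\1_(`]t - h, t]%classic)) = h.
  rewrite /ip (_ : (fun x => _) = (\1_(`]t - h, t]%classic) : measurableTypeR R -> R)).
    by rewrite /Rintegral integral_indic// setIT; exact: (congr1 fine leI).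
  by apply/funext => r; rewrite indicE; case: (_ \in _); rewrite ?mulr0 ?mulr1.
have := ip_cauchy_schwarz OL KL; rewrite oneE => CS.
have -> : avg h g t x = h^-1 * ip leb (\1_(`]t - h, t]%classic) : measurableTypeR R -> R) (fun r => K h g ((t, x), r)).
  rewrite avgE; congr (_ * _); apply: eq_Rintegral => r _.
  rewrite indicE /K/= mem_setE in_itv/=; case: ifPn => _; by rewrite ?mul1r ?mul0r.
have -> : I = (ip leb (fun r => K h g ((t, x), r)) (fun r => K h g ((t, x), r)))%:E.
  by rewrite /ip /Rintegral fineK// ge0_fin_numE.
rewrite -EFinM lee_fin exprMn.
rewrite (_ : h^-1 * _ = h^-1 ^+ 2 * (h * ip leb (fun r => K h g ((t, x), r)) (fun r => K h g ((t, x), r)))).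
  by rewrite ler_wpM2l// sqr_ge0.
by field; rewrite gt_eqF.
Qed.

(** The square of an average is at most the average of the squares. After exchanging the integrals,
    each r lies in the windows of exactly the t in [r, r + h[, a set of length h, which cancels the
    factor 1/h. *)
Lemma avg_L2 h g : 0 < h -> L2 (leb \x mu)%E (uncurry g) ->
  L2 (leb \x mu)%E (uncurry (avg h g)) /\
  ip (leb \x mu)%E (uncurry (avg h g)) (uncurry (avg h g)) <=
  ip (leb \x mu)%E (uncurry g) (uncurry g).
Proof.
move=> h0 /[dup] gL [mg ig].
have ma := measurable_avg h mg.
pose G := (\int[(leb \x mu)]_p (uncurry g p ^+ 2)%:E)%E.
have mK2 : measurable_fun setT (fun q => (K h g q ^+ 2)%:E).
  by apply/measurable_EFinP; apply: measurable_funX; exact: mK.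
have H : (\int[(leb \x mu)]_p (uncurry (avg h g) p ^+ 2)%:E <= G)%E.
  apply: (@le_trans _ _ (\int[(leb \x mu)]_p (h^-1%:E * fubini_F leb (fun q => (K h g q ^+ 2)%:E) p))%E).
    apply: ge0_le_integral_ae => [p|p|].
    - by rewrite lee_fin sqr_ge0.
    - rewrite mule_ge0 ?lee_fin ?invr_ge0 ?(ltW h0)//; apply: integral_ge0 => r _.
      by rewrite lee_fin sqr_ge0.
    by apply: aeW => -[t x]; exact: avg_sqr_le.
  have mF : measurable_fun setT (fubini_F leb (fun q => (K h g q ^+ 2)%:E)).
    by apply: measurable_fun_fubini_tonelli_F => // q; rewrite lee_fin sqr_ge0.
  have F0 p : (0 <= fubini_F leb (fun q => (K h g q ^+ 2)%:E) p)%E.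
    by apply: integral_ge0 => r _; rewrite lee_fin sqr_ge0.
  rewrite ge0_integralZl//; last by rewrite lee_fin invr_ge0 ltW.
  rewrite fubini_tonelli1//.
  pose k2 (p : measurableTypeR R * measurableTypeR R) : \bar R :=
    if (p.1 - h < p.2) && (p.2 <= p.1) then 1%E else 0%E.
  have mk2 : measurable_fun setT k2.
    apply: measurable_fun_ifT => //; apply: measurable_and.
      by apply: measurable_fun_ltr => //; exact: measurable_funB.
    exact: measurable_fun_ler.
  have k20 p : (0 <= k2 p)%E by rewrite /k2; case: ifPn.
  pose Gr (r : measurableTypeR R) := (\int[mu]_x (g r x ^+ 2)%:E)%E.
  have Gr0 r : (0 <= Gr r)%E by apply: integral_ge0 => x _; rewrite lee_fin sqr_ge0.
  have mg2 : measurable_fun setT (fun p => (uncurry g p ^+ 2)%:E).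
    by apply/measurable_EFinP; exact: measurable_funX.
  have mGr : measurable_fun setT Gr.
    by apply: (measurable_fun_fubini_tonelli_F (fun p => (uncurry g p ^+ 2)%:E)) => // p; rewrite lee_fin sqr_ge0.
  have E1 t : fubini_F mu (fubini_F leb (fun q => (K h g q ^+ 2)%:E)) t =
      (\int[leb]_r (k2 (t, r) * Gr r))%E.
    pose f3 (p : X * measurableTypeR R) := (K h g ((t, p.1), p.2) ^+ 2)%:E.
    have mf3 : measurable_fun setT f3.
      apply: (measurableT_comp mK2 (_ : measurable_fun setT (fun p : X * measurableTypeR R => ((t, p.1), p.2)))).
      by apply/measurable_fun_pair => //; apply/measurable_fun_pair.
    transitivity (\int[mu]_x \int[leb]_r f3 (x, r))%E; first by [].
    rewrite (fubini_tonelli f3 mf3) => [|p]; last by rewrite lee_fin sqr_ge0.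
    apply: eq_integral => r _; rewrite /Gr -ge0_integralZl//.
    - apply: eq_integral => x _; rewrite /f3 /K /k2/=.
      by case: ifPn => _; rewrite ?mul1e// mul0e expr0n.
    - exact: measurableT_comp mg2 (pair1_measurable r).
    - by move=> x _; rewrite lee_fin sqr_ge0.
  rewrite (eq_integral _ _ (fun t _ => E1 t)).
  rewrite (fubini_tonelli (fun p => k2 p * Gr p.2)%E); last 2 first.
  - by apply: emeasurable_funM => //; apply: measurableT_comp.
  - by move=> p; rewrite mule_ge0.
  have E2 r : (\int[leb]_t (k2 (t, r) * Gr r) = h%:E * Gr r)%E.
    rewrite ge0_integralZr//; last exact: measurableT_comp mk2 (pair2_measurable r).
    congr (_ * _)%E; rewrite (_ : h%:E = leb (`[r, r + h[%classic)); last first.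
      by rewrite lebesgue_measure_itv/= lte_fin ltrDl h0 -EFinB; congr EFin; ring.
    transitivity (\int[leb]_t (\1_(`[r, r + h[%classic) t)%:E)%E; last first.
      by rewrite integral_indic ?setIT//; exact: measurable_itv.
    apply: eq_integral => t _; rewrite /k2/= indicE mem_setE in_itv/= ltrBlDr andbC.
    by case: ifPn.
  under eq_integral do rewrite E2.
  rewrite ge0_integralZl//; last by rewrite lee_fin ltW.
  rewrite muleA -EFinM mulVf ?gt_eqF// mul1e /G fubini_tonelli1// => p.
  by rewrite lee_fin sqr_ge0.
have Goo : (G < +oo)%E.
  move/integrableP : ig => [_]; apply: le_lt_trans; rewrite le_eqVlt; apply/orP; left; apply/eqP.
  by apply: eq_integral => p _ /=; rewrite ger0_norm ?sqr_ge0.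
have aL : L2 (leb \x mu)%E (uncurry (avg h g)).
  split => //; apply/integrableP; split.
    by apply/measurable_EFinP; exact: measurable_funX.
  apply: le_lt_trans (le_lt_trans H Goo); rewrite le_eqVlt; apply/orP; left; apply/eqP.
  by apply: eq_integral => p _ /=; rewrite ger0_norm ?sqr_ge0.
split => //; rewrite /ip /Rintegral fine_le//.
- by apply: integrable_fin_num => //; exact: L2_mul_integrable.
- by apply: integrable_fin_num => //; exact: L2_mul_integrable.
Qed.
End averages.

Section averages_limit.
Set Implicit Arguments.
Unset Strict Implicit.
Context {R : realType} {d : measure_display} {X : measurableType d}.
Variable mu : {sigma_finite_measure set X -> \bar R}.
Notation leb := (@lebesgue_measure R).
Implicit Types g : measurableTypeR R -> X -> R.

Lemma limn_einf_gt_near (u : (\bar R)^nat) (c : \bar R) : (c < limn_einf u)%E ->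
  \forall n \near \oo, (c < u n)%E.
Proof.
rewrite limn_einf_lim (_ : limn (einfs u) = ereal_sup (range (einfs u))); last first.
  by apply/cvg_lim => //; exact: cvg_einfs_sup.
move=> /ereal_sup_gt[_ [n _ <-] cn].
exists n => // m /= nm; apply: (lt_le_trans cn).
by apply: ereal_inf_lbound; exists m.
Qed.

(** Lebesgue's differentiation theorem in t is available for almost every fixed x; Tonelli with x as
    the outer variable turns this into an equality of integrals over the product. *)
Lemma ge0_prod_integral_ae (f g : measurableTypeR R * X -> \bar R) :
  measurable_fun setT f -> measurable_fun setT g ->
  (forall p, 0 <= f p)%E -> (forall p, 0 <= g p)%E ->
  {ae mu, forall x, {ae leb, forall t, f (t, x) = g (t, x)}} ->
  (\int[(leb \x mu)]_p f p = \int[(leb \x mu)]_p g p)%E.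
Proof.
move=> mf mg f0 g0 fg; rewrite !fubini_tonelli2//; apply: eq_integral_ae.
by apply: filterS fg => x fgx; apply: eq_integral_ae.
Qed.

Lemma avg_cvg (f : R -> R) (h : nat -> R) : leb.-integrable setT (EFin \o f) ->
  (forall n, 0 < h n) -> h n @[n --> \oo] --> 0 ->
  {ae leb, forall t, (h n)^-1 * \int[leb]_(r in `]t - h n, t]) f r @[n --> \oo] --> f t}.
Proof.
move=> fi h0 hc; pose F x := \int[leb]_(r in `]-oo, x]) f r.
have fiS (y : R) : leb.-integrable `]-oo, y] (EFin \o f).
  by apply: integrableS fi => //; exact: measurable_itv.
have := FTC1Ny fiS (open_integrable_locally openT fi).
apply: (@filterS _ _ (ae_filter_ringOfSetsType leb)) => t [dF Ft]; rewrite -/F in dF Ft.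
have dFt : is_derive t 1 (F : R^o -> R^o) (f t) by apply: DeriveDef; rewrite -?derive1E.
rewrite (_ : (fun n => _) = (fun n => (h n)^-1 * (F t - F (t - h n)))).
  exact: cvg_diff_quotient.
apply/funext => n; apply/esym.
congr (_ * _); apply: (@Rintegral_itvB R f -oo%O (BRight t) (t - h n)) => //.
by rewrite bnd_simp; rewrite gerBl ltW.
Qed.

(** Fatou's lemma for (A + g)^2, where A is the average of g, bounds the lower limit of |A|^2 + 2
    (A, g) + |g|^2 from below by 4 |g|^2. Since |A| <= |g|, the lower limit of (A, g) is at least
    |g|^2. Strong convergence of the averages is thereby bypassed. *)
Lemma near_ip_avg (T e : R) g (h : nat -> R) : (forall n, 0 < h n) -> h n @[n --> \oo] --> 0 ->
  L2 (leb \x mu)%E (uncurry g) -> (forall t x, ~ time T t -> g t x = 0) -> 0 < e ->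
  \forall n \near \oo, ip (leb \x mu)%E (uncurry g) (uncurry g) - e <=
    ip (leb \x mu)%E (uncurry (avg (h n) g)) (uncurry g).
Proof.
move=> h0 hc /[dup] gL [mg ig] gT e0.
set G := ip _ _ _.
pose Phi n p := ((uncurry (avg (h n) g) p + uncurry g p) ^+ 2)%:E.
have mPhi n : measurable_fun setT (Phi n).
  apply/measurable_EFinP; apply: measurable_funX; apply: measurable_funD => //.
  exact: measurable_avg.
have Phi0 n p : (0 <= Phi n p)%E by rewrite lee_fin sqr_ge0.
have aL n := (@avg_L2 _ _ _ mu (h n) g (h0 n) gL).1.
have PhiE n : (\int[(leb \x mu)]_p Phi n p = (ip (leb \x mu)%E (fun p => uncurry (avg (h n) g) p + uncurry g p)
    (fun p => uncurry (avg (h n) g) p + uncurry g p))%:E)%E.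
  have sL : L2 (leb \x mu)%E (fun p => uncurry (avg (h n) g) p + uncurry g p) by exact: L2D.
  have fin := integrable_fin_num measurableT (L2_mul_integrable sL sL).
  rewrite /ip /Rintegral fineK//.
(* Almost every slice is square integrable and vanishes off ]0, T[; multiplication by the indicator
   of that interval makes it integrable. *)
have gx : {ae mu, forall x, leb.-integrable setT (EFin \o (g^~ x))}.
  have := ae_integrable2 ig; apply: filterS => x gx2.
  have gxL : L2 leb (g^~ x).
    by split => //; exact: measurableT_comp mg (pair2_measurable x).
  have oneL : L2 leb (\1_(time T) : measurableTypeR R -> R).
    split; first by apply: measurable_indic; exact: measurable_time.
    rewrite (_ : EFin \o _ = EFin \o \1_(time T)); first exact: integrable_indic_itv.
    by apply/funext => r /=; rewrite indicE; case: (_ \in _); rewrite ?expr0n ?expr1n.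
  have := L2_mul_integrable gxL oneL; congr integrable; apply/funext => t /=.
  rewrite indicE; case: (boolP (t \in _)) => [_|]; first by rewrite mulr1.
  by rewrite notin_setE => /gT ->; rewrite mul0r.
have lim : (\int[(leb \x mu)]_p limn_einf (Phi ^~ p) = (4 * G)%:E)%E.
  rewrite (_ : (4 * G)%:E = \int[(leb \x mu)]_p (4 * (uncurry g p * uncurry g p))%:E)%E; last first.
    rewrite -[RHS]fineK; last first.
      by apply: integrable_fin_num => //; apply: integrable_EFinZ => //; exact: L2_mul_integrable.
    by rewrite -[fine _]/(Rintegral _ _ _) RintegralZl//; exact: L2_mul_integrable.
  apply: ge0_prod_integral_ae.
  - rewrite (_ : (fun p => _) = (fun p => - limn_esup (fun n => - Phi n p))%E)//.
    by apply: measurableT_comp => //; apply: measurable_fun_limn_esup => n; exact: measurableT_comp.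
  - apply/measurable_EFinP; apply: measurable_funM => //; exact: measurable_funM.
  - move=> p; rewrite limn_einf_lim; apply: lime_ge; first exact: is_cvg_einfs.
    by apply: nearW => n; apply: le_ereal_inf_tmp => _ [m _ <-].
  - by move=> p; rewrite lee_fin mulr_ge0// -expr2 sqr_ge0.
  apply: filterS gx => x /avg_cvg/(_ h0 hc); apply: (@filterS _ _ (ae_filter_ringOfSetsType leb)) => t ct.
  have : Phi n (t, x) @[n --> \oo] --> (4 * (g t x * g t x))%:E.
    apply: cvg_EFin; first exact: nearW.
    rewrite (_ : 4 * _ = (g t x + g t x) ^+ 2); last by ring.
    rewrite (_ : fine \o _ = (fun n => (avg (h n) g t x + g t x) * (avg (h n) g t x + g t x))); last first.
      by apply/funext => n; rewrite /= expr2.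
    by rewrite expr2; apply: cvgM; apply: cvgD; rewrite //; exact: cvg_cst.
  by move/cvg_limn_einf_sup => [-> _].
have := @fatou _ _ _ (leb \x mu)%E setT measurableT Phi mPhi (fun n p _ => Phi0 n p).
rewrite lim => H.
have {}H : ((4 * G - 2 * e)%:E < limn_einf (fun n => \int[(leb \x mu)]_p Phi n p))%E.
  by apply: lt_le_trans H; rewrite lte_fin; lra.
have := limn_einf_gt_near H; apply: filterS => n; rewrite PhiE lte_fin ip_sqrD//.
have := (@avg_L2 _ _ _ mu (h n) g (h0 n) gL).2; rewrite -/G; lra.
Qed.

End averages_limit.

Section average_pairing.
Set Implicit Arguments.
Unset Strict Implicit.
Context {R : realType} {d : measure_display} {X : measurableType d}.
Variable mu : {sigma_finite_measure set X -> \bar R}.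
Notation leb := (@lebesgue_measure R).
Implicit Types g : measurableTypeR R -> X -> R.

Lemma L2_indic_itv (a b : R) : L2 leb (\1_(`]a, b]%classic) : measurableTypeR R -> R).
Proof.
apply: L2_indic; first exact: measurable_itv.
by rewrite /= lebesgue_measure_itv/=; case: ifPn; rewrite ?ltry// -EFinB ltry.
Qed.

(** Fubini's theorem for the product of g with the tensor of the indicator of the window and v. *)
Lemma integral_ip_avg (h : R) g (t : R) (v : X -> R) : 0 < h ->
  L2 (leb \x mu)%E (uncurry g) -> L2 mu v -> L2 mu (avg h g t) ->
  leb.-integrable `]t - h, t] (EFin \o (fun r => ip mu (g r) v)) /\
  \int[leb]_(r in `]t - h, t]) ip mu (g r) v = h * ip mu (avg h g t) v.
Proof.
move=> h0 gL vL aL; set I := `]t - h, t]%classic.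
have mI : measurable (I : set (measurableTypeR R)) by exact: measurable_itv.
have QL : L2 (leb \x mu)%E (uncurry (fun r x => \1_I r * v x)).
  rewrite (_ : uncurry _ = (fun p => \1_I p.1 * v p.2)); last by apply/funext => -[].
  exact: L2_tensor (L2_indic_itv (t - h) t) vL.
have [i1 e1] := prod_ip gL QL.
have E r : ip mu (g r) (fun x => \1_I r * v x) = ((fun r => ip mu (g r) v) \_ I) r.
  rewrite patchE indicE; case: (boolP (r \in I)) => _.
    by apply: eq_Rintegral => x _; rewrite mul1r.
  rewrite /ip; under eq_Rintegral do rewrite mul0r mulr0.
  by rewrite /Rintegral integral0.
split.
  apply/(@integrable_patch R _ (measurableTypeR R) leb _ _ mI).
  by move: i1; congr integrable; apply/funext => r /=; rewrite E.
rewrite Rintegral_mkcond; under eq_Rintegral do rewrite -E.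
rewrite [LHS]e1 [LHS]/ip.
have i2 : (leb \x mu)%E.-integrable setT (EFin \o uncurry (fun r x => g r x * (\1_I r * v x))).
  by have := L2_mul_integrable gL QL; congr integrable; apply/funext => -[].
have := prod_Rintegral2 i2.
rewrite (_ : uncurry _ = (fun p => uncurry g p * uncurry (fun r x => \1_I r * v x) p)); last by apply/funext => -[].
move=> <-; rewrite /ip -RintegralZl//; last exact: L2_mul_integrable.
apply: eq_Rintegral_ae; apply: filterS (prod_L2_ae2 gL) => x gx.
have gi := L2_mul_integrable gx (L2_indic_itv (t - h) t).
rewrite /avg mulrA mulrA mulfV ?gt_eqF// mul1r mulrC.
rewrite [in RHS]Rintegral_mkcond -RintegralZl//.
  by apply: eq_Rintegral => r _; rewrite patchE indicE; case: (r \in _); [rewrite mul1r mulrC|rewrite mul0r !mulr0].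
rewrite (_ : _ \_ _ = (fun r => g r x * \1_I r))//.
by apply/funext => r; rewrite patchE indicE; case: (_ \in _); rewrite ?mulr1 ?mulr0.
Qed.

End average_pairing.

Lemma le_Rintegral_ae {R : realType} {d : measure_display} {X : measurableType d}
    (mu : {measure set X -> \bar R}) (f g : X -> R) :
  mu.-integrable setT (EFin \o f) -> mu.-integrable setT (EFin \o g) ->
  {ae mu, forall x, f x <= g x} -> \int[mu]_x f x <= \int[mu]_x g x.
Proof.
move=> fi gi fg; rewrite -subr_ge0 -RintegralB//.
rewrite (eq_Rintegral_ae (g := fun x => `|g x - f x|)); first exact: Rintegral_ge0.
by apply: filterS fg => x fgx; rewrite ger0_norm// subr_ge0.
Qed.

Lemma dist_clamp {R : realType} (T s t : R) :
  `|Num.max 0 (Num.min s T) - Num.max 0 (Num.min t T)| <= `|s - t|.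
Proof.
have b (u v : R) : `|Num.max 0 u - Num.max 0 v| <= `|u - v|.
  rewrite ler_norml; have := ler_norm (u - v); have := ler_norm (v - u).
  rewrite [`|v - u|]distrC; move: `|u - v| => N.
  by case: (leP 0 u) => u0; case: (leP 0 v) => v0 h1 h2; apply/andP; split; lra.
apply: le_trans (b _ _) _.
rewrite ler_norml; have := ler_norm (s - t); have := ler_norm (t - s).
rewrite [`|t - s|]distrC; move: `|s - t| => N.
by case: (leP s T) => s0; case: (leP t T) => t0 h1 h2; apply/andP; split; lra.
Qed.

Lemma continuous_diff_shift {R : realType} (phi : R -> R) (h : R) :
  continuous (phi : R^o -> R^o) ->
  continuous ((fun t => phi t - phi (t - h)) : R^o -> R^o).
Proof.
move=> cphi.
have csh : continuous ((fun t => phi (t - h)) : R^o -> R^o).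
  move=> x; apply: continuous_comp; last exact: cphi.
  by apply: cvgB; [exact: cvg_id|exact: cvg_cst].
by move=> x; apply: cvgB; [exact: cphi|exact: csh].
Qed.

(** * The energy inequality for an abstract evolution equation *)

Section energy_inequality.
Set Implicit Arguments.
Unset Strict Implicit.
Context {R : realType} {d : measure_display} {X : measurableType d}.
Variable mu : {sigma_finite_measure set X -> \bar R}.
Notation leb := (@lebesgue_measure R).
Variables (T D : R) (n : nat) (z : R -> X -> R).
Variables (y F : measurableTypeR R -> X -> R) (g : 'I_n -> measurableTypeR R -> X -> R).
Hypotheses (T0 : 0 < T) (D0 : 0 <= D).
Hypothesis zL : forall t, 0 <= t <= T -> L2 mu (z t).
Hypothesis zc : forall t e, 0 <= t <= T -> 0 < e -> exists2 r, 0 < r &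
  forall s, 0 <= s <= T -> `|s - t| < r -> `|ip mu (z s) (z s) - ip mu (z t) (z t)| <= e.
Hypotheses (yL : L2 (leb \x mu)%E (uncurry y)) (FL : L2 (leb \x mu)%E (uncurry F))
  (gL : forall i, L2 (leb \x mu)%E (uncurry (g i))).
Hypotheses (y0 : forall t x, ~ time T t -> y t x = 0)
  (F0 : forall t x, ~ time T t -> F t x = 0)
  (g0 : forall i t x, ~ time T t -> g i t x = 0).
Hypothesis zy : {ae leb, forall t, time T t -> {ae mu, forall x, z t x = y t x}}.
Hypothesis zE : {ae leb, forall t, time T t -> forall s, 0 <= s <= t ->
  ip mu (fun x => z t x - z s x) (y t) =
  \int[leb]_(r in `]s, t]) (- D * (\sum_i ip mu (g i r) (g i t)) + ip mu (F r) (y t))}.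

Let AF := ae_filter_ringOfSetsType leb.
(** The squared norm of z is continued by its end values. For t < h the difference over the window
    is then taken from time 0, as it should be. *)
Let clamp (t : R) : R := Num.max 0 (Num.min t T).
Let phi (t : R) : R := ip mu (z (clamp t)) (z (clamp t)).

Let clampT t : 0 <= clamp t <= T.
Proof. by rewrite /clamp le_max lexx/= ge_max ge_min lexx orbT (ltW T0). Qed.

Let clampid t : 0 <= t <= T -> clamp t = t.
Proof. by move=> /andP[t0 tT]; rewrite /clamp min_l// max_r. Qed.

Let cphi : continuous (phi : R^o -> R^o).
Proof.
move=> t; apply/cvgrPdist_le => e e0.
have [r r0 H] := zc (clampT t) e0.
near=> s; rewrite distrC; apply: H; first exact: clampT.
apply: le_lt_trans (dist_clamp _ _ _) _; rewrite distrC.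
by near: s; apply: cvgr_dist_lt => //; exact: cvg_id.
Unshelve. all: by end_near. Qed.

Let ip0l v : ip mu (fun=> 0) v = 0.
Proof.
by rewrite /ip; under eq_Rintegral do rewrite mul0r; rewrite /Rintegral integral0.
Qed.

Let pairing (h : R) (t : R) : R :=
  - D * (\sum_i ip mu (avg h (g i) t) (g i t)) + ip mu (avg h F t) (y t).

(** From |z t - z s|^2 >= 0 follows |z t|^2 - |z s|^2 <= 2 (z t - z s, z t). As z t equals y t for
    almost every t, the integrated equation rewrites the right side, and Fubini turns the integral
    over the window into averages. If t < h, then s = 0 and the missing part of the window
    contributes nothing, because the data vanish off ]0, T[. *)
Let pointwise (h : R) : 0 < h ->
  {ae leb, forall t, time T t -> phi t - phi (t - h) <= 2 * (h * pairing h t)}.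
Proof.
move=> h0.
have aL (k : measurableTypeR R -> X -> R) : L2 (leb \x mu)%E (uncurry k) ->
    {ae leb, forall t, L2 mu (k t) /\ L2 mu (avg h k t)}.
  move=> kL; have k1 := prod_L2_ae kL.
  have k2 := prod_L2_ae (@avg_L2 _ _ _ mu h k h0 kL).1.
  by move: k1 k2; apply: (@filterS2 _ _ AF) => t.
have gA : {ae leb, forall t, forall i, L2 mu (g i t) /\ L2 mu (avg h (g i) t)}.
  by apply: (@filter_forall _ _ _ _ AF) => i; exact: aL.
have H := @filterI _ _ AF _ _ (@filterI _ _ AF _ _ zy zE)
  (@filterI _ _ AF _ _ gA (@filterI _ _ AF _ _ (aL _ FL) (aL _ yL))).
apply: (@filterS _ _ AF) H => t [[zyt zEt] [gt [[Ft AFt] [yt _]]]] tT.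
have {}zyt := zyt tT; have {}zEt := zEt tT.
have /andP[t0 tT'] : 0 < t < T by move: tT; rewrite /time/= in_itv.
have tin : 0 <= t <= T by rewrite !ltW.
pose s := Num.max 0 (t - h).
have st : 0 <= s <= t by rewrite /s le_max lexx/= ge_max (ltW t0) gerBl (ltW h0).
have sin : 0 <= s <= T by have /andP[-> /= /le_trans->//] := st; exact: ltW.
have cs : clamp (t - h) = s by rewrite /clamp /s (min_l (_ : t - h <= T))//; lra.
have phiE : phi t - phi (t - h) <= 2 * ip mu (fun x => z t x - z s x) (z t).
  rewrite /phi clampid// cs ipBl//; [|exact: zL..].
  have := ip_ge0 mu (fun x => z t x - z s x); rewrite ip_sqrB; [|exact: zL..].
  rewrite (ipC _ (z t) (z s)); lra.
rewrite (le_trans phiE)// ler_wpM2l// (@eq_ip_ae _ _ _ mu _ (fun x => z t x - z s x) _ (y t))//; last exact: aeW.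
rewrite zEt//.
pose Q r := - D * (\sum_i ip mu (g i r) (g i t)) + ip mu (F r) (y t).
have Q0 r : ~ time T r -> Q r = 0.
  move=> rT; rewrite /Q (_ : F r = fun=> 0); last by apply/funext => x; exact: F0.
  rewrite ip0l big1 ?mulr0 ?addr0// => i _.
  by rewrite (_ : g i r = fun=> 0) ?ip0l//; apply/funext => x; exact: g0.
have -> : \int[leb]_(r in `]s, t]) Q r = \int[leb]_(r in `]t - h, t]) Q r.
  rewrite Rintegral_mkcond [RHS]Rintegral_mkcond; apply: eq_Rintegral => r _.
  rewrite !patchE !mem_setE !in_itv/= /s gt_max.
  have [r0|r0] /= := ltP 0 r; first by [].
  case: ifPn => // _; rewrite Q0// /time/= in_itv/= => /andP[r1 _].
  by move: r1; rewrite ltNge r0.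
have mI : measurable (`]t - h, t]%classic : set (measurableTypeR R)) by exact: measurable_itv.
have gI i := integral_ip_avg h0 (gL i) (gt i).1 (gt i).2.
have [FI FE] := integral_ip_avg h0 FL yt AFt.
have sI : leb.-integrable `]t - h, t] (EFin \o (fun r => \sum_i ip mu (g i r) (g i t))).
  by apply: (@integrable_EFin_sum R _ (measurableTypeR R)) => // i; have [] := gI i.
rewrite RintegralD//; last exact: (@integrable_EFinZ R _ (measurableTypeR R)).
rewrite RintegralZl// (@Rintegral_sum R _ (measurableTypeR R))//; last by move=> i; have [] := gI i.
rewrite FE /pairing le_eqVlt; apply/orP; left; apply/eqP.
rewrite mulrDr; congr (_ + _); rewrite mulrCA; congr (_ * _); rewrite mulr_sumr.
by apply: eq_bigr => i _; have [] := gI i.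
Qed.

Let pairing_int (h : R) : 0 < h ->
  leb.-integrable setT (EFin \o (pairing h)) /\
  \int[leb]_t pairing h t =
    - D * (\sum_i ip (leb \x mu)%E (uncurry (avg h (g i))) (uncurry (g i))) +
      ip (leb \x mu)%E (uncurry (avg h F)) (uncurry y).
Proof.
move=> h0; have aL k (kL : L2 (leb \x mu)%E (uncurry k)) := (@avg_L2 _ _ _ mu h k h0 kL).1.
have gI i := prod_ip (aL _ (gL i)) (gL i).
have [FI FE] := prod_ip (aL _ FL) yL.
have sI : leb.-integrable setT (EFin \o (fun t => \sum_i ip mu (avg h (g i) t) (g i t))).
  by apply: (@integrable_EFin_sum R _ (measurableTypeR R)) => // i; have [] := gI i.
have sZ := @integrable_EFinZ R _ (measurableTypeR R) leb setT (- D) _ measurableT sI.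
split; first exact: (@integrable_EFinD R _ (measurableTypeR R)).
rewrite RintegralD// RintegralZl// (@Rintegral_sum R _ (measurableTypeR R))//; last by move=> i; have [] := gI i.
by rewrite FE; congr (_ * _ + _); apply: eq_bigr => i _; have [] := gI i.
Qed.

Theorem energy_inequality :
  ip mu (z T) (z T) + 2 * D * (\sum_i ip (leb \x mu)%E (uncurry (g i)) (uncurry (g i))) <=
  ip mu (z 0) (z 0) + ip (leb \x mu)%E (uncurry F) (uncurry F) +
    ip (leb \x mu)%E (uncurry y) (uncurry y).
Proof.
pose h (m : nat) : R := m.+1%:R^-1.
have h01 m : 0 < h m <= 1 by rewrite invr_gt0 ltr0n/= invf_le1 ?ltr0n// ler1n.
have h0 m : 0 < h m by have /andP[] := h01 m.
have hc : h m @[m --> \oo] --> 0 by exact: cvg_harmonic.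
have phiT : phi T = ip mu (z T) (z T) by rewrite /phi clampid// lexx ltW.
have phi00 : phi 0 = ip mu (z 0) (z 0) by rewrite /phi clampid// lexx ltW.
pose c := 1 + 2 * D * n%:R.
have c0 : 0 < c.
  have : 0 <= 2 * D * n%:R by rewrite !mulr_ge0.
  by rewrite /c; lra.
apply/ler_addgt0Pr => e e0; pose e1 := e / c.
have e10 : 0 < e1 by rewrite divr_gt0.
have lim := cvg_integral_shift_quotient T0 cphi h01 hc.
have [m [L1 L2']] : exists m, phi T - phi 0 - e1 <=
    (h m)^-1 * \int[leb]_(t in `[0, T]) (phi t - phi (t - h m)) /\
    forall i, ip (leb \x mu)%E (uncurry (g i)) (uncurry (g i)) - e1 <=
      ip (leb \x mu)%E (uncurry (avg (h m) (g i))) (uncurry (g i)).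
  have n1 : \forall m \near \oo, phi T - phi 0 - e1 <=
    (h m)^-1 * \int[leb]_(t in `[0, T]) (phi t - phi (t - h m)).
    by apply: (cvgr_ge _ lim); lra.
  have n2 : \forall m \near \oo, forall i, ip (leb \x mu)%E (uncurry (g i)) (uncurry (g i)) - e1 <=
      ip (leb \x mu)%E (uncurry (avg (h m) (g i))) (uncurry (g i)).
    apply: filter_forall => i; exact: (near_ip_avg h0 hc (gL i) (@g0 i) e10).
  by have [m [Hm1 Hm2]] := @filter_ex _ _ _ _ (filterI n1 n2); exists m.
have B : (h m)^-1 * \int[leb]_(t in `[0, T]) (phi t - phi (t - h m)) <= 2 * \int[leb]_t pairing (h m) t.
  rewrite ler_pdivrMl//.
  have csh : continuous ((fun t => phi t - phi (t - h m)) : R^o -> R^o).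
    exact: (@continuous_diff_shift R phi (h m) cphi).
  have -> : \int[leb]_(t in `[0, T]) (phi t - phi (t - h m)) =
      \int[leb]_(t in time T) (phi t - phi (t - h m)).
    congr fine; rewrite (@integral_itv_bndoo R 0 T (EFin \o (fun t => phi t - phi (t - h m))) true false)//.
    by apply/measurable_EFinP; apply: measurable_funTS; exact: continuous_measurable_fun.
  have [pI _] := pairing_int (h0 m).
  rewrite mulrCA -RintegralZl// -RintegralZl//; last exact: (@integrable_EFinZ R _ (measurableTypeR R)).
  have mt := measurable_time T.
  rewrite Rintegral_mkcond; apply: (@le_Rintegral_ae R _ (measurableTypeR R)).
  - apply/(@integrable_patch R _ (measurableTypeR R) leb _ _ mt).
    apply: integrableS (_ : leb.-integrable `[0, T] _) => //; first exact: subset_itv_oo_cc.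
    apply: continuous_compact_integrable; first exact: segment_compact.
    by apply: continuous_subspaceT.
  - by do 2 apply: (@integrable_EFinZ R _ (measurableTypeR R)) => //.
  - apply: (@filterS _ _ AF) (pointwise (h0 m)) => t tH; rewrite patchE.
    case: ifPn => [/set_mem /tH|]; first by rewrite mulrCA.
    rewrite notin_setE => ntT; rewrite /pairing (_ : y t = fun=> 0); last by apply/funext => x; exact: y0.
    rewrite ipC ip0l big1 ?mulr0 ?addr0 ?mulr0// => i _.
    by rewrite (_ : g i t = fun=> 0) ?[ip _ _ (fun=> 0)]ipC ?ip0l//; apply/funext => x; exact: g0.
have [_ pE] := pairing_int (h0 m); rewrite pE in B.
have [aFL aFle] := @avg_L2 _ _ _ mu (h m) F (h0 m) FL.
(* The source term needs no limit: Young's inequality is followed by the contraction property of the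
   average. *)
have Y := ip_young aFL yL.
have S : \sum_i (ip (leb \x mu)%E (uncurry (g i)) (uncurry (g i)) - e1) <=
    \sum_i ip (leb \x mu)%E (uncurry (avg (h m) (g i))) (uncurry (g i)).
  by apply: ler_sum.
rewrite sumrB sumr_const card_ord -[e1 *+ n]mulr_natr in S.
have ce : e = c * e1 by rewrite /e1; field; rewrite gt_eqF.
rewrite ce /c -phiT -phi00.
have DS := mulr_ge0 D0 (_ : 0 <= \sum_i ip (leb \x mu)%E (uncurry (avg (h m) (g i))) (uncurry (g i)) -
  (\sum_i ip (leb \x mu)%E (uncurry (g i)) (uncurry (g i)) - e1 * n%:R)).
have {}DS := DS ltac:(by rewrite subr_ge0).
move: DS B Y L1 aFle; clear; move: (\sum_i _) (\sum_i _) => Sa Sg.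
move: (ip _ _ _) (ip _ _ _) (ip _ _ _) (ip _ _ _) (phi T) (phi 0) ((h m)^-1 * _) (n%:R) => *.
lra.
Qed.

End energy_inequality.

(** * The space H^1 and its dual *)

Section H1_facts.
Set Implicit Arguments.
Unset Strict Implicit.
Context {R : realType} {d : nat}.
Notation mu := (@lebesgue_rV R d).
Variable Omega : set 'rV[R]_d.
Hypothesis mO : measurable Omega.
Hypothesis Ofin : (mu Omega < +oo)%E.

Lemma continuous_measurable_rV (f : 'rV[R]_d -> R) : continuous f -> measurable_fun setT f.
Proof.
move=> cf; apply: (measurability _ (RGenOInfty.measurableE R)).
move=> /= _ [_ [a ->]] <-; rewrite setTI; apply: open_measurable_rV.
by apply: open_comp => [x _|]; [exact: cf|exact: interval_open].
Qed.

Lemma bounded_L2 (f : 'rV[R]_d -> R) (M : R) : measurable_fun setT f ->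
  (forall x, `|f x| <= M) -> L2 mu (f \_ Omega).
Proof.
move=> mf fM.
have mfO : measurable_fun setT (f \_ Omega).
  by apply/(measurable_restrictT _ mO); exact: measurable_funTS.
split => //.
have [_ /(integrable_EFinZ (M ^+ 2) measurableT)] := @L2_indic R _ _ mu Omega mO Ofin.
apply: le_integrable => //; first by apply/measurable_EFinP; exact: measurable_funX.
move=> x _ /=; rewrite lee_fin patchE indicE; case: ifPn => _; last by rewrite expr0n /= normr0.
rewrite expr1n mulr1 !ger0_norm ?sqr_ge0//.
by rewrite -(real_normK (num_real (f x))) ler_sqr ?nnegrE// (le_trans _ (fM x)).
Qed.

Lemma continuous_support_L2 (f : 'rV[R]_d -> R) (A : set 'rV[R]_d) : compact A ->
  continuous f -> (forall x, ~ A x -> f x = 0) -> L2 mu (f \_ Omega).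
Proof.
move=> cA cf f0.
have cfA : compact (f @` A) by apply: continuous_compact => //; exact: continuous_subspaceT.
have /compact_bounded [M [_ HM]] : compact ((f @` A) : set R^o) by [].
apply: (@bounded_L2 _ (`|M| + 1)); first exact: continuous_measurable_rV.
move=> x; have [Ax|nAx] := pselect (A x); last by rewrite f0// normr0 addr_ge0.
apply: HM; last by exists x.
by rewrite (le_lt_trans (ler_norm M))// ltrDl.
Qed.

Lemma test_function_L2 phi : test_function Omega phi ->
  L2 mu (phi \_ Omega) /\ forall v, L2 mu ('D_v phi \_ Omega).
Proof.
move=> [Cphi cA _]; set A := closure _ in cA.
have out x : ~ A x -> phi x = 0.
  move=> nAx; apply: contrapT => /eqP px; apply: nAx; exact: subset_closure.
split; first by apply: continuous_support_L2 cA _ out; have [] := Cphi 0%N.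
move=> v; have [_ /(_ v)[_ [cD _]]] := Cphi 1%N.
apply: continuous_support_L2 cA cD _ => x nAx.
have oA : open (~` A) by apply: closed_openC; exact: closed_closure.
rewrite (@near_eq_derive _ _ _ phi (cst 0)) ?derive_cst//.
by apply: filterS (open_nbhs_nbhs (conj oA nAx)) => y /out.
Qed.

Lemma weak_gradient_comb a u Du v Dv :
  Lp mu 2%:E Omega u -> (forall i, Lp mu 2%:E Omega (Du i)) -> weak_gradient Omega u Du ->
  Lp mu 2%:E Omega v -> (forall i, Lp mu 2%:E Omega (Dv i)) -> weak_gradient Omega v Dv ->
  weak_gradient Omega (fun x => a * u x + v x) (fun i x => a * Du i x + Dv i x).
Proof.
move=> /Lp_L2 uL DuL gu /Lp_L2 vL DvL gv i phi tphi.
have [pL DpL] := test_function_L2 tphi.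
have := gu i _ tphi; have := gv i _ tphi; rewrite -!ip_restrict => E1 E2.
have H (w : 'rV[R]_d -> R) (z : 'rV[R]_d -> R) (q : 'rV[R]_d -> R) :
    L2 mu (w \_ Omega) -> L2 mu (z \_ Omega) -> L2 mu (q \_ Omega) ->
    ip mu ((fun x => a * w x + z x) \_ Omega) (q \_ Omega) =
    a * ip mu (w \_ Omega) (q \_ Omega) + ip mu (z \_ Omega) (q \_ Omega).
  move=> wL zL qL; rewrite restrictD restrictZ.
  by rewrite ipDl ?ipZl//; exact: L2Z.
rewrite H// E1 E2 H//; [ring|exact/Lp_L2..].
Qed.

Lemma H1_comb a u Du v Dv : H1 Omega u Du -> H1 Omega v Dv ->
  H1 Omega (fun x => a * u x + v x) (fun i x => a * Du i x + Dv i x).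
Proof.
move=> [u1 u2 u3] [v1 v2 v3]; split; last exact: weak_gradient_comb.
  apply/Lp_L2; rewrite restrictD restrictZ; apply: L2D; last exact/Lp_L2.
  by apply: L2Z; exact/Lp_L2.
move=> i; apply/Lp_L2; rewrite restrictD restrictZ; apply: L2D; last exact/Lp_L2.
by apply: L2Z; exact/Lp_L2.
Qed.

Lemma H1_0 : H1 Omega (fun=> 0) (fun _ _ => 0).
Proof.
have L0 : Lp mu 2%:E Omega (fun=> 0).
  by apply/Lp_L2; rewrite (_ : _ \_ _ = fun=> 0); [exact: L2_0|apply/funext => x; rewrite patchE; case: ifPn].
split => // i phi _; rewrite /Rintegral.
under eq_integral do rewrite mul0r.
by rewrite integral0 /=; under eq_integral do rewrite mul0r; rewrite integral0 /= oppr0.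
Qed.

Lemma H1Z a u Du : H1 Omega u Du -> H1 Omega (fun x => a * u x) (fun i x => a * Du i x).
Proof.
move=> uH; have := H1_comb a uH H1_0.
by congr H1; [|apply/funext => i]; apply/funext => x; rewrite addr0.
Qed.

Lemma H1B u Du v Dv : H1 Omega u Du -> H1 Omega v Dv ->
  H1 Omega (u \- v) (fun i => Du i \- Dv i).
Proof.
move=> uH vH; have := H1_comb (-1) vH uH.
by congr H1; [|apply/funext => i]; apply/funext => x; rewrite mulN1r addrC.
Qed.

Definition H1_sqr (u : 'rV[R]_d -> R) (Du : 'I_d -> 'rV[R]_d -> R) : R :=
  ip mu (u \_ Omega) (u \_ Omega) + \sum_i ip mu (Du i \_ Omega) (Du i \_ Omega).

Lemma H1_sqr_ge0 u Du : 0 <= H1_sqr u Du.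
Proof. by rewrite addr_ge0 ?ip_ge0// sumr_ge0// => i _; exact: ip_ge0. Qed.

Lemma H1_normE u Du : H1 Omega u Du -> H1_norm Omega u Du = (Num.sqrt (H1_sqr u Du))%:E.
Proof.
move=> [/Lp_L2 uL DuL _]; rewrite /H1_norm Lp_norm_sqr//.
under eq_bigr => i _ do rewrite (Lp_norm_sqr (iffLR (Lp_L2 _ _ _) (DuL i))).
by rewrite sumEFin -EFinD poweR2V_EFin// H1_sqr_ge0.
Qed.

Lemma H1_sqrZ a u Du : H1 Omega u Du ->
  H1_sqr (fun x => a * u x) (fun i x => a * Du i x) = a ^+ 2 * H1_sqr u Du.
Proof.
move=> [/Lp_L2 uL DuL _]; rewrite /H1_sqr restrictZ ipZl//; last exact: L2Z.
rewrite ipZr// mulrA -expr2 mulrDr mulr_sumr; congr (_ + _); apply: eq_bigr => i _.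
have DL : L2 mu (Du i \_ Omega) by exact/Lp_L2.
by rewrite restrictZ ipZl//; [rewrite ipZr// mulrA -expr2|exact: L2Z].
Qed.

Lemma H1dualZ G a u Du : H1dual Omega G -> H1 Omega u Du ->
  G (fun x => a * u x) = a * G u.
Proof.
(* Linearity is available for sums a u + v only; writing a u as (a - 1) u + u avoids the value at
   0. *)
move=> [GL _] uH; have := GL (a - 1) u Du u Du uH uH.
rewrite (_ : (fun x => (a - 1) * u x + u x) = (fun x => a * u x)).
  by move=> ->; ring.
by apply/funext => x; ring.
Qed.

Lemma H1dual_norm_fin G : H1dual Omega G -> H1dual_norm Omega G = (fine (H1dual_norm Omega G))%:E.
Proof.
move=> [_ Goo]; rewrite fineK// ge0_fin_numE//.
apply: (@le_trans _ _ (`|G (fun=> 0)|%:E)); first by rewrite lee_fin.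
apply: ereal_sup_ubound; exists (fun=> 0) => //; exists (fun _ _ => 0); first exact: H1_0.
rewrite H1_normE; last exact: H1_0.
rewrite lee_fin -sqrtr1 ler_wsqrtr// /H1_sqr.
have z : ip mu ((fun=> 0) \_ Omega) ((fun=> 0) \_ Omega) = 0.
  rewrite ip_restrict /Rintegral; under eq_integral do rewrite mul0r.
  by rewrite integral0.
by rewrite z add0r big1.
Qed.

Lemma le_H1dual_norm G u Du : H1 Omega u Du -> H1_sqr u Du <= 1 ->
  (`|G u|%:E <= H1dual_norm Omega G)%E.
Proof.
move=> uH u1; apply: ereal_sup_ubound; exists u => //; exists Du => //.
by rewrite H1_normE// lee_fin -sqrtr1 ler_wsqrtr.
Qed.

Lemma H1dual_norm_le G (c : \bar R) :
  (forall u Du, H1 Omega u Du -> (H1_sqr u Du <= 1)%R -> `|G u|%:E <= c)%E ->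
  (H1dual_norm Omega G <= c)%E.
Proof.
move=> H; apply: ge_ereal_sup => _ [u [Du uH u1] <-]; apply: (H _ _ uH).
move: u1; rewrite H1_normE// lee_fin => u1.
by rewrite -(@ler_sqrt _ _ 1)// sqrtr1.
Qed.

End H1_facts.

(** * Extension by zero outside the space-time cylinder *)

Section zero_extension.
Set Implicit Arguments.
Unset Strict Implicit.
Context {R : realType} {d : nat}.
Notation mu := (@lebesgue_rV R d).
Notation leb := (@lebesgue_measure R).
Variables (T : R) (Omega : set 'rV[R]_d).

Definition zext (y : R -> 'rV[R]_d -> R) (t : measurableTypeR R) (x : 'rV[R]_d) : R :=
  (uncurry y \_ (QT T Omega)) (t, x).

Lemma zext_in y t : time T t -> zext y t = y t \_ Omega.
Proof.
move=> tT; apply/funext => x; rewrite /zext !patchE.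
rewrite (_ : ((t, x) \in QT T Omega) = (x \in Omega))//.
by apply/idP/idP => /set_mem; [move=> [_ xO]|move=> xO]; apply/mem_set.
Qed.

Lemma zext_out y t x : ~ time T t -> zext y t x = 0.
Proof.
move=> tT; rewrite /zext !patchE; case: ifPn => // /set_mem[]; by move/tT.
Qed.

Lemma uncurry_zext y : uncurry (zext y) = uncurry y \_ (QT T Omega).
Proof. by apply/funext => -[]. Qed.

Lemma L2QT_zext y : L2QT T Omega y <-> L2 (leb \x mu)%E (uncurry (zext y)).
Proof. by rewrite uncurry_zext; exact: Lp_L2. Qed.

Lemma zextB y1 y2 t x : zext (fun t => y1 t \- y2 t) t x = zext y1 t x - zext y2 t x.
Proof.
by rewrite /zext !patchE; case: ifPn => // _; rewrite subr0.
Qed.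

End zero_extension.

(** * The heat equation at almost every time for a fixed test function *)

Section heat_test.
Set Implicit Arguments.
Unset Strict Implicit.
Context {R : realType} {d : nat}.
Notation mu := (@lebesgue_rV R d).
Notation leb := (@lebesgue_measure R).
Variables (T : R) (Omega : set 'rV[R]_d).
Hypothesis mO : measurable Omega.
Hypothesis Ofin : (mu Omega < +oo)%E.
Let AF := ae_filter_ringOfSetsType leb.

(** Strong measurability makes F t u the limit, for almost every t, of simple functions of t. Its
    square integrability comes from the bound of |F t u| by the dual norm. *)
Lemma measurable_version_unit_ball F u Du : L2H1dual T Omega F -> H1 Omega u Du ->
  H1_sqr Omega u Du <= 1 ->
  exists P : R -> R, [/\ L2 leb P, forall t, ~ time T t -> P t = 0 &
    {ae leb, forall t, time T t -> F t u = P t}].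
Proof.
move=> [Fd [S Ssimple Scv] Fn] uH u1.
have mt := measurable_time T.
(* The upper limit is defined and measurable for all t and agrees with F t u wherever the simple
   functions converge. *)
pose P0 t := fine (limn_esup (fun n => (S n t u)%:E)).
have mS n : measurable_fun setT (fun t => S n t u : R).
  have [N [A [G [mA Gd SE]]]] := Ssimple n.
  under eq_fun do rewrite SE.
  apply: measurable_sum => i; apply: measurable_funM => //.
  by apply: (@measurable_indic _ (measurableTypeR R)); exact: mA.
have mP0 : measurable_fun setT P0.
  apply: measurableT_comp => //; apply: measurable_fun_limn_esup => n.
  exact/measurable_EFinP.
have P0E : {ae leb, forall t, time T t -> F t u = P0 t}.
  apply: (@filterS _ _ AF) Scv => t + tT => /(_ tT) cv.
  suff : (S n t u)%:E @[n --> \oo] --> (F t u)%:E.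
    by move/cvg_limn_einf_sup => [_]; rewrite /P0 => ->.
  apply: cvg_EFin; first exact: nearW.
  apply/cvgrPdist_le => e e0 /=.
  have : \forall n \near \oo, (H1dual_norm Omega (S n t \- F t)%R < e%:E)%E.
    by apply: (cv [set x | (x < e%:E)%E]); apply: open_nbhs_nbhs; split; [exact: open_ereal_lt_ereal|rewrite /= lte_fin].
  apply: filterS => n ne; rewrite -lee_fin distrC.
  by rewrite (le_trans (le_H1dual_norm (S n t \- F t) uH u1))// ltW.
have mP : measurable_fun setT (P0 \_ (time T)).
  by apply/(measurable_restrictT _ mt); exact: measurable_funTS.
exists (P0 \_ (time T)); split.
- split => //; apply/integrableP; split.
    by apply/measurable_EFinP; exact: measurable_funX.
  have : ((L2H1dual_norm T Omega F) `^ 2 < +oo)%E by exact: poweR_lty.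
  rewrite /L2H1dual_norm poweR_Lnorm//; apply: le_lt_trans.
  apply: ge0_le_integral_ae => [t|t|]; rewrite ?poweR_ge0//.
  apply: (@filterS _ _ AF) P0E => t tE.
  rewrite /= !patchE; case: ifPn => [/set_mem /tE <-|_]; last first.
    apply: (@le_trans _ _ 0%E); last exact: poweR_ge0.
    by rewrite (_ : (point : R) = 0)// expr0n/= normr0.
  rewrite normrX -powR_mulrn// -poweR_EFin.
  apply: gt0_ler_poweR => //.
  + by rewrite in_itv/= leey lee_fin normr_ge0.
  + by rewrite in_itv/= leey abse_ge0.
  + by apply: (le_trans (le_H1dual_norm (F t) uH u1)); exact: lee_abs.
- by move=> t tT; rewrite patchE memNset.
- by apply: (@filterS _ _ AF) P0E => t tE /[dup] tT /tE ->; rewrite patchE mem_set.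
Qed.

Lemma measurable_version F u Du : L2H1dual T Omega F -> H1 Omega u Du ->
  exists P : R -> R, [/\ L2 leb P, forall t, ~ time T t -> P t = 0 &
    {ae leb, forall t, time T t -> F t u = P t}].
Proof.
(* The summand 1 keeps c positive even for u = 0, so that u / c is in the unit ball. *)
move=> FL uH; pose c := Num.sqrt (H1_sqr Omega u Du + 1).
have c2 : c ^+ 2 = H1_sqr Omega u Du + 1 by rewrite sqr_sqrtr// addr_ge0// H1_sqr_ge0.
have c0 : 0 < c by rewrite sqrtr_gt0 ltr_wpDl// H1_sqr_ge0.
have vH := H1Z mO Ofin c^-1 uH.
have [|P [PL P0 PE]] := measurable_version_unit_ball FL vH.
  rewrite H1_sqrZ// exprVn ler_pdivrMl ?exprn_gt0// mulr1 c2; lra.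
have [Fd _ _] := FL.
exists (fun t => c * P t); split; first exact: L2Z.
  by move=> t /P0 ->; rewrite mulr0.
move: Fd PE; apply: (@filterS2 _ _ AF) => t Fdt PEt tT.
by rewrite -PEt// (H1dualZ _ (Fdt tT) uH) mulrA mulfV ?gt_eqF// mul1r.
Qed.

Lemma measurable_ip_zext (g : R -> 'rV[R]_d -> R) v : L2QT T Omega g ->
  measurable_fun setT v ->
  measurable_fun setT (fun t => ip mu (zext T Omega g t) v).
Proof.
move=> /L2QT_zext [mg _] mv.
apply: (@measurable_fun_Rintegral R _ _ (measurableTypeR R) _ mu (fun p => uncurry (zext T Omega g) p * v p.2)).
by apply: measurable_funM => //; exact: measurableT_comp.
Qed.

(** With E the residual of the equation tested with u, the test function is a(t) u(x) for a = E / (1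
    + E^2). This weight is bounded whatever the size of E, hence admissible, and a E = E^2 / (1 +
    E^2) is nonnegative with integral 0, which forces E = 0 almost everywhere. *)
Lemma heat_test D F Fo (Dy : 'I_d -> R -> 'rV[R]_d -> R) u Du : L2H1dual T Omega F ->
  L2QT T Omega Fo -> (forall i, L2QT T Omega (Dy i)) ->
  (forall phi Dphi, L2H1 T Omega phi Dphi -> \int[leb]_(t in time T)
    (F t (phi t) + D * (\sum_(i < d) \int[mu]_(x in Omega) (Dy i t x * Dphi i t x))
     - \int[mu]_(x in Omega) (Fo t x * phi t x)) = 0) ->
  H1 Omega u Du ->
  {ae leb, forall t, time T t -> F t u =
    - D * (\sum_i ip mu (zext T Omega (Dy i) t) (Du i \_ Omega)) +
    ip mu (zext T Omega Fo t) (u \_ Omega)}.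
Proof.
move=> FL FoL DyL eq uH; have [P [PL P0 PE]] := measurable_version FL uH.
have mt := measurable_time T.
have [/Lp_L2 uL DuL _] := uH.
have {}DuL i : L2 mu (Du i \_ Omega) by exact/Lp_L2.
pose E t := P t - (- D * (\sum_i ip mu (zext T Omega (Dy i) t) (Du i \_ Omega)) +
    ip mu (zext T Omega Fo t) (u \_ Omega)).
have mE : measurable_fun setT E.
  apply: measurable_funB; first by have [] := PL.
  apply: measurable_funD; last by apply: measurable_ip_zext => //; have [] := uL.
  apply: measurable_funM => //; apply: measurable_sum => i.
  by apply: measurable_ip_zext => //; have [] := DuL i.
pose a t := E t / (1 + E t ^+ 2).
have den t : 0 < 1 + E t ^+ 2 by rewrite ltr_wpDr// sqr_ge0.
have ma : measurable_fun setT a.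
  apply: measurable_funM => //.
  have -> : (fun t => (1 + E t ^+ 2)^-1) = (fun t => (1 + E t ^+ 2) `^ (-1)).
    by apply/funext => t; rewrite powR_inv1// ltW.
  apply: (measurableT_comp (measurable_powR _)).
  by apply: measurable_funD => //; exact: measurable_funX.
have a1 t : `|a t| <= 1.
  rewrite normrM normfV (gtr0_norm (den t)) ler_pdivrMr// mul1r.
  by rewrite -(real_normK (num_real (E t))); have := sqr_ge0 (`|E t| - 1); have := normr_ge0 (E t); nra.
have aE t : 0 <= a t * E t <= 1.
  rewrite /a mulrAC -expr2 ler_pdivrMr// mul1r divr_ge0 ?sqr_ge0 ?(ltW (den t))//=; lra.
have tfin : (leb (time T) < +oo)%E.
  by rewrite /= /time lebesgue_measure_itv/=; case: ifPn => _; rewrite ?ltry// -EFinB ltry.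
have bI (k : R -> R) : measurable_fun setT k -> (forall t, `|k t| <= 1) -> L2 leb (k \_ (time T)).
  move=> mk k1; have mk1 : measurable_fun setT (k \_ (time T)).
    by apply/(measurable_restrictT _ mt); exact: measurable_funTS.
  split => //; have [_] := @L2_indic R _ (measurableTypeR R) leb (time T) mt tfin.
  apply: le_integrable => //; first by apply/measurable_EFinP; exact: measurable_funX.
  move=> t _; rewrite /= lee_fin patchE indicE; case: ifPn => _; last by rewrite expr0n /= normr0.
  by rewrite expr1n normr1 normrX -(expr1n R 2) lerXn2r ?nnegrE.
have aL : L2 leb (a \_ (time T)) by exact: bI.
have tens v : L2 mu (v \_ Omega) -> L2QT T Omega (fun t x => a t * v x).
  move=> vL; apply/L2QT_zext; have := L2_tensor aL vL; congr L2.
  apply/funext => -[t x] /=; have [tT|tT] := pselect (time T t).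
    by rewrite zext_in// restrictZ [in LHS]patchE mem_set.
  by rewrite zext_out// [in LHS]patchE memNset// mul0r.
have phiH : L2H1 T Omega (fun t x => a t * u x) (fun i t x => a t * Du i x).
  split; first exact: tens.
  - split; first by move=> i; exact: tens.
    by apply: aeW => t tT; have [] := H1Z mO Ofin (a t) uH.
  - by apply: aeW => t tT; exact: H1Z.
have := eq _ _ phiH.
have sl (g : R -> 'rV[R]_d -> R) : L2QT T Omega g -> {ae leb, forall t, L2 mu (zext T Omega g t)}.
  by move=> /L2QT_zext; exact: prod_L2_ae.
have gsl : {ae leb, forall t, forall i, L2 mu (zext T Omega (Dy i) t)}.
  by apply: (@filter_forall _ _ _ _ AF) => i; exact: sl.
have [Fd _ _] := FL.
rewrite (@eq_Rintegral_in_ae R _ (measurableTypeR R) leb (time T) _ (fun t => a t * E t)); last first.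
  have H := @filterI _ _ AF _ _ (@filterI _ _ AF _ _ Fd PE) (@filterI _ _ AF _ _ gsl (sl _ FoL)).
  apply: (@filterS _ _ AF) H => t [[Fdt PEt] [gt Fot]] tT.
  have {}Fdt := Fdt tT; have {}PEt := PEt tT.
  rewrite (H1dualZ _ Fdt uH) PEt.
  have pull (g v : 'rV[R]_d -> R) : L2 mu (g \_ Omega) -> L2 mu (v \_ Omega) ->
      \int[mu]_(x in Omega) (g x * (a t * v x)) = a t * ip mu (g \_ Omega) (v \_ Omega).
    move=> gL vL; rewrite -(@ip_restrict _ _ _ mu Omega g (fun x => a t * v x)) restrictZ.
    by rewrite ipZr.
  rewrite pull//; last by rewrite -(zext_in _ _ tT).
  rewrite (eq_bigr (fun i => a t * ip mu (zext T Omega (Dy i) t) (Du i \_ Omega))); last first.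
    by move=> i _; rewrite pull// ?zext_in//; rewrite -(zext_in _ _ tT).
  by rewrite -mulr_sumr /E (zext_in _ _ tT); ring.
have iaE : leb.-integrable setT (EFin \o (fun t => a t * E t) \_ (time T)).
  have mk : measurable_fun setT (fun t => a t * E t) by exact: measurable_funM.
  have kL : L2 leb ((fun t => a t * E t) \_ (time T)).
    by apply: bI => // t; have /andP[h1 h2] := aE t; rewrite ger0_norm.
  have oL : L2 leb (\1_(time T)) by exact: (@L2_indic R _ (measurableTypeR R)).
  have := L2_mul_integrable kL oL; congr integrable; apply/funext => t /=.
  by rewrite patchE indicE; case: (t \in time T); rewrite ?mulr1 ?mul0r.
rewrite Rintegral_mkcond => /(@Rintegral_eq0_ae R _ (measurableTypeR R) leb _ _ iaE) H.
have {}H := H ltac:(by move=> t; rewrite patchE; case: ifPn => // _; have /andP[] := aE t).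
move: PE H; apply: (@filterS2 _ _ AF) => t PEt + tT; rewrite patchE mem_set// PEt//.
rewrite /a mulrAC -expr2 => /eqP; rewrite mulf_eq0 invr_eq0 [1 + _ == 0]gt_eqF// orbF sqrf_eq0.
by move=> /eqP; rewrite /E => /eqP; rewrite subr_eq0 => /eqP.
Qed.

End heat_test.

(** * Bounding the dual norm at almost every time *)

Section norming_family.
Set Implicit Arguments.
Unset Strict Implicit.
Context {R : realType} {d : nat}.
Notation mu := (@lebesgue_rV R d).
Notation leb := (@lebesgue_measure R).
Variables (T : R) (Omega : set 'rV[R]_d).
Hypothesis mO : measurable Omega.
Hypothesis Ofin : (mu Omega < +oo)%E.
Let AF := ae_filter_ringOfSetsType leb.

Lemma H1dual_bound G : H1dual Omega G -> exists c : R,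
  forall u Du, H1 Omega u Du -> H1_sqr Omega u Du <= 1 -> `|G u| <= c.
Proof.
move=> Gd; exists (fine (H1dual_norm Omega G)) => u Du uH u1.
by rewrite -lee_fin -(H1dual_norm_fin Gd); exact: le_H1dual_norm uH u1.
Qed.

Lemma H1dual_comb a G1 G2 : H1dual Omega G1 -> H1dual Omega G2 ->
  H1dual Omega (fun u => G1 u + a * G2 u).
Proof.
move=> d1 d2; have [c1 b1] := H1dual_bound d1; have [c2 b2] := H1dual_bound d2.
split.
  move=> r u Du v Dv uH vH; have [l1 _] := d1; have [l2 _] := d2.
  by rewrite (l1 _ _ _ _ _ uH vH) (l2 _ _ _ _ _ uH vH); ring.
apply: (@le_lt_trans _ _ (c1 + `|a| * c2)%:E); last exact: ltry.
apply: H1dual_norm_le => u Du uH u1; rewrite lee_fin (le_trans (ler_normD _ _))//.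
by rewrite lerD ?(b1 _ _ uH u1)// normrM ler_wpM2l// (b2 _ _ uH u1).
Qed.

Lemma H1dual0 : H1dual Omega (fun=> 0).
Proof.
split; first by move=> *; rewrite mulr0 addr0.
apply: (@le_lt_trans _ _ 0%E); last exact: ltry.
by apply: H1dual_norm_le => u Du _ _; rewrite normr0.
Qed.

Lemma H1dual_sum (I : finType) (A : {set I}) (G : I -> ('rV[R]_d -> R) -> R) :
  (forall i, H1dual Omega (G i)) -> H1dual Omega (fun u => \sum_(i in A) G i u).
Proof.
move=> Gd; elim: (index_enum I) => [|i s IH].
  by under eq_fun do rewrite big_nil; exact: H1dual0.
under eq_fun do rewrite big_cons.
case: (i \in A) => //; have := H1dual_comb 1 (Gd i) IH.
by under eq_fun do rewrite mul1r.
Qed.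

(** The sets on which the values are taken are forgotten: what matters later is that a sequence of
    such functions takes countably many values in all. *)
Definition finite_range_H1dual (S : R -> ('rV[R]_d -> R) -> R) : Prop :=
  exists (I : finType) (G : I -> ('rV[R]_d -> R) -> R),
    (forall i, H1dual Omega (G i)) /\ forall t, exists i, forall u, S t u = G i u.

Lemma simple_finite_range S : simple_H1dual Omega S -> finite_range_H1dual S.
Proof.
move=> [n [A [F [_ Fd SE]]]].
(* The sets A i may overlap, so the value at t is indexed by the set of all i with t in A i. *)
exists {set 'I_n}, (fun (B : {set 'I_n}) u => \sum_(i in B) F i u); split.
  by move=> B; exact: H1dual_sum.
move=> t; exists [set i | t \in A i]%SET => u.
rewrite SE [RHS]big_mkcond/=; apply: eq_bigr => i _.
by rewrite indicE finset.inE; case: (t \in A i); rewrite ?mul1r ?mul0r.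
Qed.

Lemma finite_range_H1dualB S1 S2 : finite_range_H1dual S1 -> finite_range_H1dual S2 ->
  finite_range_H1dual (fun t u => S1 t u - S2 t u).
Proof.
move=> [I1 [G1 [d1 s1]]] [I2 [G2 [d2 s2]]].
exists (I1 * I2)%type, (fun i u => G1 i.1 u - G2 i.2 u); split.
  move=> i; have := H1dual_comb (-1) (d1 i.1) (d2 i.2).
  by under eq_fun do rewrite mulN1r.
by move=> t; have [i1 e1] := s1 t; have [i2 e2] := s2 t; exists (i1, i2) => u; rewrite e1 e2.
Qed.

(** Convergence in the dual norm, spelled out on the unit ball so that it passes to differences by
    the triangle inequality. *)
Definition approximable (F : R -> ('rV[R]_d -> R) -> R) : Prop :=
  exists2 S : nat -> R -> ('rV[R]_d -> R) -> R, (forall n, finite_range_H1dual (S n)) &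
    {ae leb, forall t, time T t -> forall e, 0 < e -> \forall n \near \oo,
      forall u Du, H1 Omega u Du -> H1_sqr Omega u Du <= 1 -> `|S n t u - F t u| <= e}.

Lemma L2H1dual_approximable F : L2H1dual T Omega F -> approximable F.
Proof.
move=> [_ [S Ss Sc] _]; exists S; first by move=> n; exact: simple_finite_range.
apply: (@filterS _ _ AF) Sc => t + tT e e0 => /(_ tT) cv.
have : \forall n \near \oo, (H1dual_norm Omega (S n t \- F t)%R < e%:E)%E.
  by apply: (cv [set x | (x < e%:E)%E]); apply: open_nbhs_nbhs; split; [exact: open_ereal_lt_ereal|rewrite /= lte_fin].
apply: filterS => n ne u Du uH u1; rewrite -lee_fin.
by rewrite (le_trans (le_H1dual_norm (S n t \- F t) uH u1))// ltW.
Qed.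

Lemma approximableB F1 F2 : approximable F1 -> approximable F2 ->
  approximable (fun t u => F1 t u - F2 t u).
Proof.
move=> [S1 r1 c1] [S2 r2 c2]; exists (fun n t u => S1 n t u - S2 n t u).
  by move=> n; exact: finite_range_H1dualB.
move: c1 c2; apply: (@filterS2 _ _ AF) => t h1 h2 tT e e0.
have e2 : 0 < e / 2 by rewrite divr_gt0.
move: (h1 tT _ e2) (h2 tT _ e2); apply: filterS2 => n k1 k2 u Du uH u1.
rewrite (_ : _ - _ = (S1 n t u - F1 t u) - (S2 n t u - F2 t u)); last by ring.
rewrite (le_trans (ler_normB _ _))// [leRHS](splitr e).
by rewrite lerD ?(k1 _ _ uH u1) ?(k2 _ _ uH u1).
Qed.

Lemma norming_vector G (e : R) : H1dual Omega G -> 0 < e -> exists u Du,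
  [/\ H1 Omega u Du, H1_sqr Omega u Du <= 1 &
      forall v Dv, H1 Omega v Dv -> H1_sqr Omega v Dv <= 1 -> `|G v| <= `|G u| + e].
Proof.
move=> Gd e0; pose c := fine (H1dual_norm Omega G).
have nE : H1dual_norm Omega G = c%:E := H1dual_norm_fin Gd.
have [u [Du [uH u1 ce]]] : exists u Du, [/\ H1 Omega u Du, H1_sqr Omega u Du <= 1 & c - e <= `|G u|].
  apply: contrapT => H; have : (H1dual_norm Omega G <= (c - e)%:E)%E.
    apply: H1dual_norm_le => u Du uH u1; rewrite lee_fin leNgt; apply/negP => h.
    by apply: H; exists u, Du; split => //; exact: ltW.
  by rewrite nE lee_fin; lra.
exists u, Du; split => // v Dv vH v1.
have : `|G v| <= c by rewrite -lee_fin -nE; exact: le_H1dual_norm vH v1.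
lra.
Qed.

(* The dual norm is an uncountable supremum; the approximants, which take finitely
   many values, make a countable family of test functions sufficient. *)
Lemma H1dual_norm_ae_le F (B : R -> R) : approximable F ->
  (forall u Du, H1 Omega u Du -> H1_sqr Omega u Du <= 1 ->
    {ae leb, forall t, time T t -> `|F t u| <= B t}) ->
  {ae leb, forall t, time T t -> (H1dual_norm Omega (F t) <= (B t)%:E)%E}.
Proof.
move=> [S Sr Sc] FB.
have key n m : exists (W : set (('rV[R]_d -> R))), [/\
    forall t, exists2 u, W u & forall v Dv, H1 Omega v Dv -> H1_sqr Omega v Dv <= 1 ->
      `|S n t v| <= `|S n t u| + m.+1%:R^-1,
    forall u, W u -> exists2 Du, H1 Omega u Du & H1_sqr Omega u Du <= 1 &
    {ae leb, forall t, time T t -> forall u, W u -> `|F t u| <= B t}].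
  have [I [G [Gd GS]]] := Sr n.
  have m0 : 0 < m.+1%:R^-1 :> R by rewrite invr_gt0 ltr0n.
  pose U i := cid (norming_vector (Gd i) m0).
  exists [set u | exists i, u = sval (U i)]; split.
  - move=> t; have [i Gi] := GS t; exists (sval (U i)); first by exists i.
    move=> v Dv vH v1; rewrite !Gi.
    by have [Du [_ _ h]] := svalP (U i); exact: h vH v1.
  - by move=> _ [i ->]; have [Du [h1 h2 _]] := svalP (U i); exists Du.
  - have : {ae leb, forall t, forall i, time T t -> `|F t (sval (U i))| <= B t}.
      apply: (@filter_forall _ _ _ _ AF) => i.
      by have [Du [h1 h2 _]] := svalP (U i); exact: FB h1 h2.
    by apply: (@filterS _ _ AF) => t h tT _ [i ->]; exact: h.
pose W n m := sval (cid (key n m)).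
have WP n m := svalP (cid (key n m)).
have : {ae leb, forall t, forall n m, time T t -> forall u, W n m u -> `|F t u| <= B t}.
  apply/ae_foralln => n; apply/ae_foralln => m.
  by have [_ _ h] := WP n m; exact: h.
move: Sc; apply: (@filterS2 _ _ AF) => t Sct WB tT.
apply: H1dual_norm_le => v Dv vH v1; rewrite lee_fin; apply/ler_addgt0Pr => e e0.
(* The chain is |F v| <= |S v| + e/3 <= |S u| + 2 e/3 <= |F u| + e, with u the norming vector
   attached to the value of S at time t. *)
have e3 : 0 < e / 3 by rewrite divr_gt0.
have [n Sn] := @filter_ex _ _ _ _ (Sct tT _ e3).
have [m me] : exists m, m.+1%:R^-1 < e / 3 :> R.
  have [N _ /(_ N (leqnn _)) NP] := near_infty_natSinv_lt (PosNum e3).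
  by exists N.
have [h1 h2 _] := WP n m; have [u Wu hu] := h1 t; have [Du uH u1] := h2 u Wu.
have := Sn _ _ uH u1; have := Sn _ _ vH v1; have := hu _ _ vH v1; have := WB n m tT u Wu.
have := ler_normD (S n t v) (F t v - S n t v).
have -> : S n t v + (F t v - S n t v) = F t v by ring.
rewrite (distrC (F t v)).
have := ler_normD (F t u) (S n t u - F t u).
have -> : F t u + (S n t u - F t u) = S n t u by ring.
have ee : e = e / 3 + e / 3 + e / 3 by field.
move: me ee; clear; move: `|F t u| `|S n t u - F t u| `|S n t u| `|F t v| `|S n t v| `|S n t v - F t v| (B t) (m.+1%:R^-1) => *.
lra.
Qed.

End norming_family.

(** * Weak solutions of the heat equation in integrated form *)

Section heat_evolution.
Set Implicit Arguments.
Unset Strict Implicit.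
Context {R : realType} {d : nat}.
Notation mu := (@lebesgue_rV R d).
Notation leb := (@lebesgue_measure R).
Variables (T D : R) (Omega : set 'rV[R]_d).
Hypothesis mO : measurable Omega.
Hypothesis Ofin : (mu Omega < +oo)%E.
Let AF := ae_filter_ringOfSetsType leb.

Definition heat_pairing (Dy : 'I_d -> R -> 'rV[R]_d -> R) (Fo : R -> 'rV[R]_d -> R)
    (u : 'rV[R]_d -> R) (Du : 'I_d -> 'rV[R]_d -> R) (t : measurableTypeR R) : R :=
  - D * (\sum_i ip mu (zext T Omega (Dy i) t) (Du i \_ Omega)) +
  ip mu (zext T Omega Fo t) (u \_ Omega).

(* [z] is the representative of [y] in C([0,T];L^2(Omega)), extended by 0 outside
   Omega; [F] is the time derivative of [y] and [Fo] the right-hand side. *)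
Record heat_evolution (y : R -> 'rV[R]_d -> R) (Dy : 'I_d -> R -> 'rV[R]_d -> R)
    (F : R -> ('rV[R]_d -> R) -> R) (Fo z : R -> 'rV[R]_d -> R) : Prop := HeatEvolution {
  he_y : L2QT T Omega y;
  he_Dy : forall i, L2QT T Omega (Dy i);
  he_Fo : L2QT T Omega Fo;
  he_H1 : {ae leb, forall t, time T t -> H1 Omega (y t) (fun i => Dy i t)};
  he_z : forall t, 0 <= t <= T -> L2 mu (z t);
  he_zc : forall t e, 0 <= t <= T -> 0 < e -> exists2 r, 0 < r &
    forall s, 0 <= s <= T -> `|s - t| < r ->
      ip mu (fun x => z s x - z t x) (fun x => z s x - z t x) <= e;
  he_zy : {ae leb, forall t, time T t -> {ae mu, forall x, z t x = zext T Omega y t x}};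
  he_weak : forall u Du, H1 Omega u Du -> forall s t, 0 <= s -> s <= t -> t <= T ->
    ip mu (fun x => z t x - z s x) (u \_ Omega) =
    \int[leb]_(r in `]s, t]) heat_pairing Dy Fo u Du r;
  he_dual : forall u Du, H1 Omega u Du ->
    {ae leb, forall t, time T t -> F t u = heat_pairing Dy Fo u Du t};
  he_app : approximable T Omega F }.

Lemma integrable_ip_zext g v : L2QT T Omega g -> L2 mu v ->
  leb.-integrable setT (EFin \o (fun t => ip mu (zext T Omega g t) v)).
Proof.
move=> /L2QT_zext gL vL.
have tfin : (leb (time T) < +oo)%E.
  by rewrite /= /time lebesgue_measure_itv/=; case: ifPn => _; rewrite ?ltry// -EFinB ltry.
have oL : L2 leb (\1_(time T)).
  by apply: (@L2_indic R _ (measurableTypeR R)) => //; exact: measurable_time.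
have QL : L2 (leb \x mu)%E (uncurry (fun (r : measurableTypeR R) x => \1_(time T) r * v x)).
  by have := L2_tensor oL vL; congr L2; apply/funext => -[].
have [i1 _] := prod_ip gL QL; move: i1; congr integrable; apply/funext => t /=.
congr EFin; apply: eq_Rintegral => x _; rewrite indicE.
have [tT|tT] := pselect (time T t); first by rewrite mem_set// mul1r.
by rewrite zext_out// !mul0r.
Qed.

Lemma integrable_heat_pairing Dy Fo u Du : (forall i, L2QT T Omega (Dy i)) ->
  L2QT T Omega Fo -> H1 Omega u Du ->
  leb.-integrable setT (EFin \o heat_pairing Dy Fo u Du).
Proof.
move=> DyL FoL [/Lp_L2 uL DuL _].
apply: (@integrable_EFinD R _ (measurableTypeR R)) => //; last exact: integrable_ip_zext.
apply: (@integrable_EFinZ R _ (measurableTypeR R)) => //.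
apply: (@integrable_EFin_sum R _ (measurableTypeR R)) => // i.
by apply: integrable_ip_zext => //; exact/Lp_L2.
Qed.

Lemma heat_pairing_out Dy Fo u Du t : ~ time T t -> heat_pairing Dy Fo u Du t = 0.
Proof.
move=> tT.
have z0 g v : ip mu (zext T Omega g t) v = 0.
  rewrite /ip; under eq_Rintegral do rewrite zext_out// mul0r.
  by rewrite /Rintegral integral0.
by rewrite /heat_pairing z0 big1 ?mulr0 ?addr0// => i _; rewrite z0.
Qed.

Lemma heat_pairingB Dy1 Dy2 Fo1 Fo2 u Du t :
  (forall i, L2 mu (zext T Omega (Dy1 i) t)) -> (forall i, L2 mu (zext T Omega (Dy2 i) t)) ->
  L2 mu (zext T Omega Fo1 t) -> L2 mu (zext T Omega Fo2 t) -> H1 Omega u Du ->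
  heat_pairing (fun i t => Dy1 i t \- Dy2 i t) (fun t => Fo1 t \- Fo2 t) u Du t =
  heat_pairing Dy1 Fo1 u Du t - heat_pairing Dy2 Fo2 u Du t.
Proof.
move=> D1 D2 F1 F2 [/Lp_L2 uL DuL _].
have {}DuL i : L2 mu (Du i \_ Omega) by exact/Lp_L2.
have E g1 g2 v : L2 mu (zext T Omega g1 t) -> L2 mu (zext T Omega g2 t) -> L2 mu v ->
    ip mu (zext T Omega (fun t => g1 t \- g2 t) t) v =
    ip mu (zext T Omega g1 t) v - ip mu (zext T Omega g2 t) v.
  by move=> *; rewrite -ipBl//; congr ip; apply/funext => x; rewrite zextB.
rewrite /heat_pairing E//.
under eq_bigr do rewrite E//.
by rewrite sumrB; ring.
Qed.

(** For fixed u the function (y t, u) has weak derivative F t u, which equals the pairing for almost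
    every t; [du_bois_reymond] then gives the integrated equation for all s <= t. Null sets
    depending on u have disappeared from it, which is what later permits u = y t. *)
Lemma heat_evolution_of_solution y Dy F Fo y0 :
  L2QT T Omega y -> L2QT T Omega Fo -> space_gradient T Omega y Dy ->
  L2H1dual T Omega F -> time_derivative T Omega y F -> initial_value T Omega y y0 ->
  (forall phi Dphi, L2H1 T Omega phi Dphi -> \int[leb]_(t in time T)
    (F t (phi t) + D * (\sum_(i < d) \int[mu]_(x in Omega) (Dy i t x * Dphi i t x))
     - \int[mu]_(x in Omega) (Fo t x * phi t x)) = 0) ->
  exists z, heat_evolution y Dy F Fo z /\ {ae mu, forall x, z 0 x = (y0 \_ Omega) x}.
Proof.
move=> yL FoL [DyL Dyw] FL dy [yc [ycL ycc ycy yc0]] eq.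
have sl (g : R -> 'rV[R]_d -> R) : L2QT T Omega g -> {ae leb, forall t, L2 mu (zext T Omega g t)}.
  by move=> /L2QT_zext; exact: prod_L2_ae.
have gsl : {ae leb, forall t, forall i, L2 mu (zext T Omega (Dy i) t)}.
  by apply: (@filter_forall _ _ _ _ AF) => i; exact: sl.
have zL t : 0 <= t <= T -> L2 mu (yc t \_ Omega).
  by move=> tT; apply/Lp_L2; apply: ycL; rewrite /= in_itv.
have zc t e : 0 <= t <= T -> 0 < e -> exists2 r, 0 < r &
    forall s, 0 <= s <= T -> `|s - t| < r ->
      ip mu (fun x => (yc s \_ Omega) x - (yc t \_ Omega) x)
            (fun x => (yc s \_ Omega) x - (yc t \_ Omega) x) <= e.
  move=> tT e0.
  have /= cv := ycc t _; rewrite in_itv/= in cv; have {}cv := cv tT.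
  have nb : nbhs (0%E : \bar R) [set x | (x < (Num.sqrt e)%:E)%E].
    by apply: open_nbhs_nbhs; split; [exact: open_ereal_lt_ereal|rewrite /= lte_fin sqrtr_gt0].
  have : \forall s \near within `[0, T]%classic (nbhs t),
    (Lp_norm mu 2%:E Omega (yc s \- yc t)%R < (Num.sqrt e)%:E)%E by exact: cv _ nb.
  rewrite near_withinE => /nbhs_ballP[r /= r0 H]; exists r => // s sT st.
  have := H s; rewrite /ball/= distrC in_itv/= => /(_ st sT).
  have dL : L2 mu ((yc s \- yc t) \_ Omega).
    by rewrite restrictB; apply: L2B; exact: zL.
  rewrite Lp_normE// lte_fin ltr_sqrt// restrictB => h; exact: ltW.
have zy : {ae leb, forall t, time T t -> {ae mu, forall x, (yc t \_ Omega) x = zext T Omega y t x}}.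
  apply: (@filterS _ _ AF) ycy => t + tT => /(_ tT); apply: filterS => x h.
  by rewrite zext_in// !patchE; case: ifPn => // /set_mem/h.
have dual u Du : H1 Omega u Du ->
  {ae leb, forall t, time T t -> F t u = heat_pairing Dy Fo u Du t}.
  by move=> uH; exact: (heat_test mO Ofin FL FoL DyL eq uH).
exists (fun t => yc t \_ Omega); split; last first.
  by apply: filterS yc0 => x h; rewrite !patchE; case: ifPn => // /set_mem/h.
split => //.
- move: (sl _ yL) Dyw gsl => h1 h2 h3.
  have H := @filterI _ _ AF _ _ h1 (@filterI _ _ AF _ _ h2 h3).
  apply: (@filterS _ _ AF) H => t [k1 [k2 k3]] tT; split.
  + by apply/Lp_L2; rewrite -(zext_in _ _ tT).
  + by move=> i; apply/Lp_L2; rewrite -(zext_in _ _ tT).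
  + exact: k2.
- move=> u Du uH s t s0 st tT.
  have [/Lp_L2 uL DuL _] := uH.
  have ih := integrable_heat_pairing DyL FoL uH.
  have mt := measurable_time T.
  pose k t := \int[mu]_(x in Omega) (y t x * u x).
  pose kc t := ip mu (yc t \_ Omega) (u \_ Omega).
  have sd : scalar_derivative T k (heat_pairing Dy Fo u Du).
    move=> eta teta; rewrite -(dy u Du eta uH teta).
    apply: (@eq_Rintegral_in_ae R _ (measurableTypeR R)).
    by apply: (@filterS _ _ AF) (dual _ _ uH) => r + rT => /(_ rT) ->.
  have ckc : {within `[0, T], continuous kc}.
    apply/subspace_continuousP => r; rewrite /= in_itv/= => rT.
    apply/cvgrPdist_le => e e0.
    (* By Cauchy-Schwarz an increment of kc has square at most |u|^2 times that of z, so a squared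
       increment of at most e^2 / c suffices; the summand 1 makes c positive. *)
    pose c := ip mu (u \_ Omega) (u \_ Omega) + 1.
    have c0 : 0 < c by rewrite ltr_wpDl// ip_ge0.
    have [|r1 r10 H] := zc r (e ^+ 2 / c) rT; first by rewrite divr_gt0// exprn_gt0.
    rewrite near_withinE; apply/nbhs_ballP; exists r1 => //= q qr qT.
    rewrite /= in_itv/= in qT.
    have {}H := H q qT; rewrite distrC in H; have {}H := H qr.
    rewrite /kc distrC -ipBl//; [|exact: zL..].
    have dL : L2 mu (fun x => (yc q \_ Omega) x - (yc r \_ Omega) x).
      by apply: L2B; exact: zL.
    rewrite -(@ler_sqr _ `|_| e) ?nnegrE// ?(ltW e0)// real_normK ?num_real//.
    rewrite (le_trans (ip_cauchy_schwarz dL uL))//.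
    rewrite (@le_trans _ _ (e ^+ 2 / c * c))//; last by rewrite divfK ?gt_eqF.
    rewrite ler_pM ?ip_ge0// /c lerDl//.
  have kck : {ae leb, forall t, time T t -> kc t = k t}.
    apply: (@filterS _ _ AF) zy => r + rT => /(_ rT) h.
    rewrite /k -ip_restrict /kc; apply: eq_ip_ae; last exact: aeW.
    by apply: filterS h => x ->; rewrite zext_in.
  have := @du_bois_reymond R T k _ kc sd ckc kck (integrableS measurableT mt (@subsetT _ _) ih) s t s0 st tT.
  rewrite /kc -ipBl//; last 2 first.
  - by apply: zL; apply/andP; split => //; exact: le_trans st.
  - by apply: zL; apply/andP; split => //; exact: le_trans tT.
  move=> ->; apply: eq_Rintegral => r _; rewrite patchE; case: ifPn => //.
  by rewrite notin_setE => /heat_pairing_out ->.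
- exact: L2H1dual_approximable.
Qed.

(** Once the right-hand side is a datum [Fo], everything is linear. This is why [heat_evolution]
    mentions neither the nonlinearity nor the controls: it applies to solutions and to their
    differences alike. *)
Lemma heat_evolutionB y1 Dy1 F1 Fo1 z1 y2 Dy2 F2 Fo2 z2 :
  heat_evolution y1 Dy1 F1 Fo1 z1 -> heat_evolution y2 Dy2 F2 Fo2 z2 ->
  heat_evolution (fun t => y1 t \- y2 t) (fun i t => Dy1 i t \- Dy2 i t)
    (fun t u => F1 t u - F2 t u) (fun t => Fo1 t \- Fo2 t) (fun t => z1 t \- z2 t).
Proof.
move=> e1 e2.
have LB g1 g2 : L2QT T Omega g1 -> L2QT T Omega g2 -> L2QT T Omega (fun t => g1 t \- g2 t).
  move=> /L2QT_zext h1 /L2QT_zext h2; apply/L2QT_zext; have := L2B h1 h2.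
  by congr L2; apply/funext => -[t x] /=; rewrite zextB.
have sl (g : R -> 'rV[R]_d -> R) : L2QT T Omega g -> {ae leb, forall t, L2 mu (zext T Omega g t)}.
  by move=> /L2QT_zext; exact: prod_L2_ae.
have pB u Du : H1 Omega u Du -> {ae leb, forall t,
    heat_pairing (fun i t => Dy1 i t \- Dy2 i t) (fun t => Fo1 t \- Fo2 t) u Du t =
    heat_pairing Dy1 Fo1 u Du t - heat_pairing Dy2 Fo2 u Du t}.
  move=> uH.
  have g1 : {ae leb, forall t, forall i, L2 mu (zext T Omega (Dy1 i) t)}.
    by apply: (@filter_forall _ _ _ _ AF) => i; apply: sl; exact: he_Dy e1 i.
  have g2 : {ae leb, forall t, forall i, L2 mu (zext T Omega (Dy2 i) t)}.
    by apply: (@filter_forall _ _ _ _ AF) => i; apply: sl; exact: he_Dy e2 i.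
  have H := @filterI _ _ AF _ _ (@filterI _ _ AF _ _ g1 g2)
    (@filterI _ _ AF _ _ (sl _ (he_Fo e1)) (sl _ (he_Fo e2))).
  by apply: (@filterS _ _ AF) H => t [[? ?] [? ?]]; exact: heat_pairingB.
split.
- exact: LB (he_y e1) (he_y e2).
- by move=> i; exact: LB (he_Dy e1 i) (he_Dy e2 i).
- exact: LB (he_Fo e1) (he_Fo e2).
- move: (he_H1 e1) (he_H1 e2); apply: (@filterS2 _ _ AF) => t h1 h2 tT.
  exact: (H1B mO Ofin (h1 tT) (h2 tT)).
- by move=> t tT; exact: L2B (he_z e1 tT) (he_z e2 tT).
(* The 4 stems from |a - b|^2 <= 2 |a|^2 + 2 |b|^2. *)
- move=> t e tT e0; have e4 : 0 < e / 4 by rewrite divr_gt0.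
  have [r1 r10 H1] := he_zc e1 tT e4; have [r2 r20 H2] := he_zc e2 tT e4.
  exists (Num.min r1 r2); first by rewrite lt_min r10.
  move=> s sT; rewrite lt_min => /andP[sr1 sr2].
  have d1 := L2B (he_z e1 sT) (he_z e1 tT); have d2 := L2B (he_z e2 sT) (he_z e2 tT).
  have := ip_sqrB_le d1 d2; have := H1 s sT sr1; have := H2 s sT sr2.
  rewrite (_ : (fun x => (z1 s \- z2 s) x - (z1 t \- z2 t) x) =
    (fun x => (z1 s x - z1 t x) - (z2 s x - z2 t x))); first lra.
  by apply/funext => x /=; ring.
- move: (he_zy e1) (he_zy e2); apply: (@filterS2 _ _ AF) => t h1 h2 tT.
  by move: (h1 tT) (h2 tT); apply: filterS2 => x k1 k2; rewrite /= zextB k1 k2.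
- move=> u Du uH s t s0 st tT.
  have sin : 0 <= s <= T by rewrite s0 (le_trans st).
  have tin : 0 <= t <= T by rewrite tT (le_trans s0).
  have [/Lp_L2 uL _ _] := uH.
  have mi : measurable (`]s, t]%classic : set (measurableTypeR R)) by exact: measurable_itv.
  have i1 := integrable_heat_pairing (he_Dy e1) (he_Fo e1) uH.
  have i2 := integrable_heat_pairing (he_Dy e2) (he_Fo e2) uH.
  rewrite (@eq_Rintegral_in_ae R _ (measurableTypeR R) leb _ _
    (fun r => heat_pairing Dy1 Fo1 u Du r - heat_pairing Dy2 Fo2 u Du r)); last first.
    by apply: (@filterS _ _ AF) (pB _ _ uH) => r h _.
  rewrite RintegralB//; [|exact: integrableS i1|exact: integrableS i2].
  rewrite -(he_weak e1 uH)// -(he_weak e2 uH)// -ipBl//.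
  + by congr ip; apply/funext => x /=; ring.
  + exact: L2B (he_z e1 tin) (he_z e1 sin).
  + exact: L2B (he_z e2 tin) (he_z e2 sin).
- move=> u Du uH.
  have H := @filterI _ _ AF _ _ (pB _ _ uH) (@filterI _ _ AF _ _ (he_dual e1 uH) (he_dual e2 uH)).
  by apply: (@filterS _ _ AF) H => t [h [h1 h2]] tT; rewrite h1// h2.
- exact: approximableB (he_app e1) (he_app e2).
Qed.

End heat_evolution.

(** * Mixed norms in time and space *)

Section LpL2.
Set Implicit Arguments.
Unset Strict Implicit.
Context {R : realType} {d : nat}.
Notation mu := (@lebesgue_rV R d).
Notation leb := (@lebesgue_measure R).
Variables (T : R) (Omega : set 'rV[R]_d).
Let AF := ae_filter_ringOfSetsType leb.

Lemma Lnorm_oo_le {dX} {X : measurableType dX} (nu : {measure set X -> \bar R})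
    (f : X -> \bar R) (c : R) : 0 <= c -> {ae nu, forall x, `|f x| <= c%:E}%E ->
  ('N[nu]_+oo[f] <= c%:E)%E.
Proof.
move=> c0 fc; rewrite unlock /Lnorm; case: ifPn => [_|_]; last by rewrite lee_fin.
exact/ess_sup_inf.ess_supP.
Qed.

(** The norm of exponent infinity is the essential supremum only over a space of positive measure,
    and 0 otherwise; positivity is therefore checked on ]0, 1[. *)
Lemma Lnorm_oo_ge (f : measurableTypeR R -> \bar R) :
  {ae leb, forall t, `|f t| <= 'N[leb]_+oo[f]}%E.
Proof.
rewrite unlock /Lnorm; have -> : (0 < leb [set: measurableTypeR R])%E.
  apply: (@lt_le_trans _ _ (leb `]0, 1[%classic)).
    by rewrite lebesgue_measure_itv/= lte_fin ltr01 -EFinB subr0 lte_fin.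
  by apply: le_measure; rewrite ?inE//; exact: measurable_itv.
exact: ess_sup_inf.ess_sup_ge.
Qed.

Lemma LpL2_integral y : measurable_fun setT (uncurry y \_ (QT T Omega)) ->
  (\int[(leb \x mu)]_p ((uncurry (zext T Omega y) p) ^+ 2)%:E =
   \int[leb]_t (`|((fun t => Lp_norm mu 2%:E Omega (y t)) \_ (time T)) t| `^ 2))%E.
Proof.
rewrite -uncurry_zext => mz; rewrite fubini_tonelli1//; last 2 first.
- by apply/measurable_EFinP; exact: measurable_funX.
- by move=> p; rewrite lee_fin sqr_ge0.
apply: eq_integral => t _; rewrite /fubini_F/= patchE.
have [tT|tT] := pselect (time T t); last first.
  (* Outside ]0, T[ the restriction takes the default point of the extended reals, which is 0. *)
  rewrite memNset// (_ : (point : \bar R) = 0%E)// abse0 poweR0r//.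
  by rewrite (eq_integral (fun=> 0%E)) ?integral0// => x _; rewrite zext_out// expr0n.
rewrite mem_set// gee0_abs ?Lnorm_ge0// poweR_Lnorm// zext_in//.
by apply: eq_integral => x _; rewrite /= powR_mulrn// real_normK ?num_real.
Qed.

Lemma L2QT_of_lty y : measurable_fun setT (uncurry y \_ (QT T Omega)) ->
  (\int[leb]_t (`|((fun t => Lp_norm mu 2%:E Omega (y t)) \_ (time T)) t| `^ 2) < +oo)%E ->
  L2QT T Omega y.
Proof.
move=> my; rewrite -LpL2_integral// => yoo; apply/L2QT_zext; split.
  by rewrite uncurry_zext.
apply/integrableP; split.
  by apply/measurable_EFinP; apply: measurable_funX; rewrite uncurry_zext.
apply: le_lt_trans yoo; rewrite le_eqVlt; apply/orP; left; apply/eqP.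
by apply: eq_integral => p _ /=; rewrite ger0_norm ?sqr_ge0.
Qed.

Lemma LpL2_oo_L2QT y : LpL2 T Omega +oo y -> L2QT T Omega y.
Proof.
move=> [my yoo]; apply: L2QT_of_lty => //.
pose N := (fun t : measurableTypeR R => Lp_norm mu 2%:E Omega (y t)) \_ (time T).
rewrite /LpL2_norm -/N in yoo *.
have M0 : (0 <= 'N[leb]_+oo[N])%E by exact: Lnorm_ge0.
pose M := fine 'N[leb]_+oo[N].
have ME : ('N[leb]_+oo[N] = M%:E)%E by rewrite fineK// ge0_fin_numE.
have tfin : (leb (time T) < +oo)%E.
  by rewrite /= /time lebesgue_measure_itv/=; case: ifPn => _; rewrite ?ltry// -EFinB ltry.
have mt := measurable_time T.
apply: (@le_lt_trans _ _ (\int[leb]_t ((M ^+ 2)%:E * (\1_(time T) t)%:E))%E); last first.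
  rewrite ge0_integralZl//; last 2 first.
  - by apply/measurable_EFinP; exact: measurable_indic.
  - by rewrite lee_fin sqr_ge0.
  rewrite integral_indic// setIT lte_mul_pinfty// ?lee_fin ?sqr_ge0//.
apply: ge0_le_integral_ae => [t|t|]; first exact: poweR_ge0.
  by rewrite mule_ge0 ?lee_fin ?sqr_ge0.
apply: (@filterS _ _ AF) (Lnorm_oo_ge N) => t; rewrite ME => NM.
rewrite indicE; have [tT|tT] := pselect (time T t); last first.
  by rewrite memNset// mule0 /N patchE memNset// (_ : (point : \bar R) = 0%E)// abse0 poweR0r.
rewrite mem_set// mule1; move: NM; case: `|N t|%E (abse_ge0 (N t)) => // r; rewrite !lee_fin => r0 rM.
by rewrite powR_mulrn// lerXn2r ?nnegrE// (le_trans r0).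
Qed.

Lemma L2QT_ip y : L2QT T Omega y ->
  leb.-integrable setT (EFin \o (fun t => ip mu (zext T Omega y t) (zext T Omega y t))) /\
  \int[leb]_t ip mu (zext T Omega y t) (zext T Omega y t) =
    ip (leb \x mu)%E (uncurry (zext T Omega y)) (uncurry (zext T Omega y)).
Proof. by move=> /L2QT_zext yL; exact: prod_ip. Qed.

Lemma LpL2_norm2 y c : LpL2 T Omega +oo y -> LpL2_norm T Omega 2%:E y = c%:E ->
  \int[leb]_t ip mu (zext T Omega y t) (zext T Omega y t) = c ^+ 2.
Proof.
move=> /[dup] [[my _]] yoo yc; have yL := LpL2_oo_L2QT yoo.
have [_ ->] := L2QT_ip yL; have /L2QT_zext zL := yL.
have := LpL2_integral my; rewrite -poweR_Lnorm// -/(LpL2_norm T Omega 2%:E y) yc.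
have c0 : 0 <= c by rewrite -lee_fin -yc; exact: Lnorm_ge0.
rewrite poweR_EFin powR_mulrn// => h; rewrite /ip /Rintegral.
by under eq_integral do rewrite -expr2; rewrite h.
Qed.

Lemma LpL2_oo_le y c : 0 <= c ->
  {ae leb, forall t, time T t -> L2 mu (zext T Omega y t) /\
    ip mu (zext T Omega y t) (zext T Omega y t) <= c} ->
  (LpL2_norm T Omega +oo y <= (Num.sqrt c)%:E)%E.
Proof.
move=> c0 yc; apply: Lnorm_oo_le; first exact: sqrtr_ge0.
apply: (@filterS _ _ AF) yc => t tc; rewrite patchE.
have [tT|tT] := pselect (time T t); last first.
  by rewrite memNset// (_ : (point : \bar R) = 0%E)// abse0 lee_fin.
have [tL le] := tc tT; rewrite mem_set// zext_in// in tL le *.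
by rewrite Lp_normE// gee0_abs ?lee_fin// ler_wsqrtr.
Qed.

Lemma L2QT_norm_sqr y : L2QT T Omega y ->
  (L2QT_norm T Omega y ^+ 2 =
   (\int[leb]_t ip mu (zext T Omega y t) (zext T Omega y t))%:E)%E.
Proof.
move=> yL; have [_ ->] := L2QT_ip yL; have /Lp_L2 zL := yL.
by rewrite /L2QT_norm Lp_norm_sqr// uncurry_zext.
Qed.

End LpL2.

(** * The energy inequality for the heat equation up to any time *)

Section heat_energy.
Set Implicit Arguments.
Unset Strict Implicit.
Context {R : realType} {d : nat}.
Notation mu := (@lebesgue_rV R d).
Notation leb := (@lebesgue_measure R).
Variables (T D : R) (Omega : set 'rV[R]_d).
Hypothesis D0 : 0 <= D.
Let AF := ae_filter_ringOfSetsType leb.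

(** The energy inequality has its final time built in, and data vanishing beyond it; truncation at b
    gives the estimate at every b <= T. *)
Let cut (b : R) (g : measurableTypeR R -> 'rV[R]_d -> R) (t : measurableTypeR R) (x : 'rV[R]_d) : R :=
  (uncurry g \_ (time b `*` setT)) (t, x).

Let cut_in b g t : time b t -> cut b g t = g t.
Proof. by move=> tb; apply/funext => x; rewrite /cut patchE mem_set. Qed.

Let cut_out b g t x : ~ time b t -> cut b g t x = 0.
Proof. by move=> tb; rewrite /cut patchE memNset//= => -[]. Qed.

Let cut_L2 b g : L2 (leb \x mu)%E (uncurry g) -> L2 (leb \x mu)%E (uncurry (cut b g)).
Proof.
move=> gL; rewrite (_ : uncurry (cut b g) = uncurry g \_ (time b `*` setT)); last first.
  by apply/funext => -[].
by apply: L2_restrict => //; apply: measurableX => //; exact: measurable_time.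
Qed.

Let cut_ip b g : L2 (leb \x mu)%E (uncurry g) ->
  ip (leb \x mu)%E (uncurry (cut b g)) (uncurry (cut b g)) =
  \int[leb]_(t in time b) ip mu (g t) (g t).
Proof.
move=> gL; have cL := cut_L2 b gL; have [_ <-] := prod_ip cL cL.
rewrite [RHS]Rintegral_mkcond; apply: eq_Rintegral => t _; rewrite patchE.
have [tb|tb] := pselect (time b t); first by rewrite mem_set// cut_in.
rewrite memNset// /ip; under eq_Rintegral do rewrite cut_out// mul0r.
by rewrite /Rintegral integral0.
Qed.

Lemma heat_energy y Dy F Fo z (b : R) : 0 < b <= T -> heat_evolution T D Omega y Dy F Fo z ->
  ip mu (z b) (z b) +
  2 * D * (\sum_i \int[leb]_(t in time b) ip mu (zext T Omega (Dy i) t) (zext T Omega (Dy i) t)) <=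
  ip mu (z 0) (z 0) + \int[leb]_(t in time b) ip mu (zext T Omega Fo t) (zext T Omega Fo t) +
  \int[leb]_(t in time b) ip mu (zext T Omega y t) (zext T Omega y t).
Proof.
move=> /andP[b0 bT] he.
have zL t : 0 <= t <= b -> L2 mu (z t).
  by move=> /andP[t0 tb]; apply: (he_z he); rewrite t0 (le_trans tb).
have tbT t : time b t -> time T t.
  by rewrite /time/= !in_itv/= => /andP[-> tb]; exact: lt_le_trans bT.
have yL := iffLR (L2QT_zext T Omega y) (he_y he).
have FL := iffLR (L2QT_zext T Omega Fo) (he_Fo he).
have gL i := iffLR (L2QT_zext T Omega (Dy i)) (he_Dy he i).
rewrite -!cut_ip//; under eq_bigr do rewrite -cut_ip//.
apply: (@energy_inequality R _ _ mu b D d z (cut b (zext T Omega y)) (cut b (zext T Omega Fo))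
  (fun i => cut b (zext T Omega (Dy i)))) => //.
- move=> t e tb e0; have tT : 0 <= t <= T.
    by have /andP[-> h] := tb; rewrite (le_trans h).
  pose N := ip mu (z t) (z t); have N0 : 0 <= N := ip_ge0 _ _.
  (* Continuity of the squared norm: |z s|^2 - |z t|^2 = del + 2 (z s - z t, z t), and Young's
     inequality with weight eta bounds its absolute value by del (1 + 1/eta) + eta N. Each of the
     two terms is made at most e/2. *)
  pose eta := e / (2 * (N + 1)).
  have N1 : 0 < N + 1 by rewrite ltr_wpDl.
  have eta0 : 0 < eta by rewrite divr_gt0// mulr_gt0.
  have c0 : 0 < 1 + eta^-1 by rewrite addr_gt0// invr_gt0.
  have [|r r0 H] := he_zc he (t := t) (e := e / 2 / (1 + eta^-1)) tT.
    by rewrite !divr_gt0.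
  exists r => // s sb st; have sT : 0 <= s <= T.
    by have /andP[-> h] := sb; rewrite (le_trans h).
  have {}H := H s sT st.
  have zs := he_z he sT; have zt := he_z he tT.
  have dL := L2B zs zt.
  set del := ip mu (fun x => z s x - z t x) (fun x => z s x - z t x) in H.
  have E : ip mu (z s) (z s) - ip mu (z t) (z t) = del + 2 * ip mu (fun x => z s x - z t x) (z t).
    by rewrite /del ip_sqrB// ipBl//; ring.
  have Y1 a : 2 * (a * ip mu (fun x => z s x - z t x) (z t)) <= del + a ^+ 2 * N.
    have := ip_young dL (L2Z a zt); rewrite ipZr// -/del ipZl//; last exact: L2Z.
    by rewrite [ip mu (z t) (fun x => a * z t x)]ipZr// [a * (a * _)]mulrA -expr2.
  rewrite E; move: (ip mu (fun x => z s x - z t x) (z t)) Y1 => q Y1.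
  have del0 : 0 <= del := ip_ge0 _ _.
  have etaN : eta * N <= e / 2.
    rewrite /eta (_ : e / (2 * (N + 1)) * N = e / 2 * (N / (N + 1))); last by field; rewrite gt_eqF.
    by rewrite ler_piMr ?divr_ge0 ?(ltW e0)// ler_pdivrMr// mul1r lerDl.
  have H' : del * (1 + eta^-1) <= e / 2 by rewrite -ler_pdivlMr.
  have P1 : 2 * q <= del * eta^-1 + eta * N.
    have := Y1 eta; rewrite -(ler_pM2l (_ : 0 < eta^-1)) ?invr_gt0//.
    rewrite (_ : eta^-1 * (2 * (eta * q)) = 2 * q); last by field; rewrite gt_eqF.
    by rewrite (_ : eta^-1 * (del + eta ^+ 2 * N) = del * eta^-1 + eta * N)//; field; rewrite gt_eqF.
  have P2 : - (2 * q) <= del * eta^-1 + eta * N.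
    have := Y1 (- eta); rewrite -(ler_pM2l (_ : 0 < eta^-1)) ?invr_gt0//.
    rewrite (_ : eta^-1 * (2 * (- eta * q)) = - (2 * q)); last by field; rewrite gt_eqF.
    by rewrite (_ : eta^-1 * (del + (- eta) ^+ 2 * N) = del * eta^-1 + eta * N)//; field; rewrite gt_eqF.
  move: H' P1 P2 etaN del0; rewrite mulrDr mulr1; move: (del * eta^-1) (eta * N) => A B.
  clear => *; apply/ler_normlP; split; lra.
- exact: cut_L2.
- exact: cut_L2.
- by move=> i; exact: cut_L2.
- by move=> t x; exact: cut_out.
- by move=> t x; exact: cut_out.
- by move=> i t x; exact: cut_out.
- apply: (@filterS _ _ AF) (he_zy he) => t h tb.
  by rewrite cut_in//; exact: h (tbT _ tb).
(* Here the solution is tested with itself: y t is in H^1 for almost every t, and [he_weak] holds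
   for every element of H^1. *)
- apply: (@filterS _ _ AF) (he_H1 he) => t + tb => /(_ (tbT _ tb)) yH s /andP[s0 st].
  have /andP[t0 tb'] : 0 < t < b by move: tb; rewrite /time/= in_itv.
  have tT : t <= T by rewrite (le_trans (ltW tb')).
  rewrite cut_in// zext_in; last exact: tbT.
  rewrite (he_weak he yH s0 st tT).
  apply: eq_Rintegral => r; rewrite inE/= in_itv/= => /andP[sr rt].
  have rb : time b r by rewrite /time/= in_itv/= (le_lt_trans s0)// (le_lt_trans rt).
  rewrite /heat_pairing cut_in//; congr (_ * _ + _); apply: eq_bigr => i _.
  by rewrite !cut_in// [zext _ _ _ t]zext_in//; exact: tbT.
Qed.

End heat_energy.

(** * Composition with Lipschitz functions *)

Section square_integrable_comp.
Set Implicit Arguments.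
Unset Strict Implicit.
Context {R : realType} {dX : measure_display} {X : measurableType dX}.
Variable mu : {measure set X -> \bar R}.

Lemma L2_le_ae (u g : X -> R) : measurable_fun setT u ->
  mu.-integrable setT (EFin \o g) -> {ae mu, forall x, u x ^+ 2 <= g x} -> L2 mu u.
Proof.
move=> um /integrableP[gm gi] ug; split => //; apply/integrableP; split.
  by apply/measurable_EFinP; exact: measurable_funX.
apply: le_lt_trans gi; apply: ge0_le_integral_ae => [x|x|]; rewrite ?abse_ge0//.
apply: filterS ug => x h; rewrite /= lee_fin ger0_norm ?sqr_ge0//.
by rewrite (le_trans h)// ler_norm.
Qed.

Lemma lipschitz_dist (f : R -> R) (L : R) : L.-lipschitz f ->
  forall x y, `|f x - f y| <= L * `|x - y|.
Proof. by move=> fL x y; exact: (fL (x, y)). Qed.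

Lemma lipschitz_measurable (f : R -> R) (L : R) :
  (forall x y, `|f x - f y| <= L * `|x - y|) -> measurable_fun setT f.
Proof.
move=> fL; apply: continuous_measurable_fun => x; apply/cvgrPdist_le => e e0.
have L0 : 0 < `|L| + 1 by rewrite ltr_wpDl.
apply/nbhs_ballP; exists (e / (`|L| + 1)); first by rewrite /= divr_gt0.
move=> y xy; rewrite (le_trans (fL x y))//.
rewrite (@le_trans _ _ ((`|L| + 1) * `|x - y|))//.
  by rewrite ler_wpM2r// (le_trans (ler_norm L))// lerDl.
by rewrite mulrC -ler_pdivlMr//; exact: ltW.
Qed.

Lemma lipschitz_sqr_dist (f : R -> R) (L : R) : (forall x y, `|f x - f y| <= L * `|x - y|) ->
  forall x y, (f x - f y) ^+ 2 <= L ^+ 2 * (x - y) ^+ 2.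
Proof.
move=> fL x y; rewrite -exprMn -[leLHS]real_normK ?num_real// -[leRHS]real_normK ?num_real//.
rewrite lerXn2r ?nnegrE// (le_trans (fL x y))//.
by rewrite normrM ler_wpM2r// ler_norm.
Qed.

(** With v = 0 it gives f(u) - f(0) in L^2. The constant is subtracted because f(u) itself equals
    f(0) wherever the zero extension u vanishes, possibly on a set of infinite measure. *)
Lemma lipschitz_comp_L2 f L u v : (forall x y, `|f x - f y| <= L * `|x - y|) ->
  L2 mu u -> L2 mu v ->
  L2 mu (fun x => f (u x) - f (v x)) /\
  ip mu (fun x => f (u x) - f (v x)) (fun x => f (u x) - f (v x)) <=
  L ^+ 2 * ip mu (fun x => u x - v x) (fun x => u x - v x).
Proof.
move=> fL uL vL; have mf := lipschitz_measurable fL; have dL := L2B uL vL.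
have fsq := lipschitz_sqr_dist fL.
have di := integrable_EFinZ (L ^+ 2) measurableT (L2_mul_integrable dL dL).
have wL : L2 mu (fun x => f (u x) - f (v x)).
  apply: L2_le_ae di _.
    by apply: measurable_funB; apply: measurableT_comp => //; [case: uL|case: vL].
  by apply: aeW => x; rewrite -expr2.
split => //; rewrite /ip -RintegralZl//; last exact: L2_mul_integrable.
apply: le_Rintegral_ae => //; first exact: L2_mul_integrable.
by apply: aeW => x; rewrite -!expr2.
Qed.

Lemma ip_sqrD3_le u v w : L2 mu u -> L2 mu v -> L2 mu w ->
  ip mu (fun x => u x + v x + w x) (fun x => u x + v x + w x) <=
  3 * (ip mu u u + ip mu v v + ip mu w w).
Proof.
move=> uL vL wL; have := ip_young uL vL; have := ip_young uL wL; have := ip_young vL wL.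
by rewrite ip_sqrD// ?ip_sqrD// ?ipDl//; [lra|exact: L2D].
Qed.

End square_integrable_comp.

(** * The right-hand sides of the two equations *)

Section force.
Set Implicit Arguments.
Unset Strict Implicit.
Context {R : realType} {d J K : nat}.
Notation mu := (@lebesgue_rV R d).
Notation leb := (@lebesgue_measure R).
Variables (T : R) (Omega : set 'rV[R]_d).
Hypothesis mO : measurable Omega.
Hypothesis Ofin : (mu Omega < +oo)%E.
Let AF := ae_filter_ringOfSetsType leb.

Lemma time_fin : (leb (time T) < +oo)%E.
Proof.
by rewrite /= /time lebesgue_measure_itv/=; case: ifPn => _; rewrite ?ltry// -EFinB ltry.
Qed.

Lemma L2_time_indic : L2 leb (\1_(time T)).
Proof. by apply: (@L2_indic R _ (measurableTypeR R)); [exact: measurable_time|exact: time_fin]. Qed.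

Definition force (f : R -> R) (g : 'I_J -> 'rV[R]_d -> R) (y : R -> 'rV[R]_d -> R)
    (k : 'I_J -> R -> R) (t : R) (x : 'rV[R]_d) : R :=
  f (y t x) + \sum_j k j t * g j x.

(** As f(0) may differ from 0, composition with f does not commute with the extension by zero; the
    term f(0) times the indicator of Omega corrects this. *)
Lemma zext_force f g y k t : time T t ->
  zext T Omega (force f g y k) t =
  (fun x => f (zext T Omega y t x) - f 0 + f 0 * \1_Omega x + \sum_j k j t * (g j \_ Omega) x).
Proof.
move=> tT; apply/funext => x; rewrite !zext_in// !patchE indicE /force.
case: ifPn => xO; last by rewrite subrr mulr0 !add0r big1// => j _; rewrite patchE (negbTE xO) mulr0.
by rewrite mulr1 subrK; congr (_ + _); apply: eq_bigr => j _; rewrite patchE xO.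
Qed.

Lemma L2QT_force f L g y k : (forall x y, `|f x - f y| <= L * `|x - y|) ->
  (forall j, Lp mu 2%:E Omega (g j)) -> L2QT T Omega y ->
  (forall j, L2 leb (k j \_ (time T))) -> L2QT T Omega (force f g y k).
Proof.
move=> fL gL /L2QT_zext yL kL; apply/L2QT_zext.
have [dL _] := lipschitz_comp_L2 fL yL (L2_0 (leb \x mu)%E).
have oL := L2_tensor L2_time_indic (@L2_indic R _ _ mu Omega mO Ofin).
have kgL j := L2_tensor (kL j) (iffLR (Lp_L2 _ _ _) (gL j)).
have := L2D (L2D dL (L2Z (f 0) oL)) (L2_sum (index_enum 'I_J) kgL).
congr L2; apply/funext => -[t x] /=.
have [tT|tT] := pselect (time T t).
  rewrite zext_force// indicE mem_set// mul1r; congr (_ + _).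
  by apply: eq_bigr => j _; rewrite [X in X * _]patchE mem_set.
rewrite !zext_out// subrr indicE memNset//= mul0r mulr0 add0r add0r.
by rewrite big1// => j _; rewrite patchE memNset// mul0r.
Qed.

Lemma L2_ip_zext g v : L2QT T Omega g -> L2 mu v -> L2 leb (fun t => ip mu (zext T Omega g t) v).
Proof.
move=> gL vL; have zL := iffLR (L2QT_zext _ _ _) gL.
have [zi _] := prod_ip zL zL.
apply: (@L2_le_ae R _ (measurableTypeR R) leb _
    (fun t => ip mu v v * ip mu (zext T Omega g t) (zext T Omega g t))).
- by apply/measurable_EFinP; apply: (measurable_int leb); exact: integrable_ip_zext.
- exact: (@integrable_EFinZ R _ (measurableTypeR R)).
- apply: (@filterS _ _ AF) (prod_L2_ae zL) => t tL.
  by rewrite mulrC; exact: ip_cauchy_schwarz.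
Qed.

Lemma L2_thermostat_W (w : 'I_K -> R -> R) (Lw : 'I_K -> R) ys (u : control R d J K) j y :
  (forall k x y, `|w k x - w k y| <= Lw k * `|x - y|) -> in_U Omega u ->
  L2QT T Omega y -> L2QT T Omega ys ->
  L2 leb (thermostat_W Omega w ys u j y \_ (time T)).
Proof.
move=> wL [_ hL] yL ysL.
have zL : L2QT T Omega (fun t => y t \- ys t).
  move: yL ysL => /L2QT_zext yL /L2QT_zext ysL; apply/L2QT_zext.
  by have := L2B yL ysL; congr L2; apply/funext => -[t x] /=; rewrite zextB.
pose I k t := ip mu (zext T Omega (fun t => y t \- ys t) t) (ctrl_h u k \_ Omega).
have IL k : L2 leb (I k) by apply: L2_ip_zext => //; exact/Lp_L2.
have dL k : L2 leb (fun t => w k (I k t) - w k 0).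
  have [|+ _] := lipschitz_comp_L2 (mu := leb) (wL k) (IL k) (v := fun=> 0); last by [].
  exact: (@L2_0 R _ (measurableTypeR R)).
have kL k : L2 leb (fun t : measurableTypeR R => ctrl_alpha u j k * (w k (I k t) - w k 0 + w k 0 * \1_(time T) t)).
  apply: (@L2Z R _ (measurableTypeR R)); apply: (@L2D R _ (measurableTypeR R)) => //.
  by apply: (@L2Z R _ (measurableTypeR R)); exact: L2_time_indic.
have := @L2_restrict R _ (measurableTypeR R) leb _ _ (measurable_time T) (@L2_sum R _ (measurableTypeR R) leb _ (index_enum 'I_K) _ kL).
congr L2; apply/funext => t; rewrite !patchE; case: ifPn => // tT.
apply: eq_bigr => k _; rewrite indicE tT mulr1 subrK; congr (_ * w k _).
rewrite /I zext_in; last exact: set_mem.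
rewrite ip_restrict; apply: eq_Rintegral => x _ /=; exact: mulrC.
Qed.

End force.

(** * Gronwall's inequality with an almost-everywhere bound on the rate *)

Section gronwall.
Set Implicit Arguments.
Unset Strict Implicit.
Context {R : realType}.
Notation leb := (@lebesgue_measure R).
Let AF := ae_filter_ringOfSetsType leb.

Lemma Rintegral_subset_le (A B : set (measurableTypeR R)) (f : R -> R) : measurable A ->
  measurable B -> leb.-integrable B (EFin \o f) -> A `<=` B -> (forall x, 0 <= f x) ->
  \int[leb]_(x in A) f x <= \int[leb]_(x in B) f x.
Proof.
move=> mA mB fi AB f0; have fA : leb.-integrable A (EFin \o f) by exact: integrableS fi.
rewrite [leLHS]Rintegral_mkcond [leRHS]Rintegral_mkcond.
apply: (@le_Rintegral_ae R _ (measurableTypeR R)).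
- exact/(@integrable_patch R _ (measurableTypeR R) leb _ _ mA).
- exact/(@integrable_patch R _ (measurableTypeR R) leb _ _ mB).
- apply: aeW => x; rewrite !patchE; case: ifPn => [/set_mem/AB xB|_].
    by rewrite mem_set.
  by case: ifPn.
Qed.

Lemma integral_expR_le (c b : R) : 0 < c -> 0 < b ->
  leb.-integrable (time b) (EFin \o (fun t => expR (c * t))) /\
  \int[leb]_(t in time b) expR (c * t) <= c^-1 * expR (c * b).
Proof.
move=> c0 b0.
have ce : continuous (fun t : R^o => expR (c * t)).
  move=> t; apply: continuous_comp; last exact: continuous_expR.
  by apply: continuousM => //; exact: cst_continuous.
have ce1 : continuous (fun t : R^o => c^-1 * expR (c * t)).
  by move=> t; apply: cvgM; [exact: cvg_cst|exact: ce].
have ic : leb.-integrable `[0, b] (EFin \o (fun t => expR (c * t))).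
  apply: continuous_compact_integrable; first exact: segment_compact.
  exact: continuous_subspaceT.
have i0 : leb.-integrable (time b) (EFin \o (fun t => expR (c * t))).
  apply: integrableS ic => //; first exact: measurable_time.
  exact: subset_itv_oo_cc.
split => //.
have E : (\int[leb]_(t in `[0%R, b]) (expR (c * t))%:E =
    (c^-1 * expR (c * b))%:E - (c^-1 * expR (c * 0))%:E)%E.
  apply: (@continuous_FTC2 _ _ (fun t => c^-1 * expR (c * t))) => //.
  - exact: continuous_subspaceT.
  - split.
    + by move=> z _; exact: ex_derive.
    + by apply/cvg_at_right_filter; exact: ce1.
    + by apply/cvg_at_left_filter; exact: ce1.
  - move=> z _; rewrite derive1Ml// derive1_comp// derive1E.
    have /funeqP -> := @derive_expR R.
    by rewrite derive1Ml// derive1_id mulr1 mulrCA mulVf ?mulr1// gt_eqF.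
have : \int[leb]_(t in `[0, b]) expR (c * t) <= c^-1 * expR (c * b).
  by rewrite /Rintegral E/= lerBlDr lerDl mulr_ge0 ?expR_ge0// invr_ge0 ltW.
apply: le_trans; apply: Rintegral_subset_le => //; first exact: measurable_time.
exact: subset_itv_oo_cc.
Qed.

(** The supremum m of exp(- c t) z(t) is finite thanks to M, which does not enter the conclusion.
    Replacing z t by m exp(c t) bounds the rate, so that only q, p and an exponential are
    integrated, and the hypothesis becomes m <= A + P + m/2. *)
Lemma gronwall (z q p : R -> R) (A B T M : R) : 0 < B -> 0 <= A ->
  (forall t, 0 <= t <= T -> 0 <= z t <= M) -> (forall t, 0 <= p t) ->
  leb.-integrable (time T) (EFin \o q) -> leb.-integrable (time T) (EFin \o p) ->
  {ae leb, forall t, time T t -> q t <= p t + B * z t} ->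
  z 0 <= A -> (forall b, 0 < b <= T -> z b <= A + \int[leb]_(t in time b) q t) ->
  forall b, 0 <= b <= T -> z b <= 2 * (A + \int[leb]_(t in time T) p t) * expR (2 * B * T).
Proof.
move=> B0 A0 zM p0 qi pi' qp z0A zq b0 b0T.
have T0 : 0 <= T by case/andP: b0T => ? /(le_trans _); exact.
(* The integral of B m exp(c t) up to b is at most (B / c) m exp(c b); with c = 2 B the factor is
   1/2, so the term can be absorbed. *)
pose c := 2 * B; have c0 : 0 < c by rewrite mulr_gt0.
pose W := [set expR (- (c * t)) * z t | t in [set t | 0 <= t <= T]].
pose m := sup W; pose P := \int[leb]_(t in time T) p t.
have P0 : 0 <= P by apply: Rintegral_ge0 => t _.
have Wub : has_ubound W.
  exists M => _ [t /= tT <-]; have /andP[zt ztM] := zM t tT.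
  rewrite (le_trans _ ztM)// ler_piMl// -expR0 ler_expR oppr_le0.
  by case/andP: tT => t0 _; rewrite mulr_ge0// ltW.
have le_m t : 0 <= t <= T -> z t <= m * expR (c * t).
  move=> tT; rewrite -ler_pdivrMr ?expR_gt0// -expRN mulrC.
  by apply: ub_le_sup => //; exists t.
have m0 : 0 <= m.
  have /andP[h _] := zM 0 (introT andP (conj (lexx 0) T0)).
  have := le_m 0 (introT andP (conj (lexx 0) T0)).
  by rewrite mulr0 expR0 mulr1; exact: le_trans.
have key b : 0 < b <= T -> z b <= A + P + m / 2 * expR (c * b).
  move=> /[dup] bT /andP[b0' bT'].
  have [ei ele] := integral_expR_le c0 b0'.
  have sb : (time b `<=` time T) by move=> t; rewrite /time/= !in_itv/= => /andP[-> h]; exact: lt_le_trans bT'.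
  have mb := measurable_time b; have mT := measurable_time T.
  have qib : leb.-integrable (time b) (EFin \o q) by exact: integrableS qi.
  have pib : leb.-integrable (time b) (EFin \o p) by exact: integrableS pi'.
  rewrite (le_trans (zq b bT))// -addrA lerD2l.
  have H : \int[leb]_(t in time b) q t <= \int[leb]_(t in time b) (p t + B * m * expR (c * t)).
    have i2 := @integrable_EFinD R _ (measurableTypeR R) leb _ _ _ mb pib
      (@integrable_EFinZ R _ (measurableTypeR R) leb _ (B * m) _ mb ei).
    rewrite [leLHS]Rintegral_mkcond [leRHS]Rintegral_mkcond; apply: (@le_Rintegral_ae R _ (measurableTypeR R)).
    - exact/(@integrable_patch R _ (measurableTypeR R) leb _ _ mb).
    - exact/(@integrable_patch R _ (measurableTypeR R) leb _ _ mb).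
    - apply: (@filterS _ _ AF) qp => t h; rewrite !patchE; case: ifPn => // /set_mem tb.
      have tT := sb _ tb; rewrite (le_trans (h tT))// lerD2l -mulrA ler_wpM2l ?(ltW B0)// le_m//.
      by move: tT; rewrite /time/= in_itv/= => /andP[h1 h2]; rewrite !ltW.
  rewrite (le_trans H)// RintegralD//; last exact: (@integrable_EFinZ R _ (measurableTypeR R) leb _ (B * m) _ mb ei).
  apply: lerD.
    exact: Rintegral_subset_le.
  rewrite RintegralZl// (le_trans (ler_wpM2l _ ele))//; first by rewrite mulr_ge0// ltW.
  rewrite /c (_ : B * m * ((2 * B)^-1 * expR (2 * B * b)) = m / 2 * expR (2 * B * b))//.
  by field; rewrite gt_eqF.
have mle : m <= A + P + m / 2.
  apply: ge_sup; first by exists (expR (- (c * 0)) * z 0), 0 => //=; rewrite lexx.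
  move=> _ [t /= /andP[t0 tT] <-].
  have AP : 0 <= A + P by rewrite addr_ge0.
  have [->|tn0] := eqVneq t 0.
    rewrite mulr0 oppr0 expR0 mul1r (le_trans z0A)//.
    by rewrite -addrA lerDl addr_ge0// divr_ge0.
  have := key t; rewrite lt_neqAle eq_sym tn0 t0 => /(_ tT) h.
  rewrite expRN mulrC ler_pdivrMr ?expR_gt0// (le_trans h)// mulrDl lerD2r.
  by rewrite ler_peMr// -expR0 ler_expR mulr_ge0// ltW.
have {}mle : m <= 2 * (A + P) by move: mle; lra.
rewrite (le_trans (le_m _ b0T))// (le_trans (ler_wpM2r (expR_ge0 _) mle))//.
by rewrite ler_wpM2l ?mulr_ge0 ?addr_ge0// ler_expR ler_wpM2l ?(ltW c0)//; case/andP: b0T.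
Qed.

End gronwall.

(** * The scalar relaxation equations in integrated form *)

Section thermostat_evolution.
Set Implicit Arguments.
Unset Strict Implicit.
Context {R : realType}.
Notation leb := (@lebesgue_measure R).
Variable T : R.
Let AF := ae_filter_ringOfSetsType leb.

(** The feedback is left out, so that this notion is linear in the triple and passes to differences;
    the equation itself is used separately, at almost every time. *)
Record thermostat_evolution (k k' kc : R -> R) : Prop := ThermostatEvolution {
  te_k' : L2 leb (k' \_ (time T));
  te_kc : {ae leb, forall t, time T t -> kc t = k t};
  te_int : forall b, 0 <= b <= T ->
    kc b - kc 0 = \int[leb]_(r in `]0, b]) (k' \_ (time T)) r }.

Lemma L2_Rintegral_sqr_le (b : R) (g : measurableTypeR R -> R) : 0 < b -> L2 leb g ->
  (\int[leb]_(r in `]0, b]) g r) ^+ 2 <= b * \int[leb]_(r in time b) (g r ^+ 2).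
Proof.
move=> b0 gL; have mb := measurable_time b.
have gb : L2 leb (g \_ (time b)) by exact: (@L2_restrict R _ (measurableTypeR R)).
have ob : L2 leb (\1_(time b)) by exact: L2_time_indic.
have iab : leb.-integrable (time b) (EFin \o g).
  apply/(@integrable_patch R _ (measurableTypeR R) leb _ _ mb).
  have := @L2_mul_integrable R _ (measurableTypeR R) leb _ _ gb ob.
  congr integrable; apply/funext => r /=; congr EFin; rewrite patchE indicE.
  by case: ifPn => _; rewrite ?mulr1 ?mul0r.
have -> : \int[leb]_(r in `]0, b]) g r = ip leb (g \_ (time b)) (\1_(time b)).
  rewrite -Rintegral_itv_bndo_bndc; last exact: iab.
  rewrite Rintegral_mkcond; apply: eq_Rintegral => r _; rewrite !patchE indicE.
  by rewrite /time; case: ifPn => _; rewrite ?mulr1 ?mul0r.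
rewrite (le_trans (@ip_cauchy_schwarz R _ (measurableTypeR R) leb _ _ gb ob))// mulrC.
rewrite (_ : ip leb \1_(time b) \1_(time b) = b); last first.
  rewrite /ip (_ : (fun x => _) = \1_(time b)); last first.
    by apply/funext => r; rewrite indicE; case: (_ \in _); rewrite ?mulr0 ?mulr1.
  rewrite /Rintegral integral_indic// setIT /= /time lebesgue_measure_itv/= lte_fin b0.
  by rewrite -EFinB subr0.
by rewrite ip_restrict ler_wpM2l ?(ltW b0).
Qed.

Lemma thermostat_energy k k' kc b : 0 < b <= T -> thermostat_evolution k k' kc ->
  kc b ^+ 2 <= 2 * kc 0 ^+ 2 + 2 * T * \int[leb]_(t in time b) (k' t ^+ 2).
Proof.
move=> /andP[b0 bT] [kL _ ki].
have kb : kc b - kc 0 = \int[leb]_(r in `]0, b]) (k' \_ (time T)) r.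
  by apply: ki; rewrite bT ltW.
have := L2_Rintegral_sqr_le b0 kL; rewrite -kb.
rewrite (_ : \int[leb]_(r in time b) _ = \int[leb]_(t in time b) (k' t ^+ 2)); last first.
  apply: eq_Rintegral => r /set_mem rb; rewrite patchE mem_set//.
  by move: rb; rewrite /time/= !in_itv/= => /andP[-> h]; exact: lt_le_trans bT.
have : 0 <= \int[leb]_(t in time b) (k' t ^+ 2) by apply: Rintegral_ge0 => r _; exact: sqr_ge0.
move: (\int[leb]_(t in time b) _) => I I0 H.
(* The square (k_b - 2 k_0)^2 is exactly the gap in k_b^2 <= 2 k_0^2 + 2 (k_b - k_0)^2. *)
have := ler_wpM2r I0 bT; have := sqr_ge0 (kc b - 2 * kc 0); nra.
Qed.

Lemma thermostat_evolutionB k1 k1' kc1 k2 k2' kc2 :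
  thermostat_evolution k1 k1' kc1 -> thermostat_evolution k2 k2' kc2 ->
  thermostat_evolution (k1 \- k2) (k1' \- k2') (fun t => kc1 t - kc2 t).
Proof.
move=> [L1 a1 i1] [L2' a2 i2]; split.
- by rewrite restrictB; exact: (@L2B R _ (measurableTypeR R)).
- by apply: (@filterS2 _ _ AF _ _ _ _ a1 a2) => t h1 h2 tT; rewrite h1// h2.
- move=> b /[dup] bT /andP[b0 bT'].
  have ii (k : R -> R) : L2 leb (k \_ (time T)) -> leb.-integrable `]0, b] (EFin \o (k \_ (time T))).
    move=> kL; apply: (@integrableS _ _ _ leb setT) => //.
    have := @L2_mul_integrable R _ (measurableTypeR R) leb _ _ kL (L2_time_indic T).
    congr integrable; apply/funext => r /=; congr EFin; rewrite patchE indicE.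
    by case: ifPn => _; rewrite ?mulr1 ?mul0r.
  rewrite (_ : \int[leb]_(r in _) _ = \int[leb]_(r in `]0, b])
      ((k1' \_ (time T)) r - (k2' \_ (time T)) r)); last first.
    by apply: eq_Rintegral => r _; rewrite restrictB.
  by rewrite RintegralB//; [rewrite -i1// -i2//; ring|exact: ii..].
Qed.

End thermostat_evolution.

(** * The coupled energy and its growth *)

Section system_evolution.
Set Implicit Arguments.
Unset Strict Implicit.
Context {R : realType} {d J : nat}.
Notation mu := (@lebesgue_rV R d).
Notation leb := (@lebesgue_measure R).
Variables (T D : R) (Omega : set 'rV[R]_d).
Hypothesis T0 : 0 < T.
Hypothesis D0 : 0 <= D.
Let AF := ae_filter_ringOfSetsType leb.
Variables (y : R -> 'rV[R]_d -> R) (Dy : 'I_d -> R -> 'rV[R]_d -> R)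
  (F : R -> ('rV[R]_d -> R) -> R) (Fo z : R -> 'rV[R]_d -> R)
  (k k' kc : 'I_J -> R -> R).
Hypothesis he : heat_evolution T D Omega y Dy F Fo z.
Hypothesis te : forall j, thermostat_evolution T (k j) (k' j) (kc j).

Definition sqr_slice (g : R -> 'rV[R]_d -> R) (t : measurableTypeR R) : R :=
  ip mu (zext T Omega g t) (zext T Omega g t).

(** The integrand on the right of the sum of the energy inequality for y and of the estimates for
    the kappa_j, whose Cauchy-Schwarz factor is 2 T. *)
Definition energy_rate (t : measurableTypeR R) : R :=
  sqr_slice Fo t + sqr_slice y t + 2 * T * \sum_j k' j t ^+ 2.

Lemma integrable_sqr_slice g b : L2QT T Omega g ->
  leb.-integrable (time b) (EFin \o sqr_slice g).
Proof.
move=> gL; have [i _] := L2QT_ip gL.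
by apply: integrableS i => //; exact: measurable_time.
Qed.

Lemma integrable_L2_sqr (g : R -> R) b : b <= T -> L2 leb (g \_ (time T)) ->
  leb.-integrable (time b) (EFin \o (fun t => g t ^+ 2)).
Proof.
move=> bT [_ gL]; have mT := measurable_time T.
apply: (@integrableS _ _ _ leb (time T)) => //; first exact: measurable_time.
  by move=> t; rewrite /time/= !in_itv/= => /andP[-> h]; exact: lt_le_trans bT.
apply/(@integrable_patch R _ (measurableTypeR R) leb _ _ mT).
move: gL; congr integrable; apply/funext => t /=; congr EFin; rewrite !patchE.
by case: ifPn => // _; rewrite expr0n.
Qed.

Lemma integrable_energy_rate b : b <= T -> leb.-integrable (time b) (EFin \o energy_rate).
Proof.
move=> bT; have mb := measurable_time b.
apply: (@integrable_EFinD R _ (measurableTypeR R)) => //.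
  by apply: (@integrable_EFinD R _ (measurableTypeR R)) => //;
    apply: integrable_sqr_slice; [exact: he_Fo he|exact: he_y he].
apply: (@integrable_EFinZ R _ (measurableTypeR R)) => //.
apply: (@integrable_EFin_sum R _ (measurableTypeR R)) => // j.
by apply: integrable_L2_sqr => //; exact: te_k' (te j).
Qed.

Lemma energy_rate_ge0 t : 0 <= energy_rate t.
Proof.
apply: addr_ge0; first by apply: addr_ge0; exact: ip_ge0.
apply: mulr_ge0; first by rewrite mulr_ge0 ?(ltW T0).
by apply: sumr_ge0 => j _; exact: sqr_ge0.
Qed.

Lemma integral_energy_rate b : b <= T ->
  \int[leb]_(t in time b) energy_rate t =
  \int[leb]_(t in time b) sqr_slice Fo t + \int[leb]_(t in time b) sqr_slice y t +
  2 * T * \sum_j \int[leb]_(t in time b) (k' j t ^+ 2).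
Proof.
move=> bT; have mb := measurable_time b.
have i1 := integrable_sqr_slice b (he_Fo he); have i2 := integrable_sqr_slice b (he_y he).
have i3 j := integrable_L2_sqr bT (te_k' (te j)).
have i4 : leb.-integrable (time b) (EFin \o (fun t => \sum_j k' j t ^+ 2)).
  exact: (@integrable_EFin_sum R _ (measurableTypeR R)).
rewrite /energy_rate RintegralD//; last 2 first.
- exact: (@integrable_EFinD R _ (measurableTypeR R)).
- exact: (@integrable_EFinZ R _ (measurableTypeR R)).
rewrite RintegralD// RintegralZl//; congr (_ + 2 * T * _).
exact: (@Rintegral_sum R _ (measurableTypeR R)).
Qed.

(** It is formed with the continuous representatives, so that it has a meaning at every time and in
    particular at 0. *)
Definition state_sqr (t : R) : R := ip mu (z t) (z t) + \sum_j kc j t ^+ 2.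

Lemma state_sqr_le b : 0 < b <= T ->
  state_sqr b <= 2 * state_sqr 0 + \int[leb]_(t in time b) energy_rate t.
Proof.
move=> /[dup] bT /andP[b0 bT'].
have H1 := heat_energy D0 bT he.
have H2 : \sum_j kc j b ^+ 2 <=
    2 * (\sum_j kc j 0 ^+ 2) + 2 * T * \sum_j \int[leb]_(t in time b) (k' j t ^+ 2).
  rewrite !mulr_sumr -big_split/=; apply: ler_sum => j _; exact: thermostat_energy.
have H3 : 0 <= 2 * D * (\sum_i \int[leb]_(t in time b) ip mu (zext T Omega (Dy i) t) (zext T Omega (Dy i) t)).
  rewrite mulr_ge0 ?mulr_ge0// sumr_ge0// => i _.
  by apply: Rintegral_ge0 => t _; exact: ip_ge0.
rewrite integral_energy_rate// /state_sqr.
have := ip_ge0 mu (z 0); move: H1 H2 H3; rewrite -!/(sqr_slice _ _).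
rewrite -[\int[leb]_(t in time b) ip mu (zext T Omega Fo t) _]/(\int[leb]_(t in time b) sqr_slice Fo t).
rewrite -[\int[leb]_(t in time b) ip mu (zext T Omega y t) _]/(\int[leb]_(t in time b) sqr_slice y t).
move: (ip _ _ _) (ip _ _ _) (\sum_j _) (\sum_j _) (2 * T * _) (2 * D * _) (\int[leb]_(t in time b) _) (\int[leb]_(t in time b) _).
move=> *; lra.
Qed.

Lemma state_sqr_ge0 t : 0 <= state_sqr t.
Proof. by rewrite addr_ge0 ?ip_ge0// sumr_ge0// => j _; exact: sqr_ge0. Qed.

Lemma state_sqrE : {ae leb, forall t, time T t ->
  state_sqr t = sqr_slice y t + \sum_j k j t ^+ 2}.
Proof.
have H : {ae leb, forall t, forall j, time T t -> kc j t = k j t}.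
  by apply: (@filter_forall _ _ _ _ AF) => j; exact: te_kc (te j).
apply: (@filterS2 _ _ AF _ _ _ _ (he_zy he) H) => t h1 h2 tT.
rewrite /state_sqr; congr (_ + _); last by apply: eq_bigr => j _; rewrite h2.
by apply: eq_ip_ae; exact: h1.
Qed.

(** The first conclusion is Gronwall's; the second inserts it back into the rate. The integrated
    rate is what later controls the gradient and the time derivatives. *)
Lemma state_sqr_bound (p : R -> R) (B : R) : 0 < B -> (forall t, 0 <= p t) ->
  leb.-integrable (time T) (EFin \o p) ->
  {ae leb, forall t, time T t ->
    energy_rate t <= p t + B * (sqr_slice y t + \sum_j k j t ^+ 2)} ->
  let M := 2 * (2 * state_sqr 0 + \int[leb]_(t in time T) p t) * expR (2 * B * T) in
  {ae leb, forall t, time T t -> sqr_slice y t + \sum_j k j t ^+ 2 <= M} /\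
  \int[leb]_(t in time T) energy_rate t <= \int[leb]_(t in time T) p t + B * T * M.
Proof.
move=> B0 p0 pi' rle M; have mT := measurable_time T.
have rle' : {ae leb, forall t, time T t -> energy_rate t <= p t + B * state_sqr t}.
  by apply: (@filterS2 _ _ AF _ _ _ _ rle state_sqrE) => t h1 h2 tT; rewrite h2// h1.
have ri := integrable_energy_rate (lexx T).
have S0 := state_sqr_ge0 0.
have zM b : 0 <= b <= T -> state_sqr b <= M.
  (* The a priori bound demanded by Gronwall's lemma is the energy estimate itself, with the rate
     integrated over all of ]0, T[. *)
  apply: (gronwall (M := 2 * state_sqr 0 + \int[leb]_(t in time T) energy_rate t) B0 _ _ p0 ri pi' rle').
  - by rewrite mulr_ge0.
  - move=> t /andP[t0 tT]; rewrite state_sqr_ge0/=.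
    have I0 : 0 <= \int[leb]_(t in time T) energy_rate t.
      by apply: Rintegral_ge0 => r _; exact: energy_rate_ge0.
    have [->|tn0] := eqVneq t 0; first by lra.
    have tT' : 0 < t <= T by rewrite tT lt_neqAle eq_sym tn0 t0.
    rewrite (le_trans (state_sqr_le tT'))// lerD2l; apply: Rintegral_subset_le => //.
    + exact: measurable_time.
    + by move=> r; rewrite /time/= !in_itv/= => /andP[-> h]; exact: lt_le_trans tT.
    + exact: energy_rate_ge0.
  - by lra.
  - exact: state_sqr_le.
have tT' t : time T t -> 0 <= t <= T.
  by rewrite /time/= in_itv/= => /andP[h1 h2]; rewrite !ltW.
split.
  apply: (@filterS _ _ AF) state_sqrE => t h tT.
  by rewrite -h//; apply: zM; exact: tT'.
have oi : leb.-integrable (time T) (EFin \o cst (B * M)).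
  apply/integrableP; split; first by apply/measurable_EFinP; exact: measurable_cst.
  rewrite (_ : (fun t => _) = cst `|B * M|%:E)// integral_cst//.
  by rewrite lte_mul_pinfty ?time_fin.
rewrite (_ : B * T * M = \int[leb]_(t in time T) (B * M)); last first.
  rewrite Rintegral_cst//= /time lebesgue_measure_itv/= lte_fin T0/= subr0; ring.
rewrite -RintegralD// [leLHS]Rintegral_mkcond [leRHS]Rintegral_mkcond.
apply: (@le_Rintegral_ae R _ (measurableTypeR R)).
- exact/(@integrable_patch R _ (measurableTypeR R) leb _ _ mT).
- apply/(@integrable_patch R _ (measurableTypeR R) leb _ _ mT).
  exact: (@integrable_EFinD R _ (measurableTypeR R)).
- apply: (@filterS _ _ AF) rle' => t h; rewrite !patchE; case: ifPn => // /set_mem tT.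
  by rewrite (le_trans (h tT))// lerD2l ler_wpM2l ?(ltW B0)// zM// tT'.
Qed.

End system_evolution.

(** * Differences of the right-hand sides at a fixed time *)

Section difference_estimates.
Set Implicit Arguments.
Unset Strict Implicit.
Context {R : realType} {dX : measure_display} {X : measurableType dX}.
Variable mu : {measure set X -> \bar R}.

Lemma ler_sum_mul n (a b : 'I_n -> R) : (forall i, 0 <= a i) -> (forall i, 0 <= b i) ->
  \sum_i a i * b i <= (\sum_i a i) * \sum_i b i.
Proof.
move=> a0 b0; rewrite mulr_suml; apply: ler_sum => i _; rewrite ler_wpM2l//.
by rewrite (bigD1 i)//= lerDl sumr_ge0.
Qed.

(** The coupling splits as (k1 - k2) G1 + k2 (G1 - G2): the controls bound the first part, the
    second state the other. With the difference of the f terms there are three summands, whence the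
    3; the common term [o] cancels. *)
Lemma force_sqrB_le J (f : R -> R) (L c E : R) (o Y1 Y2 dY dF : X -> R) (k1 k2 : 'I_J -> R)
    (G1 G2 : 'I_J -> X -> R) :
  (forall x y, `|f x - f y| <= L * `|x - y|) -> L2 mu Y1 -> L2 mu Y2 ->
  (forall j, L2 mu (G1 j)) -> (forall j, L2 mu (G2 j)) ->
  \sum_j ip mu (G1 j) (G1 j) <= c ->
  \sum_j ip mu (fun x => G1 j x - G2 j x) (fun x => G1 j x - G2 j x) <= E ->
  (forall x, dY x = Y1 x - Y2 x) ->
  (forall x, dF x = (f (Y1 x) - f 0 + o x + \sum_j k1 j * G1 j x) -
                    (f (Y2 x) - f 0 + o x + \sum_j k2 j * G2 j x)) ->
  ip mu dF dF <= 3 * (L ^+ 2 * ip mu dY dY + c * \sum_j (k1 j - k2 j) ^+ 2 +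
    (\sum_j k2 j ^+ 2) * E).
Proof.
move=> fL Y1L Y2L G1L G2L Gc GE /funext -> /funext dFE.
have [dfL dfle] := lipschitz_comp_L2 fL Y1L Y2L.
have dGL j := L2B (G1L j) (G2L j).
have aL := L2_sum (index_enum 'I_J) (fun j => L2Z (k1 j - k2 j) (G1L j)).
have bL := L2_sum (index_enum 'I_J) (fun j => L2Z (k2 j) (dGL j)).
have -> : dF = (fun x => f (Y1 x) - f (Y2 x) + \sum_j (k1 j - k2 j) * G1 j x +
    \sum_j k2 j * (G1 j x - G2 j x)).
  rewrite dFE; apply/funext => x; rewrite -[RHS]addrA -big_split/=.
  have -> : \sum_j ((k1 j - k2 j) * G1 j x + k2 j * (G1 j x - G2 j x)) =
      \sum_j k1 j * G1 j x - \sum_j k2 j * G2 j x.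
    by rewrite -sumrB; apply: eq_bigr => j _; ring.
  ring.
apply: le_trans (ip_sqrD3_le dfL aL bL) _; rewrite ler_wpM2l//.
apply: lerD; [apply: lerD => //|].
- rewrite mulrC (le_trans (ip_sum_sqr_le _ G1L))// ler_wpM2l// sumr_ge0// => j _.
  exact: sqr_ge0.
- rewrite (le_trans (ip_sum_sqr_le _ dGL))// ler_wpM2l// sumr_ge0// => j _.
  exact: sqr_ge0.
Qed.

(** The same splitting is used twice, for alpha times w and inside w for the inner product with h.
    The second state enters through N alone, so taking it to be the zero state covers a single
    solution. *)
Lemma feedback_sqrB_le J K (w : 'I_K -> R -> R) (Lw : 'I_K -> R) (c E N : R)
    (H1 H2 : 'I_K -> X -> R) (V1 V2 dV : X -> R) (a1 a2 : 'M[R]_(J, K)) :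
  (forall k x y, `|w k x - w k y| <= Lw k * `|x - y|) ->
  (forall k, L2 mu (H1 k)) -> (forall k, L2 mu (H2 k)) -> L2 mu V1 -> L2 mu V2 ->
  \sum_k ip mu (H1 k) (H1 k) <= c -> \sum_k ip mu (H2 k) (H2 k) <= c ->
  \sum_j \sum_k a1 j k ^+ 2 <= c ->
  \sum_k ip mu (fun x => H1 k x - H2 k x) (fun x => H1 k x - H2 k x) <= E ->
  \sum_j \sum_k (a1 j k - a2 j k) ^+ 2 <= E ->
  ip mu V2 V2 <= N ->
  (forall x, dV x = V1 x - V2 x) ->
  \sum_j (\sum_k a1 j k * w k (ip mu (H1 k) V1) - \sum_k a2 j k * w k (ip mu (H2 k) V2)) ^+ 2 <=
  4 * c ^+ 2 * (\sum_k Lw k ^+ 2) * ip mu dV dV +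
  E * (4 * (\sum_k w k 0 ^+ 2) + 8 * c * (\sum_k Lw k ^+ 2) * N).
Proof.
move=> wL H1L H2L V1L V2L H1c H2c a1c HE aE VN /funext dVE.
have dVL : L2 mu dV by rewrite dVE; exact: L2B.
 have dHL k := L2B (H1L k) (H2L k).
set Lam := \sum_k Lw k ^+ 2; set n := ip mu dV dV.
have Lam0 : 0 <= Lam by apply: sumr_ge0 => k _; exact: sqr_ge0.
have n0 : 0 <= n := ip_ge0 _ _.
have N0 : 0 <= N := le_trans (ip_ge0 mu V2) VN.
have E0 : 0 <= E by apply: le_trans HE; apply: sumr_ge0 => k _; exact: ip_ge0.
have c0 : 0 <= c by apply: le_trans H1c; apply: sumr_ge0 => k _; exact: ip_ge0.
(* In the end [P] is multiplied by 2 c and [Q] by 2 E; each contributes 4 c E N to the coefficient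
   of [Lam], whence the 8. *)
pose P := \sum_k (w k (ip mu (H1 k) V1) - w k (ip mu (H2 k) V2)) ^+ 2.
pose Q := \sum_k w k (ip mu (H2 k) V2) ^+ 2.
have PQ j : (\sum_k a1 j k * w k (ip mu (H1 k) V1) - \sum_k a2 j k * w k (ip mu (H2 k) V2)) ^+ 2 <=
    2 * (\sum_k a1 j k ^+ 2) * P + 2 * (\sum_k (a1 j k - a2 j k) ^+ 2) * Q.
  have -> : \sum_k a1 j k * w k (ip mu (H1 k) V1) - \sum_k a2 j k * w k (ip mu (H2 k) V2) =
      \sum_k a1 j k * (w k (ip mu (H1 k) V1) - w k (ip mu (H2 k) V2)) +
      \sum_k (a1 j k - a2 j k) * w k (ip mu (H2 k) V2).
    by rewrite -sumrB -big_split/=; apply: eq_bigr => k _; ring.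
  have := @sumr_cauchy_schwarz R K (fun k => a1 j k) (fun k => w k (ip mu (H1 k) V1) - w k (ip mu (H2 k) V2)).
  have := @sumr_cauchy_schwarz R K (fun k => a1 j k - a2 j k) (fun k => w k (ip mu (H2 k) V2)).
  rewrite -/P -/Q -![2 * _ * _]mulrA => h2 h1.
  apply: le_trans (_ : _ <= 2 * (\sum_k a1 j k * (w k (ip mu (H1 k) V1) - w k (ip mu (H2 k) V2))) ^+ 2 +
    2 * (\sum_k (a1 j k - a2 j k) * w k (ip mu (H2 k) V2)) ^+ 2) _; last first.
    by apply: lerD; rewrite ler_wpM2l.
  move: (\sum_k _ * (_ - _)) (\sum_k (_ - _) * _) => r1 r2.
  by have := sqr_ge0 (r1 - r2); clear; nra.
have Ple : P <= Lam * (2 * c * n + 2 * E * N).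
  have Pk k : (w k (ip mu (H1 k) V1) - w k (ip mu (H2 k) V2)) ^+ 2 <=
      Lw k ^+ 2 * (2 * n * ip mu (H1 k) (H1 k) +
      2 * N * ip mu (fun x => H1 k x - H2 k x) (fun x => H1 k x - H2 k x)).
    rewrite (le_trans (lipschitz_sqr_dist (wL k) _ _))// ler_wpM2l ?sqr_ge0//.
    have -> : ip mu (H1 k) V1 - ip mu (H2 k) V2 =
        ip mu (H1 k) dV + ip mu (fun x => H1 k x - H2 k x) V2.
      by rewrite dVE ipBr// ipBl//; ring.
    have := ip_cauchy_schwarz (H1L k) dVL; have := ip_cauchy_schwarz (dHL k) V2L.
    rewrite -/n; have := ler_wpM2l (ip_ge0 mu (fun x => H1 k x - H2 k x)) VN.
    move: (ip mu _ _) (ip mu _ _) (ip mu _ _) (ip mu _ _) (ip mu V2 V2) => r1 r2 r3 r4 r5.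
    by have := sqr_ge0 (r1 - r4); have := sqr_ge0 (r2 - r3); have := sqr_ge0 (r1 - r3); have := sqr_ge0 (r2 - r4); nra.
  rewrite (le_trans (ler_sum _ (fun k _ => Pk k)))//.
  apply: le_trans (ler_sum_mul _ _) _ => [k|k|]; first exact: sqr_ge0.
    by rewrite addr_ge0// !mulr_ge0// ip_ge0.
  rewrite ler_wpM2l// big_split/= -!mulr_sumr; apply: lerD.
    by rewrite -mulrA [2 * c * n]mulrAC -mulrA !ler_wpM2l.
  by rewrite [2 * E * N]mulrAC !ler_wpM2l// mulr_ge0.
have Qle : Q <= 2 * (\sum_k w k 0 ^+ 2) + 2 * Lam * (c * N).
  have Qk k : w k (ip mu (H2 k) V2) ^+ 2 <= 2 * w k 0 ^+ 2 + 2 * (Lw k ^+ 2 * (ip mu (H2 k) (H2 k) * N)).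
    have h1 := lipschitz_sqr_dist (wL k) (ip mu (H2 k) V2) 0.
    have h2 : Lw k ^+ 2 * (ip mu (H2 k) V2 - 0) ^+ 2 <= Lw k ^+ 2 * (ip mu (H2 k) (H2 k) * N).
      rewrite ler_wpM2l ?sqr_ge0// subr0 (le_trans (ip_cauchy_schwarz (H2L k) V2L))//.
      by rewrite ler_wpM2l// ip_ge0.
    move: (le_trans h1 h2); move: (w k _) (w k 0) (Lw k ^+ 2 * _) => r1 r2 r3.
    by have := sqr_ge0 (r1 - 2 * r2); nra.
  rewrite (le_trans (ler_sum _ (fun k _ => Qk k)))// big_split/= -!mulr_sumr lerD2l.
  rewrite -mulrA ler_wpM2l//.
  apply: le_trans (ler_sum_mul _ _) _ => [k|k|]; first exact: sqr_ge0.
    by rewrite mulr_ge0// ip_ge0.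
  by rewrite ler_wpM2l// -mulr_suml ler_wpM2r.
rewrite (le_trans (ler_sum _ (fun j _ => PQ j)))// big_split/= -!mulr_suml -!mulr_sumr.
have P0 : 0 <= P by apply: sumr_ge0 => k _; exact: sqr_ge0.
have Q0 : 0 <= Q by apply: sumr_ge0 => k _; exact: sqr_ge0.
have A1 := ler_wpM2r P0 a1c; have A2 := ler_wpM2r Q0 aE.
have A3 := ler_wpM2l c0 Ple; have A4 := ler_wpM2l E0 Qle.
clear -A1 A2 A3 A4; clearbody P Q Lam n.
move: A1 A2 A3 A4; move: (\sum_j _) (\sum_j _) (\sum_k _) => r1 r2 r3 A1 A2 A3 A4.
by rewrite -!mulrA; lra.
Qed.

End difference_estimates.

(** * From weak solutions to the integrated equations *)

Section weak_solution_evolution.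
Set Implicit Arguments.
Unset Strict Implicit.
Context {R : realType} {d J K : nat}.
Notation mu := (@lebesgue_rV R d).
Notation leb := (@lebesgue_measure R).
Variables (T D : R) (Omega : set 'rV[R]_d) (beta : 'I_J -> R) (f : R -> R) (L : R)
  (w : 'I_K -> R -> R) (Lw : 'I_K -> R) (ys : R -> 'rV[R]_d -> R).
Hypothesis mO : measurable Omega.
Hypothesis Ofin : (mu Omega < +oo)%E.
Hypothesis fL : forall x y, `|f x - f y| <= L * `|x - y|.
Hypothesis wL : forall k x y, `|w k x - w k y| <= Lw k * `|x - y|.
Hypothesis ysL : L2QT T Omega ys.
Let AF := ae_filter_ringOfSetsType leb.

Lemma Lp_oo_L2_time (k : R -> R) : Lp leb +oo%E (time T) k -> L2 leb (k \_ (time T)).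
Proof.
rewrite /Lp inE => /andP[]; rewrite !inE /= => mk; rewrite /finite_norm => kM.
set N := 'N[_]_+oo[_]%E in kM.
have N0 : (0 <= N)%E by exact: Lnorm_ge0.
have NE : (N = (fine N)%:E)%E by rewrite fineK// ge0_fin_numE.
have [_ oi] := L2_time_indic T.
apply: (@L2_le_ae R _ (measurableTypeR R) leb _ (fun t => fine N ^+ 2 * \1_(time T) t ^+ 2)) => //.
  exact: (@integrable_EFinZ R _ (measurableTypeR R)).
apply: (@filterS _ _ AF) (Lnorm_oo_ge (EFin \o k \_ (time T))) => t.
rewrite -/N NE /= lee_fin patchE indicE; case: ifPn => [tT h|tT _].
  rewrite expr1n mulr1 -[leLHS]real_normK ?num_real// lerXn2r ?nnegrE//.
  exact: le_trans h.
by rewrite expr0n mulr0.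
Qed.

Lemma thermostat_WE (u : control R d J K) j y t : time T t ->
  thermostat_W Omega w ys u j y t = \sum_k ctrl_alpha u j k *
    w k (ip mu (ctrl_h u k \_ Omega) (fun x => zext T Omega y t x - zext T Omega ys t x)).
Proof.
move=> tT; apply: eq_bigr => k _; congr (_ * w k _).
rewrite ip_restrictl; apply: eq_Rintegral => x xO.
by rewrite !zext_in// !patchE xO.
Qed.

Lemma weak_solution_evolution (u : control R d J K) (a : initial R d J) (s : state R d J) :
  in_U Omega u -> weak_solution T Omega D beta f w ys u a s ->
  exists z kc,
  [/\ heat_evolution T D Omega (st_y s) (st_grad s) (st_y' s)
        (force f (ctrl_g u) (st_y s) (st_kappa s)) z,
      forall j, thermostat_evolution T (st_kappa s j) (st_kappa' s j) (kc j),
      {ae mu, forall x, z 0 x = (init_y a \_ Omega) x},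
      forall j, kc j 0 = init_kappa a j &
      {ae leb, forall t, time T t -> forall j,
        beta j * st_kappa' s j t = thermostat_W Omega w ys u j (st_y s) t - st_kappa s j t}].
Proof.
move=> uU [[yoo gr [y'L dy] kL] y0 k0 heq teq].
have mT := measurable_time T.
have yL := LpL2_oo_L2QT yoo.
have kL2 j : L2 leb (st_kappa s j \_ (time T)) by apply: Lp_oo_L2_time; case: (kL j).
have k'L2 j : L2 leb (st_kappa' s j \_ (time T)).
  by apply/(@Lp_L2 R _ (measurableTypeR R)); case: (kL j).
have FL := L2QT_force mO Ofin fL uU.1 yL kL2.
have [z [hez z0]] := heat_evolution_of_solution mO Ofin yL FL gr y'L dy y0 heq.
have [kc kcP] := choice k0.
exists z, kc; split => //.
- move=> j; have [ckc kck kc0] := kcP j; have [_ _ sd] := kL j.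
  split => // b /andP[b0 bT].
  apply: (@du_bois_reymond R T _ _ _ sd ckc kck) => //.
  apply/(@integrable_patch R _ (measurableTypeR R) leb _ _ mT).
  have := @L2_mul_integrable R _ (measurableTypeR R) leb _ _ (k'L2 j) (L2_time_indic T).
  congr integrable; apply/funext => r /=; congr EFin; rewrite !patchE indicE.
  by case: ifPn => _; rewrite ?mulr1 ?mul0r.
- by move=> j; have [] := kcP j.
- have WL j := L2_thermostat_W j wL uU yL ysL.
  have H : {ae leb, forall t, forall j, time T t ->
      beta j * st_kappa' s j t = thermostat_W Omega w ys u j (st_y s) t - st_kappa s j t}.
    apply: (@filter_forall _ _ _ _ AF) => j.
    pose r t := beta j * st_kappa' s j t + st_kappa s j t - thermostat_W Omega w ys u j (st_y s) t.
    have rL : L2 leb (r \_ (time T)).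
      have := @L2B R _ (measurableTypeR R) leb _ _
        (@L2D R _ (measurableTypeR R) leb _ _ (@L2Z R _ (measurableTypeR R) leb (beta j) _ (k'L2 j)) (kL2 j)) (WL j).
      congr L2; apply/funext => t; rewrite /r !patchE; case: ifPn => // _.
      by rewrite (_ : (point : R) = 0)// mulr0 addr0 subr0.
    have rLp : Lp leb 2%:E (time T) r by apply/(@Lp_L2 R _ (measurableTypeR R)).
    (* The residual [r] is square integrable, hence an admissible test function for itself: the
       integral of its square is 0. *)
    have := teq j r rLp; rewrite -/(r _).
    rewrite -(@ip_restrict R _ (measurableTypeR R) leb) => /(@ip_eq0_ae R _ (measurableTypeR R) leb _ rL).
    apply: (@filterS _ _ AF) => t; rewrite patchE => + tT; rewrite mem_set// /r => h.
    by apply/eqP; rewrite -subr_eq0 opprB addrA; apply/eqP.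
  by apply: (@filterS _ _ AF) H => t h tT j; exact: h.
Qed.

End weak_solution_evolution.

(** * The norms of controls and initial data as square roots *)

Section norms.
Set Implicit Arguments.
Unset Strict Implicit.
Context {R : realType} {d J K : nat}.
Notation mu := (@lebesgue_rV R d).
Variable Omega : set 'rV[R]_d.

Definition ctrl_sqr (u : control R d J K) : R :=
  \sum_j ip mu (ctrl_g u j \_ Omega) (ctrl_g u j \_ Omega) +
  \sum_k ip mu (ctrl_h u k \_ Omega) (ctrl_h u k \_ Omega) +
  \sum_j \sum_k ctrl_alpha u j k ^+ 2.

Definition init_sqr (a : initial R d J) : R :=
  ip mu (init_y a \_ Omega) (init_y a \_ Omega) + \sum_j init_kappa a j ^+ 2.

Lemma ctrl_sqr_le (u : control R d J K) (E : R) : ctrl_sqr u <= E ->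
  [/\ \sum_j ip mu (ctrl_g u j \_ Omega) (ctrl_g u j \_ Omega) <= E,
      \sum_k ip mu (ctrl_h u k \_ Omega) (ctrl_h u k \_ Omega) <= E &
      \sum_j \sum_k ctrl_alpha u j k ^+ 2 <= E].
Proof.
have g0 : 0 <= \sum_j ip mu (ctrl_g u j \_ Omega) (ctrl_g u j \_ Omega).
  by apply: sumr_ge0 => j _; exact: ip_ge0.
have h0 : 0 <= \sum_k ip mu (ctrl_h u k \_ Omega) (ctrl_h u k \_ Omega).
  by apply: sumr_ge0 => j _; exact: ip_ge0.
have a0 : 0 <= \sum_j \sum_k ctrl_alpha u j k ^+ 2.
  by apply: sumr_ge0 => j _; apply: sumr_ge0 => k _; exact: sqr_ge0.
by rewrite /ctrl_sqr => uE; split; lra.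
Qed.

Lemma U_normE (u : control R d J K) : in_U Omega u ->
  U_norm Omega u = (Num.sqrt (ctrl_sqr u))%:E.
Proof.
move=> [gL hL]; rewrite -poweR2V_EFin; last first.
  rewrite !addr_ge0//; do ?by apply: sumr_ge0 => j _; exact: ip_ge0.
  by apply: sumr_ge0 => j _; apply: sumr_ge0 => k _; exact: sqr_ge0.
rewrite /U_norm /ctrl_sqr !EFinD -!sumEFin; congr poweR; congr (_ + _ + _)%E.
- by apply: eq_bigr => j _; rewrite Lp_norm_sqr//; exact/Lp_L2.
- by apply: eq_bigr => j _; rewrite Lp_norm_sqr//; exact/Lp_L2.
- by apply: eq_bigr => j _; rewrite sumEFin.
Qed.

Lemma X0_normE (a : initial R d J) : in_X0 Omega a ->
  X0_norm Omega a = (Num.sqrt (init_sqr a))%:E.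
Proof.
move=> /Lp_L2 aL; rewrite -poweR2V_EFin; last first.
  by rewrite addr_ge0 ?ip_ge0// sumr_ge0// => j _; exact: sqr_ge0.
by rewrite /X0_norm Lp_norm_sqr// sumEFin -EFinD.
Qed.

Lemma sqrt_le_sqr (x r : R) : 0 <= x -> 0 <= r -> ((Num.sqrt x)%:E <= r%:E)%E -> x <= r ^+ 2.
Proof.
move=> x0 r0; rewrite lee_fin => h; rewrite -(sqr_sqrtr x0) lerXn2r// nnegrE.
exact: sqrtr_ge0.
Qed.

Lemma in_U_sub (u1 u2 : control R d J K) : in_U Omega u1 -> in_U Omega u2 ->
  in_U Omega (control_sub u1 u2).
Proof.
move=> [g1 h1] [g2 h2]; split=> i; apply/Lp_L2; rewrite restrictB; apply: L2B; exact/Lp_L2.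
Qed.

Lemma in_X0_sub (a1 a2 : initial R d J) : in_X0 Omega a1 -> in_X0 Omega a2 ->
  in_X0 Omega (initial_sub a1 a2).
Proof. by move=> A1 A2; apply/Lp_L2; rewrite restrictB; apply: L2B; exact/Lp_L2. Qed.

Lemma ctrl_sqr_ge0 (u : control R d J K) : 0 <= ctrl_sqr u.
Proof.
rewrite !addr_ge0//; do ?by apply: sumr_ge0 => j _; exact: ip_ge0.
by apply: sumr_ge0 => j _; apply: sumr_ge0 => k _; exact: sqr_ge0.
Qed.

Lemma init_sqr_ge0 (a : initial R d J) : 0 <= init_sqr a.
Proof. by rewrite addr_ge0 ?ip_ge0// sumr_ge0// => j _; exact: sqr_ge0. Qed.

End norms.

(** * The constants of the two Gronwall arguments *)

Section constants.
Context {R : realType} {J K : nat}.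
Variables (T vol L f0 : R) (Lw w0 : 'I_K -> R) (RU R0 ny D : R) (beta : 'I_J -> R).

(* [cst_state] bounds |y|^2 + sum_j kappa_j^2 for a single solution. For the difference
   of two solutions, [cst_sup] bounds the same quantity and [cst_rates] the time integral
   of [energy_rate], both relative to the squared distance of the data. *)
Definition cst_Lam := \sum_k Lw k ^+ 2.
Definition cst_w := \sum_k w0 k ^+ 2.
Definition cst_beta := \sum_j (beta j)^-1 ^+ 2.
(** The Gronwall coefficient of both comparisons. The 6 is 2 times the 3 of [force_sqrB_le], the 2
    being spent on separating f(0); the 1 stands for |y|^2 in [energy_rate]; the rest is 2 T times
    the bound on the kappa_j'. *)
Definition cst_rate :=
  6 * L ^+ 2 + 6 * RU ^+ 2 + 1 + 4 * T * cst_beta * (4 * (RU ^+ 2) ^+ 2 * cst_Lam + 1).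
Definition cst_a1 := 2 * f0 ^+ 2 * vol + 16 * T * cst_beta * RU ^+ 2 * cst_w.
Definition cst_b1 := 32 * T * cst_beta * (RU ^+ 2) ^+ 2 * cst_Lam.
Definition cst_state :=
  2 * (2 * R0 ^+ 2 + (cst_a1 * T + cst_b1 * ny ^+ 2)) * expR (2 * cst_rate * T).
(** Together with [cst_b2], a source per unit of squared distance of the data; the target enters
    with the weight [cst_b2]. *)
Definition cst_a2 := 3 * cst_state +
  4 * T * cst_beta * (4 * cst_w + 16 * RU ^+ 2 * cst_Lam * cst_state).
Definition cst_b2 := 64 * T * cst_beta * RU ^+ 2 * cst_Lam.
Definition cst_source := cst_a2 * T + cst_b2 * ny ^+ 2.
Definition cst_sup := 2 * (2 + cst_source) * expR (2 * cst_rate * T).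
Definition cst_rates := 1 + (cst_source + cst_rate * T * cst_sup).

Lemma cst_Lam_ge0 : 0 <= cst_Lam. Proof. by apply: sumr_ge0 => k _; exact: sqr_ge0. Qed.
Lemma cst_w_ge0 : 0 <= cst_w. Proof. by apply: sumr_ge0 => k _; exact: sqr_ge0. Qed.
Lemma cst_beta_ge0 : 0 <= cst_beta. Proof. by apply: sumr_ge0 => k _; exact: sqr_ge0. Qed.

Hypothesis T0 : 0 < T.
Hypothesis vol0 : 0 <= vol.

Ltac nonneg := repeat first [exact: sqr_ge0 | exact: ltW T0 | exact: vol0
  | exact: expR_ge0 | exact: cst_Lam_ge0 | exact: cst_w_ge0 | exact: cst_beta_ge0
  | exact: ler0n | assumption | apply: addr_ge0 | apply: mulr_ge0].

Lemma cst_rate_gt0 : 0 < cst_rate.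
Proof. by rewrite /cst_rate ltr_pwDl//; [apply: ltr_wpDl => //|]; nonneg. Qed.

Lemma cst_a1_ge0 : 0 <= cst_a1. Proof. by rewrite /cst_a1; nonneg. Qed.

Lemma cst_b1_ge0 : 0 <= cst_b1. Proof. by rewrite /cst_b1; nonneg. Qed.

Lemma cst_state_ge0 : 0 <= cst_state.
Proof.
have a1 := cst_a1_ge0; have b1 := cst_b1_ge0; rewrite /cst_state.
by move: cst_a1 cst_b1 a1 b1 => a b a0 b0; nonneg.
Qed.

Lemma cst_a2_ge0 : 0 <= cst_a2.
Proof. by have s0 := cst_state_ge0; rewrite /cst_a2; move: cst_state s0 => s s0; nonneg. Qed.

Lemma cst_b2_ge0 : 0 <= cst_b2. Proof. by rewrite /cst_b2; nonneg. Qed.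

Lemma cst_source_ge0 : 0 <= cst_source.
Proof.
have a2 := cst_a2_ge0; have b2 := cst_b2_ge0; rewrite /cst_source.
by move: cst_a2 cst_b2 a2 b2 => a b a0 b0; nonneg.
Qed.

End constants.

Lemma sum_sqr_relaxation_le {R : realType} {J : nat} (beta k' W k : 'I_J -> R) :
  (forall j, 0 < beta j) -> (forall j, beta j * k' j = W j - k j) ->
  \sum_j k' j ^+ 2 <= 2 * cst_beta beta * (\sum_j W j ^+ 2 + \sum_j k j ^+ 2).
Proof.
move=> b0 bk.
have -> : \sum_j k' j ^+ 2 = \sum_j (beta j)^-1 ^+ 2 * (W j - k j) ^+ 2.
  apply: eq_bigr => j _; rewrite -bk -exprMn mulrA mulVf ?mul1r//.
  by rewrite gt_eqF.
apply: le_trans (ler_sum_mul _ _) _ => [j|j|]; [exact: sqr_ge0..|].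
rewrite -mulrA mulrCA ler_wpM2l//; first exact: cst_beta_ge0.
rewrite mulrDr !mulr_sumr -big_split/=; apply: ler_sum => j _.
by have := sqr_ge0 (W j + k j); nra.
Qed.

Lemma ip_subrr {R : realType} {dX} {X : measurableType dX} (nu : {measure set X -> \bar R})
    (v : X -> R) : ip nu (fun x => v x - v x) (fun x => v x - v x) = 0.
Proof.
rewrite /ip (@eq_Rintegral _ _ _ nu _ (fun=> 0)); first by rewrite /Rintegral integral0.
by move=> x _; rewrite subrr mul0r.
Qed.

(** * Bounds on the energy rate at a fixed time *)

Section rate_estimates.
Set Implicit Arguments.
Unset Strict Implicit.
Context {R : realType} {d J K : nat}.
Notation mu := (@lebesgue_rV R d).
Notation leb := (@lebesgue_measure R).
Variables (T vol L : R) (Omega : set 'rV[R]_d) (beta : 'I_J -> R) (f : R -> R)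
  (w : 'I_K -> R -> R) (Lw : 'I_K -> R) (ys : R -> 'rV[R]_d -> R) (RU R0 ny : R).
Hypothesis T0 : 0 < T.
Hypothesis mO : measurable Omega.
Hypothesis Ovol : mu Omega = vol%:E.
Hypothesis beta0 : forall j, 0 < beta j.
Hypothesis fL : forall x y, `|f x - f y| <= L * `|x - y|.
Hypothesis wL : forall k x y, `|w k x - w k y| <= Lw k * `|x - y|.
Local Notation w0 := (fun k => w k 0).
Local Notation c := (RU ^+ 2).

Section one_solution.
Variables (u : control R d J K) (y : R -> 'rV[R]_d -> R) (k k' : 'I_J -> R -> R) (t : R).
Hypothesis tT : time T t.
Hypothesis uU : in_U Omega u.
Hypothesis uc : ctrl_sqr Omega u <= c.
Hypothesis yL : L2 mu (zext T Omega y t).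
Hypothesis ysL : L2 mu (zext T Omega ys t).
Hypothesis FL : L2 mu (zext T Omega (force f (ctrl_g u) y k) t).
Hypothesis teq : forall j, beta j * k' j t = thermostat_W Omega w ys u j y t - k j t.

Lemma energy_rate_le :
  energy_rate T Omega y (force f (ctrl_g u) y k) k' t <=
  cst_a1 T vol (f 0) w0 RU beta + cst_b1 T Lw RU beta * sqr_slice T Omega ys t +
  cst_rate T L Lw RU beta * (sqr_slice T Omega y t + \sum_j k j t ^+ 2).
Proof.
have [gc hc ac] := ctrl_sqr_le uc.
have gL j : L2 mu (ctrl_g u j \_ Omega) by exact/Lp_L2/uU.1.
have hL j : L2 mu (ctrl_h u j \_ Omega) by exact/Lp_L2/uU.2.
have oL : L2 mu (\1_Omega) by apply: (@L2_indic R _ _ mu) => //; rewrite [X in (X < _)%E]Ovol ltry.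
pose F := zext T Omega (force f (ctrl_g u) y k) t; have FL' : L2 mu F := FL.
pose o x := f 0 * \1_Omega x; pose G j := ctrl_g u j \_ Omega; pose H i := ctrl_h u i \_ Omega.
have {}oL : L2 mu o := L2Z (f 0) oL.
(* The solution is compared with the zero state, whose right-hand side is f(0). *)
have F1 : ip mu (fun x => F x - o x) (fun x => F x - o x) <=
    3 * (L ^+ 2 * sqr_slice T Omega y t + c * \sum_j k j t ^+ 2).
  have := @force_sqrB_le _ _ _ mu _ f L c 0 o _ _ (zext T Omega y t) (fun x => F x - o x) (fun j => k j t) (fun=> 0) G G
    fL yL (L2_0 mu) gL gL gc.
  rewrite big1 => [/(_ (lexx _))|j _]; last exact: ip_subrr.
  move=> /(_ (fun x => esym (subr0 _))); rewrite mulr0 addr0.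
  rewrite (eq_bigr (fun j => k j t ^+ 2)) => [|j _]; last by rewrite subr0.
  apply => x; rewrite /F zext_force// [\sum_j 0 * _]big1 => [|j _]; last exact: mul0r.
  by rewrite /o /G; ring.
have ooE : ip mu o o = f 0 ^+ 2 * vol.
  rewrite /ip (@eq_Rintegral _ _ _ mu _ (fun x => f 0 ^+ 2 * \1_Omega x)); last first.
    by move=> x _; rewrite /o indicE; case: (_ \in _); rewrite ?mulr1 ?mulr0.
  rewrite RintegralZl//; last first.
    apply/integrableP; split; first by apply/measurable_EFinP; exact: measurable_indic.
    under eq_integral do rewrite /= ger0_norm//.
    by rewrite integral_indic// setIT [X in (X < _)%E]Ovol ltry.
  by congr (_ * _); rewrite /Rintegral integral_indic// setIT; exact: (congr1 fine Ovol).
have F2 : ip mu F F <= 2 * ip mu (fun x => F x - o x) (fun x => F x - o x) + 2 * (f 0 ^+ 2 * vol).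
  rewrite -ooE; have := ip_sqrD_le (L2B FL' oL) oL.
  by rewrite (_ : (fun x => F x - o x + o x) = F)//; apply/funext => x; rewrite subrK.
have W1 : \sum_j thermostat_W Omega w ys u j y t ^+ 2 <=
    4 * c ^+ 2 * cst_Lam Lw * sqr_slice T Omega y t +
    c * (4 * cst_w w0 + 8 * c * cst_Lam Lw * sqr_slice T Omega ys t).
  have N1 : ip mu (fun x => 0 - zext T Omega ys t x) (fun x => 0 - zext T Omega ys t x) <=
      sqr_slice T Omega ys t.
    rewrite /sqr_slice /ip le_eqVlt; apply/orP; left; apply/eqP.
    by apply: eq_Rintegral => x _; rewrite sub0r mulrNN.
  (* The zero state is given the same h and alpha = 0. Its feedback then vanishes, the distance of
     the controls is at most c, and its deviation from the target is minus the target. *)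
  have := @feedback_sqrB_le _ _ _ mu _ _ w Lw c c (sqr_slice T Omega ys t) H H _ _ (zext T Omega y t) (ctrl_alpha u) 0
    wL hL hL (L2B yL ysL) (L2B (L2_0 mu) ysL) hc hc ac.
  rewrite big1 => [/(_ (sqr_ge0 _))|j _]; last exact: ip_subrr.
  rewrite (eq_bigr (fun j => \sum_k0 ctrl_alpha u j k0 ^+ 2)) => [/(_ ac N1)|j _]; last first.
    by apply: eq_bigr => i _; rewrite mxE subr0.
  have E x : zext T Omega y t x = zext T Omega y t x - zext T Omega ys t x - (0 - zext T Omega ys t x).
    by ring.
  move=> /(_ E); congr (_ <= _); apply: eq_bigr => j _; rewrite (@thermostat_WE _ _ _ _ T)//.
  by rewrite [X in _ - X]big1 ?subr0// => i _; rewrite mxE mul0r.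
have K1 := sum_sqr_relaxation_le beta0 teq.
rewrite /energy_rate -/(sqr_slice _ _ _ _) /cst_rate /cst_a1 /cst_b1.
rewrite [sqr_slice T Omega (force _ _ _ _) t]/sqr_slice -/F.
have Tb0 : 0 <= 2 * T * (2 * cst_beta beta) by rewrite !mulr_ge0 ?cst_beta_ge0 ?(ltW T0).
have K2 := ler_wpM2l (_ : 0 <= 2 * T) K1; have {}K2 := K2 ltac:(by rewrite mulr_ge0 ?(ltW T0)).
have W2 := ler_wpM2l Tb0 W1.
have n0 : 0 <= sqr_slice T Omega y t := ip_ge0 _ _.
have k0 : 0 <= \sum_j k j t ^+ 2 by apply: sumr_ge0 => j _; exact: sqr_ge0.
(* These nonnegative cross terms are given away by using the single coefficient [cst_rate] for |y|^2
   and for the sum of the kappa_j^2. *)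
have L0 : 0 <= L ^+ 2 * (\sum_j k j t ^+ 2) by rewrite mulr_ge0 ?sqr_ge0.
have C0 : 0 <= c * sqr_slice T Omega y t by rewrite mulr_ge0 ?sqr_ge0.
have B1 : 0 <= T * cst_beta beta * sqr_slice T Omega y t.
  by rewrite !mulr_ge0 ?cst_beta_ge0 ?(ltW T0).
have B2 : 0 <= T * cst_beta beta * (c ^+ 2 * cst_Lam Lw) * (\sum_j k j t ^+ 2).
  apply: mulr_ge0 => //; apply: mulr_ge0; first by rewrite mulr_ge0 ?cst_beta_ge0 ?(ltW T0).
  by rewrite mulr_ge0 ?sqr_ge0 ?cst_Lam_ge0.
move: F1 F2 K2 W2 n0 k0 L0 C0 B1 B2.
move: (ip mu F F) (ip mu _ _) (\sum_j _ ^+ 2) (\sum_j _ ^+ 2) (\sum_j _ ^+ 2)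
  (sqr_slice _ _ y t) (sqr_slice _ _ ys t) (cst_beta beta) (cst_Lam Lw) (cst_w w0) (f 0 ^+ 2) (L ^+ 2) c.
move=> r1 r2 r3 r4 r5 r6 r7 r8 r9 r10 r11 r12 r13 *.
lra.
Qed.

End one_solution.
Section two_solutions.
Variables (u1 u2 : control R d J K) (y1 y2 : R -> 'rV[R]_d -> R)
  (k1 k1' k2 k2' : 'I_J -> R -> R) (t E M : R).
Hypothesis tT : time T t.
Hypothesis u1U : in_U Omega u1.
Hypothesis u2U : in_U Omega u2.
Hypothesis u1c : ctrl_sqr Omega u1 <= c.
Hypothesis u2c : ctrl_sqr Omega u2 <= c.
Hypothesis uE : ctrl_sqr Omega (control_sub u1 u2) <= E.
Hypothesis y1L : L2 mu (zext T Omega y1 t).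
Hypothesis y2L : L2 mu (zext T Omega y2 t).
Hypothesis ysL : L2 mu (zext T Omega ys t).
Hypothesis teq1 : forall j, beta j * k1' j t = thermostat_W Omega w ys u1 j y1 t - k1 j t.
Hypothesis teq2 : forall j, beta j * k2' j t = thermostat_W Omega w ys u2 j y2 t - k2 j t.
Hypothesis state2 : sqr_slice T Omega y2 t + \sum_j k2 j t ^+ 2 <= M.

(** Every difference of data stands beside a factor bounded by RU, by M or by the target. The source
    is therefore proportional to E, and the first solution enters only through the differences. *)
Lemma diff_energy_rate_le :
  energy_rate T Omega (fun t => y1 t \- y2 t) (fun t => force f (ctrl_g u1) y1 k1 t \-
    force f (ctrl_g u2) y2 k2 t) (fun j => k1' j \- k2' j) t <=
  E * (3 * M + 4 * T * cst_beta beta * (4 * cst_w w0 + 16 * c * cst_Lam Lw * M) +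
    cst_b2 T Lw RU beta * sqr_slice T Omega ys t) +
  cst_rate T L Lw RU beta *
    (sqr_slice T Omega (fun t => y1 t \- y2 t) t + \sum_j (k1 j t - k2 j t) ^+ 2).
Proof.
have [g1c h1c a1c] := ctrl_sqr_le u1c; have [g2c h2c _] := ctrl_sqr_le u2c.
have [gE hE aE] := ctrl_sqr_le uE.
have g1L j : L2 mu (ctrl_g u1 j \_ Omega) by exact/Lp_L2/u1U.1.
have h1L j : L2 mu (ctrl_h u1 j \_ Omega) by exact/Lp_L2/u1U.2.
have g2L j : L2 mu (ctrl_g u2 j \_ Omega) by exact/Lp_L2/u2U.1.
have h2L j : L2 mu (ctrl_h u2 j \_ Omega) by exact/Lp_L2/u2U.2.
have {}gE : \sum_j ip mu (fun x => (ctrl_g u1 j \_ Omega) x - (ctrl_g u2 j \_ Omega) x)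
    (fun x => (ctrl_g u1 j \_ Omega) x - (ctrl_g u2 j \_ Omega) x) <= E.
  by apply: le_trans gE; under [leRHS]eq_bigr do rewrite restrictB.
have {}hE : \sum_j ip mu (fun x => (ctrl_h u1 j \_ Omega) x - (ctrl_h u2 j \_ Omega) x)
    (fun x => (ctrl_h u1 j \_ Omega) x - (ctrl_h u2 j \_ Omega) x) <= E.
  by apply: le_trans hE; under [leRHS]eq_bigr do rewrite restrictB.
have {}aE : \sum_j \sum_k (ctrl_alpha u1 j k - ctrl_alpha u2 j k) ^+ 2 <= E.
  by apply: le_trans aE; under [leRHS]eq_bigr do under eq_bigr do rewrite !mxE.
have n20 : 0 <= sqr_slice T Omega y2 t := ip_ge0 _ _.
have k20 : 0 <= \sum_j k2 j t ^+ 2 by apply: sumr_ge0 => j _; exact: sqr_ge0.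
have E0 : 0 <= E by apply: le_trans gE; apply: sumr_ge0 => j _; exact: ip_ge0.
have dyE x : zext T Omega (fun t => y1 t \- y2 t) t x = zext T Omega y1 t x - zext T Omega y2 t x.
  exact: zextB.
have F1 := @force_sqrB_le _ _ _ mu _ f L c E (fun x => f 0 * \1_Omega x) _ _
  (zext T Omega (fun t => y1 t \- y2 t) t) (zext T Omega (fun t => force f (ctrl_g u1) y1 k1 t \-
    force f (ctrl_g u2) y2 k2 t) t) (fun j => k1 j t) (fun j => k2 j t) _ _
    fL y1L y2L g1L g2L g1c gE dyE.
have {}F1 := F1 ltac:(by move=> x; rewrite zextB !zext_force).
have N2 : ip mu (fun x => zext T Omega y2 t x - zext T Omega ys t x)
    (fun x => zext T Omega y2 t x - zext T Omega ys t x) <= 2 * (M + sqr_slice T Omega ys t).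
  apply: le_trans (ip_sqrB_le y2L ysL) _; rewrite -!/(sqr_slice _ _ _ _) mulrDr lerD2r ler_wpM2l//.
  by apply: le_trans state2; rewrite lerDl.
have W1 := @feedback_sqrB_le _ _ _ mu _ _ w Lw c E _ _ _ _ _ (zext T Omega (fun t => y1 t \- y2 t) t)
  (ctrl_alpha u1) (ctrl_alpha u2) wL h1L h2L (L2B y1L ysL) (L2B y2L ysL) h1c h2c a1c hE aE N2.
have {}W1 := W1 ltac:(by move=> x; rewrite dyE; ring).
have W2 : \sum_j (thermostat_W Omega w ys u1 j y1 t - thermostat_W Omega w ys u2 j y2 t) ^+ 2 <=
    4 * c ^+ 2 * cst_Lam Lw * sqr_slice T Omega (fun t => y1 t \- y2 t) t +
    E * (4 * cst_w w0 + 8 * c * cst_Lam Lw * (2 * (M + sqr_slice T Omega ys t))).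
  apply: le_trans W1; rewrite le_eqVlt; apply/orP; left; apply/eqP.
  by apply: eq_bigr => j _; rewrite !(@thermostat_WE _ _ _ _ T).
have K1 := sum_sqr_relaxation_le (k' := fun j => k1' j t - k2' j t)
  (W := fun j => thermostat_W Omega w ys u1 j y1 t - thermostat_W Omega w ys u2 j y2 t)
  (k := fun j => k1 j t - k2 j t) beta0.
have {}K1 := K1 ltac:(by move=> j; rewrite mulrBr teq1 teq2; ring).
rewrite /energy_rate /cst_rate /cst_b2.
have Tb0 : 0 <= 2 * T * (2 * cst_beta beta) by rewrite !mulr_ge0 ?cst_beta_ge0 ?(ltW T0).
have K2 := ler_wpM2l (_ : 0 <= 2 * T) K1; have {}K2 := K2 ltac:(by rewrite mulr_ge0 ?(ltW T0)).
have W3 := ler_wpM2l Tb0 W2.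
have n0 : 0 <= sqr_slice T Omega (fun t => y1 t \- y2 t) t := ip_ge0 _ _.
have k0 : 0 <= \sum_j (k1 j t - k2 j t) ^+ 2 by apply: sumr_ge0 => j _; exact: sqr_ge0.
have kM : (\sum_j k2 j t ^+ 2) * E <= M * E.
  by rewrite ler_wpM2r// (le_trans _ state2)// lerDr.
have L0 : 0 <= L ^+ 2 * (\sum_j (k1 j t - k2 j t) ^+ 2) by rewrite mulr_ge0 ?sqr_ge0.
have L1 : 0 <= L ^+ 2 * sqr_slice T Omega (fun t => y1 t \- y2 t) t by rewrite mulr_ge0 ?sqr_ge0.
have C0 : 0 <= c * sqr_slice T Omega (fun t => y1 t \- y2 t) t by rewrite mulr_ge0 ?sqr_ge0.
have C1 : 0 <= c * (\sum_j (k1 j t - k2 j t) ^+ 2) by rewrite mulr_ge0 ?sqr_ge0.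
have B1 : 0 <= T * cst_beta beta * sqr_slice T Omega (fun t => y1 t \- y2 t) t.
  by rewrite !mulr_ge0 ?cst_beta_ge0 ?(ltW T0).
have B2 : 0 <= T * cst_beta beta * (c ^+ 2 * cst_Lam Lw) * (\sum_j (k1 j t - k2 j t) ^+ 2).
  apply: mulr_ge0 => //; apply: mulr_ge0; first by rewrite mulr_ge0 ?cst_beta_ge0 ?(ltW T0).
  by rewrite mulr_ge0 ?sqr_ge0 ?cst_Lam_ge0.
move: F1 K2 W3 n0 k0 kM L0 L1 C0 C1 B1 B2.
rewrite -!/(sqr_slice _ _ _ _) /=.
move: (\sum_j (k1' j t - _) ^+ 2) (\sum_j (thermostat_W _ _ _ _ _ _ _ - _) ^+ 2)
  (\sum_j (k1 j t - _) ^+ 2) (\sum_j k2 j t ^+ 2)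
  (sqr_slice _ _ (fun t => y1 t \- y2 t) t) (sqr_slice _ _ (fun _ => force _ _ _ _ _ \- _) t)
  (sqr_slice _ _ ys t) (cst_beta beta) (cst_Lam Lw) (cst_w w0) (L ^+ 2) c.
move=> r1 r2 r3 r4 r5 r6 r7 r8 r9 r10 r11 r12 *.
lra.
Qed.

End two_solutions.

End rate_estimates.

(** * The bound for one solution and the estimate for two *)

Section stability.
Set Implicit Arguments.
Unset Strict Implicit.
Context {R : realType} {d J K : nat}.
Notation mu := (@lebesgue_rV R d).
Notation leb := (@lebesgue_measure R).
Variables (T vol L D : R) (Omega : set 'rV[R]_d) (beta : 'I_J -> R) (f : R -> R)
  (w : 'I_K -> R -> R) (Lw : 'I_K -> R) (ys : R -> 'rV[R]_d -> R) (RU R0 ny : R).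
Hypothesis T0 : 0 < T.
Hypothesis D0 : 0 < D.
Hypothesis mO : measurable Omega.
Hypothesis Ovol : mu Omega = vol%:E.
Hypothesis beta0 : forall j, 0 < beta j.
Hypothesis fL : forall x y, `|f x - f y| <= L * `|x - y|.
Hypothesis wL : forall k x y, `|w k x - w k y| <= Lw k * `|x - y|.
Hypothesis ysL : L2QT T Omega ys.
Hypothesis ysn : \int[leb]_(t in time T) sqr_slice T Omega ys t = ny ^+ 2.
Local Notation w0 := (fun k => w k 0).
Local Notation c := (RU ^+ 2).
Local Notation rate := (cst_rate T L Lw RU beta).
Local Notation bound := (cst_state T vol L (f 0) Lw w0 RU R0 ny beta).
Let AF := ae_filter_ringOfSetsType leb.

Let vol0 : 0 <= vol.
Proof. by rewrite -lee_fin -Ovol; exact: measure_ge0. Qed.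

Let Ofin : (mu Omega < +oo)%E.
Proof. by rewrite [X in (X < _)%E]Ovol ltry. Qed.

(** This is where the norm of the target enters the constants: the pointwise sources are affine in
    its squared norm at time t. *)
Lemma integral_affine_slice (a b : R) :
  leb.-integrable (time T) (EFin \o (fun t => a + b * sqr_slice T Omega ys t)) /\
  \int[leb]_(t in time T) (a + b * sqr_slice T Omega ys t) = a * T + b * ny ^+ 2.
Proof.
have mT := measurable_time T.
have i1 := integrable_sqr_slice T ysL.
have i2 := @integrable_EFinZ R _ (measurableTypeR R) leb _ b _ mT i1.
have i3 : leb.-integrable (time T) (EFin \o cst a).
  apply/integrableP; split; first by apply/measurable_EFinP; exact: measurable_cst.
  rewrite (_ : (fun t => _) = cst `|a|%:E)// integral_cst//.
  by rewrite lte_mul_pinfty ?time_fin.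
split; first exact: (@integrable_EFinD R _ (measurableTypeR R)).
rewrite RintegralD// RintegralZl// ysn Rintegral_cst//= /time lebesgue_measure_itv/=.
by rewrite lte_fin T0/= subr0.
Qed.

Let slice_L2 g : L2QT T Omega g -> {ae leb, forall t, L2 mu (zext T Omega g t)}.
Proof. by move=> /L2QT_zext; exact: prod_L2_ae. Qed.

Lemma state_sqr_init (a : initial R d J) z (kc : 'I_J -> R -> R) :
  {ae mu, forall x, z 0 x = (init_y a \_ Omega) x} -> (forall j, kc j 0 = init_kappa a j) ->
  state_sqr z kc 0 = init_sqr Omega a.
Proof.
move=> za ka; rewrite /state_sqr /init_sqr (eq_ip_ae za za).
by congr (_ + _); apply: eq_bigr => j _; rewrite ka.
Qed.

Lemma state_bound (u : control R d J K) a s : in_U Omega u -> ctrl_sqr Omega u <= c ->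
  init_sqr Omega a <= R0 ^+ 2 -> weak_solution T Omega D beta f w ys u a s ->
  {ae leb, forall t, time T t ->
    sqr_slice T Omega (st_y s) t + \sum_j st_kappa s j t ^+ 2 <= bound}.
Proof.
move=> uU uc aR sol.
have [z [kc [he te z0 kc0 teq]]] := weak_solution_evolution mO Ofin fL wL ysL uU sol.
have [pi' pE] := integral_affine_slice (cst_a1 T vol (f 0) w0 RU beta) (cst_b1 T Lw RU beta).
have p0 t : 0 <= cst_a1 T vol (f 0) w0 RU beta + cst_b1 T Lw RU beta * sqr_slice T Omega ys t.
  by rewrite addr_ge0 ?cst_a1_ge0// mulr_ge0 ?cst_b1_ge0 ?ip_ge0.
have rle : {ae leb, forall t, time T t -> energy_rate T Omega (st_y s)
    (force f (ctrl_g u) (st_y s) (st_kappa s)) (st_kappa' s) t <=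
    cst_a1 T vol (f 0) w0 RU beta + cst_b1 T Lw RU beta * sqr_slice T Omega ys t +
    rate * (sqr_slice T Omega (st_y s) t + \sum_j st_kappa s j t ^+ 2)}.
  have H := @filterI _ _ AF _ _ (slice_L2 (he_y he)) (@filterI _ _ AF _ _ (slice_L2 (he_Fo he)) (slice_L2 ysL)).
  apply: (@filterS2 _ _ AF _ _ _ _ H teq) => t [h1 [h2 h3]] h4 tT.
  by apply: energy_rate_le => //; exact: h4.
have [+ _] := state_sqr_bound T0 (ltW D0) he te (cst_rate_gt0 L Lw RU beta T0) p0 pi' rle.
rewrite pE (state_sqr_init z0 kc0) => H.
apply: (@filterS _ _ AF) H => t + tT => /(_ tT) /le_trans; apply.
rewrite /cst_state ler_wpM2r ?expR_ge0// ler_wpM2l// lerD2r ler_wpM2l//.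
Qed.

Section two_solutions.
Variables (u1 u2 : control R d J K) (a1 a2 : initial R d J) (s1 s2 : state R d J).
Hypothesis u1U : in_U Omega u1.
Hypothesis u2U : in_U Omega u2.
Hypothesis u1c : ctrl_sqr Omega u1 <= c.
Hypothesis u2c : ctrl_sqr Omega u2 <= c.
Hypothesis a2R : init_sqr Omega a2 <= R0 ^+ 2.
Hypothesis sol1 : weak_solution T Omega D beta f w ys u1 a1 s1.
Hypothesis sol2 : weak_solution T Omega D beta f w ys u2 a2 s2.
Let E := ctrl_sqr Omega (control_sub u1 u2) + init_sqr Omega (initial_sub a1 a2).
Let s := state_sub s1 s2.

Lemma diff_bounds : exists Fo z kc,
  let q := energy_rate T Omega (st_y s) Fo (st_kappa' s) in
  [/\ heat_evolution T D Omega (st_y s) (st_grad s) (st_y' s) Fo z,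
      forall j, thermostat_evolution T (st_kappa s j) (st_kappa' s j) (kc j),
      {ae leb, forall t, time T t -> sqr_slice T Omega (st_y s) t + \sum_j st_kappa s j t ^+ 2 <=
        cst_sup T vol L (f 0) Lw w0 RU R0 ny beta * E},
      \int[leb]_(t in time T) q t <= cst_rates T vol L (f 0) Lw w0 RU R0 ny beta * E &
      2 * D * (\sum_i \int[leb]_(t in time T) sqr_slice T Omega (st_grad s i) t) <=
        cst_rates T vol L (f 0) Lw w0 RU R0 ny beta * E].
Proof.
have [z1 [kc1 [he1 te1 z10 kc10 teq1]]] := weak_solution_evolution mO Ofin fL wL ysL u1U sol1.
have [z2 [kc2 [he2 te2 z20 kc20 teq2]]] := weak_solution_evolution mO Ofin fL wL ysL u2U sol2.
pose F1 := force f (ctrl_g u1) (st_y s1) (st_kappa s1).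
pose F2 := force f (ctrl_g u2) (st_y s2) (st_kappa s2).
pose z t := z1 t \- z2 t; pose kc j t := kc1 j t - kc2 j t.
have he : heat_evolution T D Omega (st_y s) (st_grad s) (st_y' s) (fun t => F1 t \- F2 t) z.
  exact: heat_evolutionB.
have te j : thermostat_evolution T (st_kappa s j) (st_kappa' s j) (kc j).
  exact: thermostat_evolutionB.
exists (fun t => F1 t \- F2 t), z, kc.
have uE : ctrl_sqr Omega (control_sub u1 u2) <= E by rewrite lerDl init_sqr_ge0.
have E0 : 0 <= E by rewrite addr_ge0 ?ctrl_sqr_ge0 ?init_sqr_ge0.
pose A2 := cst_a2 T vol L (f 0) Lw w0 RU R0 ny beta; pose B2 := cst_b2 T Lw RU beta.
have [pi' pE] := integral_affine_slice (E * A2) (E * B2).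
have p0 t : 0 <= E * A2 + E * B2 * sqr_slice T Omega ys t.
  have A0 : 0 <= A2 by exact: cst_a2_ge0.
  have B0 : 0 <= B2 by exact: cst_b2_ge0.
  by apply: addr_ge0; [exact: mulr_ge0|apply: mulr_ge0; [exact: mulr_ge0|exact: ip_ge0]].
have rle : {ae leb, forall t, time T t -> energy_rate T Omega (st_y s)
    (fun t => F1 t \- F2 t) (st_kappa' s) t <= E * A2 + E * B2 * sqr_slice T Omega ys t +
    rate * (sqr_slice T Omega (st_y s) t + \sum_j st_kappa s j t ^+ 2)}.
  have H := @filterI _ _ AF _ _ (slice_L2 (he_y he1)) (@filterI _ _ AF _ _ (slice_L2 (he_y he2)) (slice_L2 ysL)).
  have H' := @filterI _ _ AF _ _ (@filterI _ _ AF _ _ teq1 teq2) (state_bound u2U u2c a2R sol2).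
  apply: (@filterS2 _ _ AF _ _ _ _ H H') => t [h1 [h2 h3]] [[h4 h5] h6] tT.
  rewrite -mulrA -mulrDr.
  exact: (diff_energy_rate_le T0 beta0 fL wL tT u1U u2U u1c u2c uE h1 h2 h3 (h4 tT) (h5 tT) (h6 tT)).
have [] := state_sqr_bound T0 (ltW D0) he te (cst_rate_gt0 L Lw RU beta T0) p0 pi' rle.
have S0 : state_sqr z kc 0 = init_sqr Omega (initial_sub a1 a2).
  apply: state_sqr_init => [|j]; last by rewrite /kc kc10 kc20.
  by apply: filterS2 z10 z20 => x h1 h2; rewrite /z /= restrictB h1 h2.
have zE : state_sqr z kc 0 <= E by rewrite S0 lerDr ctrl_sqr_ge0.
rewrite pE.
have -> : E * A2 * T + E * B2 * ny ^+ 2 = E * cst_source T vol L (f 0) Lw w0 RU R0 ny beta.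
  by rewrite /cst_source -/A2 -/B2; ring.
set src := cst_source _ _ _ _ _ _ _ _ _ _.
have src0 : 0 <= src by exact: cst_source_ge0.
have supE : 2 * (2 * state_sqr z kc 0 + E * src) * expR (2 * rate * T) <=
    cst_sup T vol L (f 0) Lw w0 RU R0 ny beta * E.
  rewrite /cst_sup -/src [leRHS]mulrAC ler_wpM2r ?expR_ge0//.
  have := E0; move: zE; nra.
move=> H1 H2.
have Q1 : \int[leb]_(t in time T) energy_rate T Omega (st_y s) (fun t => F1 t \- F2 t) (st_kappa' s) t <=
    E * src + rate * T * (cst_sup T vol L (f 0) Lw w0 RU R0 ny beta * E).
  rewrite (le_trans H2)// lerD2l ler_wpM2l// mulr_ge0 ?(ltW T0)//.
  exact/ltW/cst_rate_gt0.
(* The leading E pays for |z(0)|^2, which remains on the right of the energy inequality when the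
   gradient is estimated. *)
have QE : cst_rates T vol L (f 0) Lw w0 RU R0 ny beta * E = E +
    (E * src + rate * T * (cst_sup T vol L (f 0) Lw w0 RU R0 ny beta * E)).
  by rewrite /cst_rates -/src; ring.
split => //.
- apply: (@filterS _ _ AF) H1 => t h tT; exact: le_trans (h tT) supE.
- by rewrite QE (le_trans Q1)// lerDr.
- have TT : 0 < T <= T by rewrite T0/=.
  have := heat_energy (ltW D0) TT he; have := integral_energy_rate he te (lexx T).
  have k0 : 0 <= 2 * T * \sum_j \int[leb]_(t in time T) (st_kappa' s j t ^+ 2).
    rewrite mulr_ge0 ?mulr_ge0 ?(ltW T0)// sumr_ge0// => j _.
    by apply: Rintegral_ge0 => t _; exact: sqr_ge0.
  have zT := ip_ge0 mu (z T).
  have z0 : ip mu (z 0) (z 0) <= E.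
    apply: le_trans zE; rewrite /state_sqr lerDl sumr_ge0// => j _; exact: sqr_ge0.
  move: k0 zT z0 Q1; rewrite QE.
  rewrite /sqr_slice.
  move: (\int[leb]_(t in time T) _) (\int[leb]_(t in time T) _) (E * src + _) (2 * D * _) (2 * T * _)
    (\int[leb]_(t in time T) energy_rate _ _ _ _ _ _) (ip mu (z 0) _) (ip mu (z T) _).
  move=> *; lra.
Qed.

End two_solutions.
End stability.

(** * The individual norms of the difference *)

Section evolution_norms.
Set Implicit Arguments.
Unset Strict Implicit.
Context {R : realType} {d J : nat}.
Notation mu := (@lebesgue_rV R d).
Notation leb := (@lebesgue_measure R).
Variables (T D : R) (Omega : set 'rV[R]_d).
Hypothesis T0 : 0 < T.
Hypothesis D0 : 0 < D.
Hypothesis mO : measurable Omega.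
Hypothesis Ofin : (mu Omega < +oo)%E.
Variables (s : state R d J) (Fo z : R -> 'rV[R]_d -> R) (kc : 'I_J -> R -> R) (A Q : R).
Hypothesis he : heat_evolution T D Omega (st_y s) (st_grad s) (st_y' s) Fo z.
Hypothesis te : forall j, thermostat_evolution T (st_kappa s j) (st_kappa' s j) (kc j).
Hypothesis supA : {ae (@lebesgue_measure R), forall t, time T t ->
  sqr_slice T Omega (st_y s) t + \sum_j st_kappa s j t ^+ 2 <= A}.
Hypothesis rateQ :
  \int[leb]_(t in time T) energy_rate T Omega (st_y s) Fo (st_kappa' s) t <= Q.
Hypothesis gradQ :
  2 * D * (\sum_i \int[leb]_(t in time T) sqr_slice T Omega (st_grad s i) t) <= Q.
Hypothesis A0 : 0 <= A.
Let AF := ae_filter_ringOfSetsType leb.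

(** Cauchy-Schwarz in L^2 for each component, then in R^d for the vectors of norms. *)
Lemma ip_sumr_sqr_le (g v : 'I_d -> 'rV[R]_d -> R) : (forall i, L2 mu (g i)) ->
  (forall i, L2 mu (v i)) ->
  (\sum_i ip mu (g i) (v i)) ^+ 2 <= (\sum_i ip mu (g i) (g i)) * \sum_i ip mu (v i) (v i).
Proof.
move=> gL vL.
have := @sumr_cauchy_schwarz R d (fun i => Num.sqrt (ip mu (g i) (g i))) (fun i => Num.sqrt (ip mu (v i) (v i))).
under [X in _ <= X * _]eq_bigr do rewrite sqr_sqrtr ?ip_ge0//.
under [X in _ <= _ * X]eq_bigr do rewrite sqr_sqrtr ?ip_ge0//.
apply: le_trans; rewrite -[leLHS]real_normK ?num_real// lerXn2r ?nnegrE//.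
  by apply: sumr_ge0 => i _; rewrite mulr_ge0.
by rewrite (le_trans (ler_norm_sum _ _ _))//; apply: ler_sum => i _; exact: norm_ip_le.
Qed.

Lemma y_norm_le : (LpL2_norm T Omega +oo (st_y s) <= (Num.sqrt A)%:E)%E.
Proof.
apply: LpL2_oo_le => //.
have yL := prod_L2_ae (iffLR (L2QT_zext _ _ _) (he_y he)).
apply: (@filterS2 _ _ AF _ _ _ _ yL supA) => t h1 h2 tT; split => //.
apply: le_trans (h2 tT); rewrite lerDl sumr_ge0// => j _; exact: sqr_ge0.
Qed.

Lemma kappa_norm_le j : (Lp_norm leb +oo (time T) (st_kappa s j) <= (Num.sqrt A)%:E)%E.
Proof.
apply: Lnorm_oo_le; first exact: sqrtr_ge0.
apply: (@filterS _ _ AF) supA => t h; rewrite /= lee_fin patchE; case: ifPn => [/set_mem tT|_].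
  rewrite -sqrtr_sqr ler_wsqrtr// (le_trans _ (h tT))// (bigD1 j)//=.
  by rewrite addrCA lerDl addr_ge0 ?ip_ge0// sumr_ge0// => i _; exact: sqr_ge0.
by rewrite normr0 sqrtr_ge0.
Qed.

Lemma grad_norm_le : (L2QT_vnorm T Omega (st_grad s) <= (Num.sqrt (Q / (2 * D)))%:E)%E.
Proof.
have I0 i : 0 <= \int[leb]_(t in time T) sqr_slice T Omega (st_grad s i) t.
  by apply: Rintegral_ge0 => t _; exact: ip_ge0.
rewrite /L2QT_vnorm (eq_bigr (fun i => (\int[leb]_(t in time T) sqr_slice T Omega (st_grad s i) t)%:E)).
  rewrite sumEFin poweR2V_EFin ?sumr_ge0// lee_fin ler_wsqrtr//.
  by rewrite ler_pdivlMr ?mulr_gt0// mulrC.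
move=> i _; rewrite L2QT_norm_sqr; last exact: he_Dy he i.
congr EFin; rewrite [RHS]Rintegral_mkcond; apply: eq_Rintegral => t _.
rewrite patchE; case: ifPn => //; rewrite notin_setE => tT.
rewrite /ip (@eq_Rintegral _ _ _ mu _ (fun=> 0)); first by rewrite /Rintegral integral0.
by move=> x _; rewrite zext_out// mul0r.
Qed.

Let rates_le : \int[leb]_(t in time T) sqr_slice T Omega Fo t +
  2 * T * \sum_j \int[leb]_(t in time T) (st_kappa' s j t ^+ 2) <= Q.
Proof.
move: rateQ; rewrite (integral_energy_rate he te)//; apply: le_trans.
rewrite -addrA lerD2l lerDr; apply: Rintegral_ge0 => t _; exact: ip_ge0.
Qed.

Lemma kappa'_norm_le j :
  (Lp_norm leb 2%:E (time T) (st_kappa' s j) <= (Num.sqrt (Q / (2 * T)))%:E)%E.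
Proof.
have k'0 i : 0 <= \int[leb]_(t in time T) (st_kappa' s i t ^+ 2).
  by apply: Rintegral_ge0 => t _; exact: sqr_ge0.
have Fo0 : 0 <= \int[leb]_(t in time T) sqr_slice T Omega Fo t.
  by apply: Rintegral_ge0 => t _; exact: ip_ge0.
rewrite Lp_normE; last exact: te_k' (te j).
rewrite lee_fin ler_wsqrtr// ler_pdivlMr ?mulr_gt0// mulrC.
apply: le_trans rates_le; rewrite ip_restrict.
rewrite (bigD1 j)//= mulrDr addrCA lerDl addr_ge0// mulr_ge0 ?mulr_ge0 ?(ltW T0)//.
by rewrite sumr_ge0.
Qed.

Lemma y'_norm_le : (L2H1dual_norm T Omega (st_y' s) <= (Num.sqrt ((2 + D) * Q))%:E)%E.
Proof.
(* On the unit ball of H^1 the heat equation bounds the square of y' by b. Its gradient part is D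
   times 2 D |grad y|^2, hence at most D Q after integration, and the source part is at most 2 Q;
   this is the factor 2 + D. *)
pose b t := 2 * D ^+ 2 * (\sum_i sqr_slice T Omega (st_grad s i) t) + 2 * sqr_slice T Omega Fo t.
have b0 t : 0 <= b t.
  apply: addr_ge0; last by apply: mulr_ge0 => //; exact: ip_ge0.
  apply: mulr_ge0; first by rewrite mulr_ge0// sqr_ge0.
  by apply: sumr_ge0 => i _; exact: ip_ge0.
have gL : {ae leb, forall t, forall i, L2 mu (zext T Omega (st_grad s i) t)}.
  apply: (@filter_forall _ _ _ _ AF) => i.
  exact: prod_L2_ae (iffLR (L2QT_zext _ _ _) (he_Dy he i)).
have FL := prod_L2_ae (iffLR (L2QT_zext _ _ _) (he_Fo he)).
have H : {ae leb, forall t, time T t -> (H1dual_norm Omega (st_y' s t) <= (Num.sqrt (b t))%:E)%E}.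
  apply: H1dual_norm_ae_le => //; first exact: he_app he.
  move=> u Du uH u1.
  have [/Lp_L2 uL DuL _] := uH.
  have {}DuL i : L2 mu (Du i \_ Omega) by exact/Lp_L2.
  have := @filterI _ _ AF _ _ gL (@filterI _ _ AF _ _ FL (he_dual he uH)).
  apply: (@filterS _ _ AF) => t [h1 [h2 h3]] tT; rewrite h3// /heat_pairing -sqrtr_sqr ler_wsqrtr//.
  have G := ip_sumr_sqr_le h1 DuL; have F := ip_cauchy_schwarz h2 uL.
  have {}G : (\sum_i ip mu (zext T Omega (st_grad s i) t) (Du i \_ Omega)) ^+ 2 <=
      \sum_i sqr_slice T Omega (st_grad s i) t.
    rewrite (le_trans G)// ler_piMr ?sumr_ge0// => [i _|]; first exact: ip_ge0.
    by rewrite (le_trans _ u1)// lerDr ip_ge0.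
  have {}F : ip mu (zext T Omega Fo t) (u \_ Omega) ^+ 2 <= sqr_slice T Omega Fo t.
    rewrite (le_trans F)// ler_piMr ?ip_ge0// (le_trans _ u1)// lerDl sumr_ge0// => i _.
    exact: ip_ge0.
  rewrite /b; have {}G := ler_wpM2l (sqr_ge0 D) G; move: F G.
  move: (\sum_i ip _ _ _) (ip _ _ _) (\sum_i _) (sqr_slice _ _ _ _) => r1 r2 r3 r4 F G.
  by have := sqr_ge0 (D * r3 + r2); nra.
have mT := measurable_time T.
have bi : leb.-integrable (time T) (EFin \o b).
  apply: (@integrable_EFinD R _ (measurableTypeR R)) => //;
    apply: (@integrable_EFinZ R _ (measurableTypeR R)) => //.
    apply: (@integrable_EFin_sum R _ (measurableTypeR R)) => // i.
    apply: integrable_sqr_slice; exact: he_Dy he i.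
  apply: integrable_sqr_slice; exact: he_Fo he.
have bQ : \int[leb]_(t in time T) b t <= (2 + D) * Q.
  rewrite RintegralD//; last 2 first.
  - apply: (@integrable_EFinZ R _ (measurableTypeR R)) => //.
    apply: (@integrable_EFin_sum R _ (measurableTypeR R)) => // i.
    apply: integrable_sqr_slice; exact: he_Dy he i.
  - apply: (@integrable_EFinZ R _ (measurableTypeR R)) => //.
    apply: integrable_sqr_slice; exact: he_Fo he.
  rewrite !RintegralZl//; last 2 first.
  - apply: integrable_sqr_slice; exact: he_Fo he.
  - apply: (@integrable_EFin_sum R _ (measurableTypeR R)) => // i.
    apply: integrable_sqr_slice; exact: he_Dy he i.
  rewrite (@Rintegral_sum R _ (measurableTypeR R))//; last first.
    by move=> i; apply: integrable_sqr_slice; exact: he_Dy he i.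
  have k'0 : 0 <= 2 * T * \sum_j \int[leb]_(t in time T) (st_kappa' s j t ^+ 2).
    rewrite mulr_ge0 ?mulr_ge0 ?(ltW T0)// sumr_ge0// => j _.
    by apply: Rintegral_ge0 => t _; exact: sqr_ge0.
  have := ler_wpM2l (ltW D0) gradQ; move: rates_le k'0.
  move: (\int[leb]_(t in time T) _) (2 * T * _) (\sum_(i < d) _) => r1 r2 r3.
  by nra.
rewrite /L2H1dual_norm unlock /Lnorm -poweR2V_EFin; last first.
  by apply: le_trans bQ; apply: Rintegral_ge0 => t _.
apply: gt0_ler_poweR; rewrite ?invr_ge0 ?in_itv ?andbT//=.
- by rewrite leey integral_ge0// => t _; exact: poweR_ge0.
- rewrite leey andbT lee_fin; apply: le_trans bQ; apply: Rintegral_ge0 => t _; exact: b0.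
apply: (@le_trans _ _ (\int[leb]_(t in time T) b t)%:E); last by rewrite lee_fin.
rewrite /Rintegral fineK; last exact: integrable_fin_num.
rewrite [leRHS]integral_mkcond; apply: ge0_le_integral_ae => [t|t|].
- exact: poweR_ge0.
- by rewrite patchE; case: ifPn => // _; rewrite lee_fin.
apply: (@filterS _ _ AF) H => t h; rewrite !patchE; case: ifPn => [/set_mem tT|_]; last first.
  by rewrite (_ : (point : \bar R) = 0%E)// abse0 poweR0r.
move: (h tT); have N0 : (0 <= H1dual_norm Omega (st_y' s t))%E.
  (* A supremum may be minus infinity; the zero function, which is in the unit ball, shows that the
     dual norm is nonnegative. *)
  have u0 := H1Z mO Ofin 0 (H1_0 Omega).
  have := le_H1dual_norm (st_y' s t) u0; rewrite H1_sqrZ//; last exact: H1_0.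
  by rewrite expr0n mul0r ler01 => /(_ isT); apply: le_trans; rewrite lee_fin.
move: N0; case: H1dual_norm => [r| |]//; rewrite !lee_fin => r0 rb.
rewrite powR_mulrn// ger0_norm// -(sqr_sqrtr (b0 t)).
by rewrite lerXn2r ?nnegrE// (le_trans r0).
Qed.

End evolution_norms.

Lemma sqrt_sum_scale {R : realType} J (S Q E T D : R) : 0 < T -> 0 < D -> 0 <= S -> 0 <= Q ->
  Num.sqrt (S * E) + Num.sqrt (Q * E / (2 * D)) + Num.sqrt ((2 + D) * (Q * E)) +
    \sum_(j < J) (Num.sqrt (S * E) + Num.sqrt (Q * E / (2 * T))) =
  (Num.sqrt S + Num.sqrt (Q / (2 * D)) + Num.sqrt ((2 + D) * Q) +
    \sum_(j < J) (Num.sqrt S + Num.sqrt (Q / (2 * T)))) * Num.sqrt E.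
Proof.
move=> /ltW T0 /ltW D0 S0 Q0.
have sE x : 0 <= x -> Num.sqrt (Q * E / x) = Num.sqrt (Q / x) * Num.sqrt E.
  by move=> x0; rewrite mulrAC sqrtrM// divr_ge0.
have sT := sE _ (mulr_ge0 (ler0n R 2) T0); have sD := sE _ (mulr_ge0 (ler0n R 2) D0).
have D2 : 0 <= 2 + D by exact: addr_ge0.
rewrite sT sD mulrA (sqrtrM _ S0) (sqrtrM _ (mulr_ge0 D2 Q0)).
by rewrite !mulrDl mulr_suml; congr (_ + _); apply: eq_bigr => j _; rewrite mulrDl.
Qed.

(** * The total norm and the stability constant *)

Section X2_norm_bound.
Set Implicit Arguments.
Unset Strict Implicit.
Context {R : realType} {d J K : nat}.
Notation mu := (@lebesgue_rV R d).
Notation leb := (@lebesgue_measure R).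

(** The summands follow those of [X2_norm]: y, its gradient, y', and for each j the function kappa_j
    and its derivative. *)
Definition X2_constant (T vol L f0 : R) (Lw w0 : 'I_K -> R) (RU R0 ny D : R) (beta : 'I_J -> R) : R :=
  let S := cst_sup T vol L f0 Lw w0 RU R0 ny beta in
  let Q := cst_rates T vol L f0 Lw w0 RU R0 ny beta in
  Num.sqrt S + Num.sqrt (Q / (2 * D)) + Num.sqrt ((2 + D) * Q) +
  \sum_(j < J) (Num.sqrt S + Num.sqrt (Q / (2 * T))).

Lemma X2_norm_le (T vol L D : R) (Omega : set 'rV[R]_d) (beta : 'I_J -> R) (f : R -> R)
    (w : 'I_K -> R -> R) (Lw : 'I_K -> R) (ys : R -> 'rV[R]_d -> R) (RU R0 ny : R)
    (u1 u2 : control R d J K) (a1 a2 : initial R d J) (s1 s2 : state R d J) :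
  0 < T -> 0 < D -> measurable Omega -> mu Omega = vol%:E -> (forall j, 0 < beta j) ->
  (forall x y, `|f x - f y| <= L * `|x - y|) ->
  (forall k x y, `|w k x - w k y| <= Lw k * `|x - y|) -> L2QT T Omega ys ->
  \int[leb]_(t in time T) sqr_slice T Omega ys t = ny ^+ 2 ->
  in_U Omega u1 -> in_U Omega u2 -> ctrl_sqr Omega u1 <= RU ^+ 2 -> ctrl_sqr Omega u2 <= RU ^+ 2 ->
  init_sqr Omega a2 <= R0 ^+ 2 ->
  weak_solution T Omega D beta f w ys u1 a1 s1 -> weak_solution T Omega D beta f w ys u2 a2 s2 ->
  (X2_norm T Omega (state_sub s1 s2) <=
   (X2_constant T vol L (f 0) Lw (fun k => w k 0) RU R0 ny D beta *
    Num.sqrt (ctrl_sqr Omega (control_sub u1 u2) + init_sqr Omega (initial_sub a1 a2)))%:E)%E.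
Proof.
move=> T0 D0 mO Ovol b0 fL wL ysL ysn u1U u2U u1c u2c a2R sol1 sol2.
have Ofin : (mu Omega < +oo)%E by rewrite [X in (X < _)%E]Ovol ltry.
have vol0 : 0 <= vol by rewrite -lee_fin -Ovol; exact: measure_ge0.
have [Fo [z [kc [he te sup_le rate_le grad_le]]]] :=
  diff_bounds T0 D0 mO Ovol b0 fL wL ysL ysn u1U u2U u1c u2c a2R sol1 sol2.
move: sup_le rate_le grad_le.
set E := _ + init_sqr _ _; set S := cst_sup _ _ _ _ _ _ _ _ _ _; set Q := cst_rates _ _ _ _ _ _ _ _ _ _.
move=> sup_le rate_le grad_le.
have E0 : 0 <= E by rewrite addr_ge0 ?ctrl_sqr_ge0 ?init_sqr_ge0.
have src0 := @cst_source_ge0 R J K T vol L (f 0) Lw (fun k => w k 0) RU R0 ny beta T0 vol0.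
have S0 : 0 <= S.
  by rewrite /S /cst_sup; apply: mulr_ge0; [apply: mulr_ge0 => //; exact: addr_ge0|exact: expR_ge0].
have Q0 : 0 <= Q.
  rewrite /Q /cst_rates addr_ge0// addr_ge0//; apply: mulr_ge0 => //.
  by apply: mulr_ge0; [exact/ltW/cst_rate_gt0|exact: ltW].
have N1 := y_norm_le he sup_le (mulr_ge0 S0 E0).
have N2 := grad_norm_le D0 he grad_le.
have N3 := y'_norm_le T0 D0 mO Ofin he te rate_le grad_le.
have N4 j := kappa_norm_le sup_le j.
have N5 j := kappa'_norm_le T0 he te rate_le j.
have H : (X2_norm T Omega (state_sub s1 s2) <=
    (Num.sqrt (S * E) + Num.sqrt (Q * E / (2 * D)) + Num.sqrt ((2 + D) * (Q * E)) +
     \sum_(j < J) (Num.sqrt (S * E) + Num.sqrt (Q * E / (2 * T))))%:E)%E.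
  rewrite !EFinD -sumEFin; apply: leeD; first by do 2?apply: leeD.
  by apply: lee_sum => j _; exact: (leeD (N4 j) (N5 j)).
by apply: le_trans H _; rewrite sqrt_sum_scale.
Qed.

End X2_norm_bound.

Theorem theorem3p3 (R : realType) (T volOmega : R) (J K : nat)
    (L f0 : R) (Lw w0 : 'I_K -> R) (RU R0 normystar D : R) (beta : 'I_J -> R) :
  0 < T -> (0 < J)%N -> (0 < K)%N -> 0 < RU -> 0 < R0 -> 0 < D ->
  (forall j, 0 < beta j) ->
  exists C : R,
  forall (d : nat) (Omega : set 'rV[R]_d) (f : R -> R) (w : 'I_K -> R -> R)
    (ystar : R -> 'rV[R]_d -> R),
  (0 < d)%N ->
  (* Omega is a bounded domain *)
  Omega !=set0 -> open Omega -> connected Omega -> bounded_set Omega ->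
  lebesgue_rV d Omega = volOmega%:E ->
  H1_compact_in_L2 Omega ->
  L.-lipschitz f -> f 0 = f0 ->
  (forall k, (Lw k).-lipschitz (w k)) -> (forall k, w k 0 = w0 k) ->
  LpL2 T Omega +oo ystar -> LpL2_norm T Omega 2%:E ystar = normystar%:E ->
  forall (u1 u2 : control R d J K) (a1 a2 : initial R d J)
    (s1 s2 : state R d J),
  in_U Omega u1 -> (U_norm Omega u1 <= RU%:E)%E ->
  in_U Omega u2 -> (U_norm Omega u2 <= RU%:E)%E ->
  in_X0 Omega a1 -> (X0_norm Omega a1 <= R0%:E)%E ->
  in_X0 Omega a2 -> (X0_norm Omega a2 <= R0%:E)%E ->
  weak_solution T Omega D beta f w ystar u1 a1 s1 ->
  weak_solution T Omega D beta f w ystar u2 a2 s2 ->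
  (X2_norm T Omega (state_sub s1 s2) <=
   C%:E * (U_norm Omega (control_sub u1 u2) ^+ 2 +
           X0_norm Omega (initial_sub a1 a2) ^+ 2) `^ 2^-1)%E.
Proof.
move=> T0 _ _ RU0 R00 D0 beta0.
exists (X2_constant T volOmega L f0 Lw w0 RU R0 normystar D beta).
move=> d Omega f w ystar _ _ oO _ _ Ovol _ fL f0E wL w0E ysoo ysn u1 u2 a1 a2 s1 s2
  u1U u1R u2U u2R a1X _ a2X a2R sol1 sol2.
have mO : measurable Omega by exact: open_measurable_rV.
have ysL := LpL2_oo_L2QT ysoo.
have ys2 : \int[lebesgue_measure]_(t in time T) sqr_slice T Omega ystar t = normystar ^+ 2.
  rewrite -(LpL2_norm2 ysoo ysn) Rintegral_mkcond; apply: eq_Rintegral => t _.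
  rewrite patchE; case: ifPn => //; rewrite notin_setE => tT.
  rewrite /ip (@eq_Rintegral _ _ _ (lebesgue_rV d) _ (fun=> 0)); first by rewrite /Rintegral integral0.
  by move=> x _; rewrite zext_out// mul0r.
have ctrl_le (u : control R d J K) : in_U Omega u -> (U_norm Omega u <= RU%:E)%E -> ctrl_sqr Omega u <= RU ^+ 2.
  by move=> uU; rewrite U_normE// => uR; apply: sqrt_le_sqr uR; [exact: ctrl_sqr_ge0|exact: ltW].
have init_le : init_sqr Omega a2 <= R0 ^+ 2.
  by move: a2R; rewrite X0_normE// => aR; apply: sqrt_le_sqr aR; [exact: init_sqr_ge0|exact: ltW].
have -> : w0 = (fun k => w k 0) by apply/funext => k; rewrite w0E.
rewrite -f0E U_normE ?X0_normE; last 2 first.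
- exact: in_X0_sub.
- exact: in_U_sub.
rewrite -!EFin_expe !sqr_sqrtr ?ctrl_sqr_ge0 ?init_sqr_ge0// -EFinD poweR2V_EFin; last first.
  by rewrite addr_ge0 ?ctrl_sqr_ge0 ?init_sqr_ge0.
rewrite -EFinM.
exact: (X2_norm_le T0 D0 mO Ovol beta0 (lipschitz_dist fL) (fun k => lipschitz_dist (wL k)) ysL ys2
  u1U u2U (ctrl_le _ u1U u1R) (ctrl_le _ u2U u2R) init_le sol1 sol2).
Qed.
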